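(* Let $k,p,m\ge1$ be integers, $\Gamma\in\mathbb{R}^{p\times p}$ symmetric positive definite, $\epsilon>0$, $R>0$. Let $A$ be a Fourier measurement operator having the RIP with constant $\gamma\in[0,1)$ on $\mathcal{S}(\Sigma_{k,\epsilon/2,\Gamma})$ with respect to $\|\cdot\|_K$, where $K$ is a Gaussian kernel with covariance proportional to $\Gamma$ satisfying the kernel assumption with constant $c_K\in[0,1)$ (see context). Suppose $e=0$, i.e. $y=Ax_0$ with $x_0\in\Sigma_{k,\epsilon,\Gamma}$. Let $g(\theta)=\|A\phi(\theta)-y\|_2^2$ with $\phi(a_1,\dots,a_k,t_1,\dots,t_k)=\sum_{i=1}^k a_i\mu_{t_i}$, and let $\theta^*=(a_1,\dots,a_k,t_1,\dots,t_k)\in\Theta_{k,\epsilon}$ be a minimizer of $g$ over $\Theta_{k,\epsilon}$ with $0<|a_1|\le|a_2|\le\dots\le|a_k|$. Let $$\beta_{GMM}=\min\left(\frac{\epsilon\sqrt{\lambda_{\min}(\Gamma)}}{8},\ \frac{|a_1|}{2},\ \frac{(1-\gamma)(1-c_K)\min(1,d_K|a_1|^2)}{8\,C_{\phi,\theta^*}\sqrt{1+\gamma}\left(\sqrt{1+\gamma}\sqrt{1+c_K}\sqrt{D_K}+2|a_k|D'_{A,K}\right)}\right),$$ where $\lambda_{\min}(\Gamma)$ is the minimum eigenvalue of $\Gamma$ and the constants $d_K,D_K,D'_{A,K},C_{\phi,\theta^*}>0$ are described in the context. Suppose additionally that $\|t_i\|_2\le R-2\beta_{GMM}$ for all $i$.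 Then $\Lambda_{\beta_{GMM}}:=\{\theta\in\mathbb{R}^{k(p+1)}:\|\theta-\theta^*\|_2<\beta_{GMM}\}$ is a $g$-basin of attraction of $\theta^*$.
   Context: Model. $\|u\|_\Gamma^2=u^T\Gamma^{-1}u$; $\mu_s$ is the finite measure on $\mathbb{R}^p$ with density $t\mapsto e^{-\frac12\|t-s\|_\Gamma^2}$. For $\eta>0$, $\Sigma_{k,\eta,\Gamma}=\{\sum_{i=1}^ka_i\mu_{t_i}: a_i\in\mathbb{R},\ \|t_i\|_2<R,\ \|t_i-t_j\|_\Gamma>\eta\text{ for }i\ne j\}$ and $\Theta_{k,\eta}=\{(a_1,\dots,a_k,t_1,\dots,t_k)\in\mathbb{R}^{k(p+1)}: \|t_i\|_2<R,\ \|t_i-t_j\|_\Gamma>\eta\text{ for }i\neq j\}$. $\mathcal{S}(\Sigma)=\Sigma-\Sigma$ is the set of differences of elements of $\Sigma$. Measurements. A Fourier measurement operator is $(A\nu)_l=\int\alpha_l\,\mathrm d\nu$, $1\le l\le m$, on finite signed measures $\nu$ on $\mathbb{R}^p$, where each $\alpha_l$ is a weighted Fourier exponential $\alpha_l(t)=c_le^{-\mathrm{i}\langle\omega_l,t\rangle}$ with $c_l\in\mathbb{C}\setminus\{0\}$, $\omega_l\in\mathbb{R}^p$. Kernel norm. $K(t)=\kappa e^{-\frac12\lambda^2\|t\|_\Gamma^2}$ for some $\kappa,\lambda>0$, and $\|\nu\|_K^2=\iint K(t-s)\,\mathrm d\nu(t)\,\mathrm d\nu(s)$ for finite signed measures $\nu$.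 $A$ has the RIP on $\mathcal{S}(\Sigma)$ with constant $\gamma$ if $(1-\gamma)\|\nu\|_K^2\le\|A\nu\|_2^2\le(1+\gamma)\|\nu\|_K^2$ for all $\nu\in\mathcal{S}(\Sigma)$. Derivatives. $\partial_w\mu_s$ is the finite signed measure with density $t\mapsto-w^T\Gamma^{-1}(t-s)e^{-\frac12\|t-s\|_\Gamma^2}$. Kernel assumption with constant $c_K$: (i) $\|\mu_s\|_K=1$ for all $s$; (ii) for any $k$ means $(t_i)$ with $\|t_i-t_j\|_\Gamma>\epsilon$ for $i\ne j$, and all $v_i,a_i\in\mathbb{R}$, $w_i\in\mathbb{R}^p$, $\|\sum_iv_i\mu_{t_i}+a_i\partial_{w_i}\mu_{t_i}\|_K^2\ge(1-c_K)\sum_i\|v_i\mu_{t_i}+a_i\partial_{w_i}\mu_{t_i}\|_K^2$. Constants. $d_K>0$ is a constant depending only on the kernel such that $\|\partial_w\mu_s\|_K^2\ge d_K\|w\|_2^2$ for all $w,s\in\mathbb{R}^p$. $D_K=\int_{\mathbb{R}^p}\int_{\mathbb{R}^p}K(t-s)\|\Gamma^{-1}s\|_2\|\Gamma^{-1}t\|_2e^{-\frac12\|s\|_\Gamma^2}e^{-\frac12\|t\|_\Gamma^2}\,\mathrm dt\,\mathrm ds$. $D'_{A,K}=\sqrt{\sum_{l=1}^m\sup_{t}|\alpha_l(t)|^2}\;\max\left(\frac{1}{\lambda_{\min}(\Gamma)}\int_{\mathbb{R}^p}e^{-\frac12\|t\|_\Gamma^2}\mathrm dt,\ \int_{\mathbb{R}^p}\|\Gamma^{-1}t\|_2e^{-\frac12\|t\|_\Gamma^2}\mathrm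 dt\right)$. $C_{\phi,\theta^*}>0$ is a local Lipschitz constant: $\|\phi(\theta)-\phi(\theta^* )\|_K\le C_{\phi,\theta^*}\|\theta-\theta^*\|_2$ for all $\theta$ with $\|\theta-\theta^*\|_2<2\min(\epsilon\sqrt{\lambda_{\min}(\Gamma)}/8,|a_1|/2)$. $g$-basin of attraction. A set $\Lambda$ with $\theta^*\in\Lambda$ is a $g$-basin of attraction of $\theta^*$ if there is $\tau_0>0$ such that for any $\tau\in(0,\tau_0]$ and any $\theta_0\in\Lambda$, the sequence $\theta_{n+1}=\theta_n-\tau\nabla g(\theta_n)$ satisfies $g(\theta_n)\to g(\theta^* )$. *)

(* Defs.v *)
From HB Require Import structures.
From mathcomp Require Import all_boot all_order all_algebra.
From mathcomp Require Import all_classical all_reals all_analysis.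
From mathcomp Require Import measurable_realfun complex.

Set Implicit Arguments.
Unset Strict Implicit.
Unset Printing Implicit Defensive.

Import Order.TTheory GRing.Theory Num.Theory.
Import numFieldNormedType.Exports.

Local Open Scope classical_set_scope.
Local Open Scope ring_scope.

(* The library provides no Lebesgue measure on R^p.  We build it on p-tuples
   (with their product sigma-algebra) by induction on p, as the image of the
   product measure lambda \x lambda^p under (x, t) |-> x :: t.  Tuples are
   only the carrier of the sigma-algebra; vectors are columns 'cV[R]_p, and
   vec_of_tuple identifies the two. *)

Notation Rtuple R n := (n.-tuple (measurableTypeR R)).

Section lebesgue_succ.
Context {R : realType} {n : nat}.
Variable mu : {sigma_finite_measure set (Rtuple R n) -> \bar R}.

Definition tuple_cons (xt : measurableTypeR R * Rtuple R n) : Rtuple R n.+1 :=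
  [tuple of xt.1 :: xt.2].

Let tuple_uncons (t : Rtuple R n.+1) : measurableTypeR R * Rtuple R n :=
  (thead t, [tuple of behead t]).

Let tuple_consK : cancel tuple_cons tuple_uncons.
Proof. by move=> [x t]; congr pair; exact/val_inj. Qed.

Lemma measurable_tuple_cons : measurable_fun setT tuple_cons.
Proof. exact: measurable_cons. Qed.

Let measurable_tuple_uncons : measurable_fun setT tuple_uncons.
Proof.
by apply: measurable_fun_pair; [exact: measurable_tnth|exact: measurable_behead].
Qed.

Definition lebesgue_succ : set (Rtuple R n.+1) -> \bar R :=
  pushforward (lebesgue_measure \x mu)%E tuple_cons.

Let lebesgue_succ_measure : {measure set (Rtuple R n.+1) -> \bar R} :=
  measure_function_pushforward__canonical__measure_function_Measure
    (lebesgue_measure \x mu)%E measurable_tuple_cons.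

HB.instance Definition _ := isMeasure.Build _ _ _ lebesgue_succ
  (measure0 lebesgue_succ_measure) (measure_ge0 lebesgue_succ_measure)
  (@measure_semi_sigma_additive _ _ _ lebesgue_succ_measure).

Let product_sigma_finite : sigma_finite setT (@lebesgue_measure R \x mu)%E.
Proof.
have /sigma_finiteP[F [TF ndF Foo]] := sigma_finiteT (@lebesgue_measure R).
have /sigma_finiteP[G [TG ndG Goo]] := sigma_finiteT mu.
exists (fun i => F i `*` G i).
  rewrite -setXTT TF TG predeqE => -[x y]; split.
    move=> [/= [i _ Fix] [j _ Gjy]]; exists (maxn i j) => //; split.
    - by move: x Fix; exact/subsetPset/ndF/leq_maxl.
    - by move: y Gjy; exact/subsetPset/ndG/leq_maxr.
  by move=> [i _ []/= ? ?]; split; exists i.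
move=> i; have [? ?] := Foo i; have [? ?] := Goo i.
split; first exact: measurableX.
by rewrite product_measure1E// lte_mul_pinfty// ge0_fin_numE.
Qed.

Let lebesgue_succ_sigma_finite : sigma_finite setT lebesgue_succ.
Proof.
have [F FT Foo] := product_sigma_finite.
exists (fun i => tuple_uncons @^-1` F i).
  by rewrite -preimage_bigcup -FT preimage_setT.
move=> i; have [mF Fi] := Foo i; split.
  by rewrite -[X in measurable X]setTI; exact: measurable_tuple_uncons.
rewrite /lebesgue_succ /pushforward -comp_preimage.
by rewrite (_ : _ \o _ = id) ?preimage_id//; apply/funext => x; exact: tuple_consK.
Qed.

HB.instance Definition _ := Measure_isSigmaFinite.Build _ _ _ lebesgue_succ
  lebesgue_succ_sigma_finite.

End lebesgue_succ.

Fixpoint lebesgue_tuple (R : realType) (n : nat) :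
    {sigma_finite_measure set (Rtuple R n) -> \bar R} :=
  if n is n'.+1 then lebesgue_succ (lebesgue_tuple R n') else \d_[tuple].

Lemma measurable_box (R : realType) n (A : 'I_n -> set (measurableTypeR R)) :
  (forall i, measurable (A i)) ->
  measurable [set t : Rtuple R n | forall i, A i (tnth t i)].
Proof.
move=> mA.
rewrite (_ : mkset _ = \bigcap_(i in [set: 'I_n])
    ((fun t : Rtuple R n => tnth t i) @^-1` A i)).
  apply: fin_bigcap_measurable => // i _.
  by rewrite -[X in measurable X]setTI; exact: measurable_tnth.
by apply/seteqP; split => t /= h i; [move=> _|]; exact: h.
Qed.

Lemma lebesgue_tuple_box (R : realType) n (A : 'I_n -> set (measurableTypeR R)) :
  (forall i, measurable (A i)) ->
  lebesgue_tuple R n [set t | forall i, A i (tnth t i)] =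
  (\prod_(i < n) lebesgue_measure (A i))%E.
Proof.
elim: n A => [|n ih] A mA.
  rewrite big_ord0 /= diracE mem_set// => -[]//.
rewrite big_ord_recl -ih// /= /lebesgue_succ /pushforward.
have -> : tuple_cons @^-1` [set t | forall i, A i (tnth t i)] =
  A ord0 `*` [set t : Rtuple R n | forall i, A (lift ord0 i) (tnth t i)].
  apply/seteqP; split => -[x t] /=.
    move=> h; split; first exact: (h ord0).
    by move=> i; have := h (lift ord0 i); rewrite tnthS.
  move=> [Ax At] i; case: (unliftP ord0 i) => [j ->|-> //].
  by rewrite tnthS.
rewrite product_measure1E//.
by apply: (@measurable_box R n (fun i => A (lift ord0 i))) => i; exact: mA.
Qed.

Section signed_measures.
Context d (T : measurableType d) (R : realType).
Implicit Types nu : {charge set T -> \bar R}.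

Definition charge_add nu1 nu2 : {charge set T -> \bar R} := cadd nu1 nu2.

Definition charge_sub nu1 nu2 : {charge set T -> \bar R} :=
  cadd nu1 (cscale (-1) nu2).

Definition charge_sum k (nu : 'I_k -> {charge set T -> \bar R}) :
    {charge set T -> \bar R} :=
  \big[charge_add/(czero : {charge set T -> \bar R})]_(i < k) nu i.

Definition charge_lincomb k (a : 'I_k -> R)
    (nu : 'I_k -> {charge set T -> \bar R}) : {charge set T -> \bar R} :=
  @charge_sum k (fun i => cscale (a i) (nu i)).

Definition charge_diff (S : set ({charge set T -> \bar R})) :
    set ({charge set T -> \bar R}) :=
  [set nu | exists2 nu1, S nu1 & exists2 nu2, S nu2 & nu = charge_sub nu1 nu2].

(* The charge with density f w.r.t. mu; the fallback czero only makes the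
   definition total when f is not integrable. *)
Definition charge_density (mu : {measure set T -> \bar R}) (f : T -> R) :
    {charge set T -> \bar R} :=
  match pselect (mu.-integrable setT (EFin \o f)) with
  | left intf => induced_charge intf
  | right _ => czero
  end.

(* Integral against a signed measure through its Jordan decomposition; the
   value does not depend on the Hahn decomposition that is picked. *)
Definition charge_integral nu (f : T -> R) : R :=
  let: exist P exN := cid (Hahn_decomposition nu) in
  let: exist N nuPN := cid exN in
  \int[jordan_pos nuPN]_x f x - \int[jordan_neg nuPN]_x f x.

End signed_measures.

Section euclidean.
Context {R : realType}.

(* The library norm `|M| of a matrix is the sup norm. *)
Definition norm2 m n (M : 'M[R]_(m, n)) : R :=
  Num.sqrt (\sum_i \sum_j M i j ^+ 2).

Definition dotv p (u v : 'cV[R]_p) : R := (u^T *m v) 0 0.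

Definition posdefmx p (G : 'M[R]_p) : Prop :=
  G^T = G /\ forall u : 'cV[R]_p, u != 0 -> 0 < dotv u (G *m u).

(* For G symmetric and p > 0 the set of eigenvalues is finite and nonempty,
   so that this inf is a minimum. *)
Definition lambda_min p (G : 'M[R]_p) : R := inf [set l | eigenvalue G l].

Definition normG2 p (G : 'M[R]_p) (u : 'cV[R]_p) : R := dotv u (invmx G *m u).

Definition normG p (G : 'M[R]_p) (u : 'cV[R]_p) : R := Num.sqrt (normG2 G u).

Definition gradient n (g : 'rV[R]_n -> R) (x : 'rV[R]_n) : 'rV[R]_n :=
  \row_j 'D_(delta_mx 0 j) g x.

Definition gradient_step n (g : 'rV[R]_n -> R) (tau : R) (x : 'rV[R]_n) :
    'rV[R]_n := x - tau *: gradient g x.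

Definition basin_of_attraction n (g : 'rV[R]_n -> R) (xs : 'rV[R]_n)
    (L : set 'rV[R]_n) : Prop :=
  L xs /\
  exists2 tau0 : R, 0 < tau0 &
    forall tau : R, 0 < tau -> tau <= tau0 -> forall x0, L x0 ->
      (fun n => g (iter n (gradient_step g tau) x0)) @ \oo --> g xs.

End euclidean.

Section measures_on_Rp.
Context {R : realType} {p : nat}.

Definition smeasure : Type := {charge set (Rtuple R p) -> \bar R}.

Definition vec_of_tuple (t : Rtuple R p) : 'cV[R]_p := \col_i tnth t i.

Definition sint (nu : smeasure) (f : 'cV[R]_p -> R) : R :=
  charge_integral nu (f \o vec_of_tuple).

Definition lint (f : 'cV[R]_p -> R) : R :=
  \int[lebesgue_tuple R p]_t f (vec_of_tuple t).

Definition with_density (f : 'cV[R]_p -> R) : smeasure :=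
  charge_density (lebesgue_tuple R p) (f \o vec_of_tuple).

Definition gauss (G : 'M[R]_p) (u : 'cV[R]_p) : R := expR (- (normG2 G u / 2)).

Definition gauss_measure (G : 'M[R]_p) (s : 'cV[R]_p) : smeasure :=
  with_density (fun t => gauss G (t - s)).

Definition dgauss_measure (G : 'M[R]_p) (w s : 'cV[R]_p) : smeasure :=
  with_density (fun t => - dotv w (invmx G *m (t - s)) * gauss G (t - s)).

Definition gaussian_mixture (G : 'M[R]_p) k (a : 'I_k -> R)
    (t : 'I_k -> 'cV[R]_p) : smeasure :=
  charge_lincomb a (fun i => gauss_measure G (t i)).

Definition separated (G : 'M[R]_p) (eta : R) k (t : 'I_k -> 'cV[R]_p) : Prop :=
  forall i j, i != j -> eta < normG G (t i - t j).

Definition Sigma k (eta rad : R) (G : 'M[R]_p) : set smeasure :=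
  [set nu | exists (a : 'I_k -> R) (t : 'I_k -> 'cV[R]_p),
     [/\ forall i, norm2 (t i) < rad, separated G eta t
       & nu = gaussian_mixture G a t]].

(* theta = (a_1, ..., a_k, t_1, ..., t_k), each t_i being a block of p
   consecutive coordinates. *)
Definition amplitude k (theta : 'rV[R]_(k + k * p)) (i : 'I_k) : R :=
  lsubmx theta 0 i.

Definition mean k (theta : 'rV[R]_(k + k * p)) (i : 'I_k) : 'cV[R]_p :=
  (row i (vec_mx (rsubmx theta)))^T.

Definition phi (G : 'M[R]_p) k (theta : 'rV[R]_(k + k * p)) : smeasure :=
  gaussian_mixture G (amplitude theta) (mean theta).

Definition Theta k (eta rad : R) (G : 'M[R]_p) :
    set 'rV[R]_(k + k * p) :=
  [set theta | (forall i, norm2 (mean theta i) < rad) /\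
               separated G eta (mean theta)].

Definition knorm2 (K : 'cV[R]_p -> R) (nu : smeasure) : R :=
  sint nu (fun s => sint nu (fun t => K (t - s))).

Definition knorm (K : 'cV[R]_p -> R) (nu : smeasure) : R :=
  Num.sqrt (knorm2 K nu).

Definition gaussian_kernel (G : 'M[R]_p) (K : 'cV[R]_p -> R) : Prop :=
  exists kappa lambda : R, [/\ 0 < kappa, 0 < lambda &
    forall t, K t = kappa * expR (- (lambda ^+ 2 * normG2 G t / 2))].

Definition kernel_assumption (G : 'M[R]_p) (K : 'cV[R]_p -> R) (k : nat)
    (eps cK : R) : Prop :=
  (forall s, knorm K (gauss_measure G s) = 1) /\
  (forall t : 'I_k -> 'cV[R]_p, separated G eps t ->
   forall (v a : 'I_k -> R) (w : 'I_k -> 'cV[R]_p),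
     let nu i : smeasure :=
       charge_add (cscale (v i) (gauss_measure G (t i)))
                  (cscale (a i) (dgauss_measure G (w i) (t i))) in
     (1 - cK) * \sum_i knorm2 K (nu i)
       <= knorm2 K (charge_sum nu)).

(* alpha t = c e^(- i <omega, t>) *)
Definition weighted_fourier (alpha : 'cV[R]_p -> R[i]) : Prop :=
  exists (c : R[i]) (omega : 'cV[R]_p), c != 0 /\
    forall t, alpha t = c * Complex (cos (dotv omega t)) (- sin (dotv omega t)).

Definition measurement m (alpha : 'I_m -> 'cV[R]_p -> R[i]) (nu : smeasure) :
    'cV[R[i]]_m :=
  \col_l Complex (sint nu (fun t => complex.Re (alpha l t)))
                 (sint nu (fun t => complex.Im (alpha l t))).

Definition sqnormC m (z : 'cV[R[i]]_m) : R :=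
  \sum_l Normc.normc (z l 0) ^+ 2.

Definition RIP m (alpha : 'I_m -> 'cV[R]_p -> R[i]) (K : 'cV[R]_p -> R)
    (S : set smeasure) (gamma : R) : Prop :=
  forall nu, S nu ->
    (1 - gamma) * knorm2 K nu <= sqnormC (measurement alpha nu) /\
    sqnormC (measurement alpha nu) <= (1 + gamma) * knorm2 K nu.

Definition DK_const (G : 'M[R]_p) (K : 'cV[R]_p -> R) : R :=
  lint (fun s => lint (fun t =>
    K (t - s) * norm2 (invmx G *m s) * norm2 (invmx G *m t)
      * gauss G s * gauss G t)).

Definition DAK_const (G : 'M[R]_p) m (alpha : 'I_m -> 'cV[R]_p -> R[i]) : R :=
  Num.sqrt (\sum_l sup (range (fun t => Normc.normc (alpha l t) ^+ 2)))
  * Num.max ((lambda_min G)^-1 * lint (gauss G))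
            (lint (fun t => norm2 (invmx G *m t) * gauss G t)).

End measures_on_Rp.

Arguments Sigma {R p} k eta rad G.
Arguments Theta {R p} k eta rad G.

(* Main.v *)
(* Writing F for the noiseless measurement of a parameter vector, F(theta) is an
   explicit sum of exponentials: by translation invariance its l-th coordinate is
   sum_i a_i d_l e^(-i <om_l, t_i>), where d_l is alpha_l integrated against the
   centred Gaussian.  Since y = F(theta0) for some theta0 in Theta, the minimizer
   satisfies F(thetas) = y, so g(theta) = |F(theta) - F(thetas)|^2.

   Letting h -> 0 in the RIP for phi(thetas + h u) - phi(thetas), the kernel
   assumption gives |F'(thetas) u| >= sqrt(mu) |u| with
   mu = (1 - gamma)(1 - cK) min(1, dK a_1^2).  In the ball of radius beta the
   second-order Taylor remainder of F at thetas is a small fraction of this, and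
   hence <grad g(theta), theta - thetas> >= g(theta).  Together with
   |grad g|^2 <= L g, each gradient step with tau <= 1/(L + 1) lowers
   |theta - thetas|^2 by at least tau g(theta), which forces g(theta_n) -> 0. *)

Require Import Defs.
From HB Require Import structures.
From mathcomp Require Import all_boot all_order all_algebra.
From mathcomp Require Import all_classical all_reals all_analysis.
From mathcomp Require Import complex.
From mathcomp Require Import measurable_realfun ring lra.

Set Implicit Arguments.
Unset Strict Implicit.
Unset Printing Implicit Defensive.

Import Order.TTheory GRing.Theory Num.Theory.
Import numFieldNormedType.Exports.

Local Open Scope classical_set_scope.
Local Open Scope ring_scope.

(** * Charges with a density *)

(** The kernel norm is an iterated integral against Jordan parts, a form in which linearity is not
    visible. Charges are therefore handled through Lebesgue densities, on which it becomes a
    bilinear form bounded in L1. Differentiating a mixture then means an explicit L1 error of order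
    h^2, obtained from e^x >= 1 + x and translation invariance, without differentiation under the
    integral sign. The constants in beta come from three sources. The second-order remainder of F
    needs the first and second order speed of one atom: the upper RIP on a single moving Gaussian
    gives sqrt(1 + gamma) sqrt(D_K), and the decay of the Fourier transform of the Gaussian gives
    D'. The factor min(1, d_K a_1^2) comes from the K-orthogonality of a Gaussian to its derivative,
    a consequence of all translates having K-norm 1. The factors C, sqrt(1 + gamma) and sqrt(1 +
    c_K) are at least 1; for C this holds because moving a_1 alone changes phi at unit speed. *)

Lemma le_bounded (T : Type) (R : realType) (A : set T) (h : T -> R) (M : R) :
  (forall x, `|h x| <= M) -> [bounded h x | x in A].
Proof.
move=> hM; exists M; split; first exact: num_real.
by move=> y My x _ /=; rewrite (le_trans (hM x))// ltW.
Qed.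

Section density.
Context d (T : measurableType d) (R : realType).
Variable mu : {sigma_finite_measure set T -> \bar R}.
Implicit Types (nu : {charge set T -> \bar R}) (f h : T -> R).

(** A relation instead of a Radon-Nikodym derivative: the density of a combination of charges can be
    written down pointwise, and no almost-everywhere class has to be chosen. *)
Definition has_density nu f :=
  mu.-integrable setT (EFin \o f) /\
  forall A, measurable A -> nu A = (\int[mu]_(x in A) (f x)%:E)%E.

Lemma has_density_dominates nu f : has_density nu f -> nu `<< mu.
Proof.
move=> [intf nuE]; apply/null_content_dominatesP => A mA muA0.
rewrite nuE// null_set_integral//.
by apply: measurable_funTS; exact: measurable_int intf.
Qed.

Lemma integrable_patch f (Q : set T) : mu.-integrable setT (EFin \o f) ->
  measurable Q -> mu.-integrable setT (fun x => ((f \_ Q) x)%:E).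
Proof.
move=> intf mQ.
have -> : (fun x => ((f \_ Q) x)%:E) = (EFin \o f) \_ Q.
  by apply/funext => x; rewrite /patch; case: ifP.
apply: (@integrable_mkcond _ _ _ mu Q (EFin \o f) mQ).1.
exact: (integrableS measurableT).
Qed.

(** On a Hahn decomposition (P, N) the Jordan parts have densities f on P and -f on N. The two
    integrals recombine pointwise because P and N partition the space. Boundedness of h supplies
    integrability. *)
Lemma charge_integral_density nu f h (M : R) : has_density nu f ->
  measurable_fun setT h -> (forall x, `|h x| <= M) ->
  charge_integral nu h = \int[mu]_x (h x * f x).
Proof.
move=> nuf mh hM; have [intf nuE] := nuf.
have dom := has_density_dominates nuf.
rewrite /charge_integral.
case: cid => P exN; case: cid => N nuPN.
have [[mP _] [mN _] PN PN0] := nuPN.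
have mf : measurable_fun setT (EFin \o f) by exact: measurable_int intf.
(* Used for both Jordan parts, with c = 1 on P and c = -1 on N. Uniqueness of densities identifies
   the Radon-Nikodym derivative of [lam] almost everywhere. *)
have key (lam : {finite_measure set T -> \bar R}) (Q : set T) (c : R) :
    measurable Q -> lam `<< mu ->
    (forall A, measurable A -> lam A = c%:E * nu (A `&` Q))%E ->
    (\int[lam]_x (h x)%:E = \int[mu]_x (h x * (c * (f \_ Q) x))%:E)%E.
  move=> mQ ldom lamE.
  have mfQ : measurable_fun setT (f \_ Q).
    by apply/(measurable_restrictT f mQ); apply: measurable_funTS; exact/measurable_EFinP.
  rewrite -(@Radon_Nikodym_change_of_variables _ _ _ lam mu ldom (EFin \o h) setT measurableT);
    last first.
    apply: measurable_bounded_integrable => //; first by rewrite ltey_eq fin_num_measure.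
    exact: le_bounded hM.
  have -> : (\int[mu]_x (h x * (c * (f \_ Q) x))%:E =
    \int[mu]_x ((h x)%:E * (c * (f \_ Q) x)%:E))%E.
    by apply: eq_integral => x _; rewrite EFinM.
  apply: ae_eq_integral => //.
  - apply: emeasurable_funM; first exact/measurable_EFinP.
    by apply: (measurable_int mu); exact: Radon_Nikodym_integrable.
  - apply: emeasurable_funM; first exact/measurable_EFinP.
    by apply/measurable_EFinP; exact: measurable_funM.
  - apply: ae_eqe_mul2l; apply: integral_ae_eq => //.
    + exact: Radon_Nikodym_integrable.
    + by apply/measurable_EFinP; exact: measurable_funM.
    + move=> A _ mA; rewrite -Radon_Nikodym_integral//.
      rewrite [LHS]lamE// nuE; last exact: measurableI.
      under [RHS]eq_integral do rewrite EFinM.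
      rewrite integralZl//; last first.
        apply: (integrableS measurableT) => //.
        exact: integrable_patch.
      congr (_ * _)%E; rewrite integral_mkcondr.
      by apply: eq_integral => x _; rewrite /patch; case: ifP.
have hpos : (\int[jordan_pos nuPN]_x (h x)%:E = \int[mu]_x (h x * (1 * (f \_ P) x))%:E)%E.
  apply: key => //; first exact: jordan_pos_dominates.
  move=> A mA; change (jordan_pos nuPN A = 1%:E * nu (A `&` P))%E.
  rewrite jordan_posE cjordan_posE /crestr0 mem_set//= /crestr/=.
  by rewrite mul1e.
have hneg : (\int[jordan_neg nuPN]_x (h x)%:E = \int[mu]_x (h x * (-1 * (f \_ N) x))%:E)%E.
  apply: key => //; first exact: jordan_neg_dominates.
  move=> A mA; change (jordan_neg nuPN A = (-1)%:E * nu (A `&` N))%E.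
  rewrite jordan_negE cjordan_negE /crestr0 mem_set//= /crestr/=.
  by rewrite mulN1e.
rewrite {1 2}/Rintegral hpos hneg.
have iQ (c : R) (Q : set T) : measurable Q ->
    mu.-integrable setT (fun x => (h x * (c * (f \_ Q) x))%:E).
  move=> mQ; apply: (@integrableMr _ _ _ _ _ _ h (fun x => (c * (f \_ Q) x)%:E)) => //.
    exact: le_bounded hM.
  by apply: (eq_integrable measurableT) (integrableZl measurableT c (integrable_patch intf mQ)).
rewrite -fineB; [|exact: integrable_fin_num (iQ 1 P mP)|exact: integrable_fin_num (iQ (-1) N mN)].
rewrite /Rintegral; congr fine; rewrite -integralB//; [|exact: iQ|exact: iQ].
apply: eq_integral => x _; rewrite -EFinB; congr EFin.
have : (P `|` N) x by rewrite PN.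
have : ~ (P `&` N) x by rewrite PN0.
rewrite /patch /= => nPN PNx.
have [xP|xP] := boolP (x \in P); have [xN|xN] := boolP (x \in N) => //;
  rewrite ?mul0r ?mulr0 ?mul1r ?subr0 ?sub0r ?mulN1r ?mulrN ?opprK//.
- by exfalso; apply: nPN; split; exact: set_mem.
- by exfalso; case: PNx => /mem_set; rewrite ?(negbTE xP) ?(negbTE xN).
Qed.

Lemma has_density0 : has_density czero (fun=> 0).
Proof.
split; first exact: integrable0.
by move=> A mA; rewrite integral0.
Qed.

Lemma has_density_charge_density f : mu.-integrable setT (EFin \o f) ->
  has_density (charge_density mu f) f.
Proof. by move=> intf; rewrite /charge_density; case: pselect. Qed.

Lemma has_density_add nu1 nu2 f1 f2 : has_density nu1 f1 -> has_density nu2 f2 ->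
  has_density (charge_add nu1 nu2) (fun x => f1 x + f2 x).
Proof.
move=> [i1 e1] [i2 e2]; split.
  by apply: (eq_integrable measurableT) (integrableD measurableT i1 i2).
move=> A mA; change (nu1 A + nu2 A = \int[mu]_(x in A) (f1 x + f2 x)%:E)%E.
rewrite e1// e2//.
rewrite -integralD//; first exact: integrableS i1.
exact: integrableS i2.
Qed.

Lemma has_density_scale nu f (c : R) : has_density nu f ->
  has_density (cscale c nu) (fun x => c * f x).
Proof.
move=> [i1 e1]; split.
  by apply: (eq_integrable measurableT) (integrableZl measurableT c i1).
move=> A mA; change (c%:E * nu A = \int[mu]_(x in A) (c * f x)%:E)%E.
rewrite e1//.
by rewrite -integralZl//; exact: integrableS i1.
Qed.

Lemma has_density_sub nu1 nu2 f1 f2 : has_density nu1 f1 -> has_density nu2 f2 ->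
  has_density (charge_sub nu1 nu2) (fun x => f1 x - f2 x).
Proof.
move=> d1 d2; have := has_density_add d1 (has_density_scale (-1) d2).
by under [X in has_density _ X -> _]eq_fun do rewrite mulN1r.
Qed.

Lemma has_density_sum k (nu : 'I_k -> {charge set T -> \bar R}) (f : 'I_k -> T -> R) :
  (forall i, has_density (nu i) (f i)) ->
  has_density (charge_sum nu) (fun x => \sum_i f i x).
Proof.
move=> d1; rewrite /charge_sum.
(* Writing the density as the same fold as [charge_sum] allows one simultaneous induction on the two
   folds. *)
have -> : (fun x => \sum_i f i x) = \big[(fun f g x => f x + g x)/(fun=> 0)]_(i < k) f i.
  by apply/funext => x; rewrite (big_morph (fun f => f x) (id1 := 0) (op1 := +%R)).
apply: (big_ind2 (fun nu f => has_density nu f)) => //; first exact: has_density0.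
by move=> ? ? ? ?; exact: has_density_add.
Qed.

End density.

(** * Integral kernels on densities *)

Section real_integrals.
Context d (T : measurableType d) (R : realType).
Variable mu : {measure set T -> \bar R}.
Implicit Types f g h : T -> R.

Lemma integrable_fun_D f g : mu.-integrable setT (EFin \o f) ->
  mu.-integrable setT (EFin \o g) -> mu.-integrable setT (EFin \o (fun x => f x + g x)).
Proof. by move=> i1 i2; apply: (eq_integrable measurableT) (integrableD measurableT i1 i2). Qed.

Lemma integrable_fun_Z f (c : R) : mu.-integrable setT (EFin \o f) ->
  mu.-integrable setT (EFin \o (fun x => c * f x)).
Proof. by move=> i1; apply: (eq_integrable measurableT) (integrableZl measurableT c i1). Qed.

Lemma integrable_fun_B f g : mu.-integrable setT (EFin \o f) ->
  mu.-integrable setT (EFin \o g) -> mu.-integrable setT (EFin \o (fun x => f x - g x)).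
Proof. by move=> i1 i2; apply: (eq_integrable measurableT) (integrableB measurableT i1 i2). Qed.

Lemma integrable_fun_norm f : mu.-integrable setT (EFin \o f) ->
  mu.-integrable setT (EFin \o (fun x => `|f x|)).
Proof. by move=> i1; apply: (eq_integrable measurableT) (integrable_abse i1). Qed.

Lemma integrable_fun_sum k (f : 'I_k -> T -> R) :
  (forall i, mu.-integrable setT (EFin \o f i)) ->
  mu.-integrable setT (EFin \o (fun x => \sum_i f i x)).
Proof.
move=> intf.
have := @integrable_sum _ _ _ mu _ measurableT _ (index_enum 'I_k) xpredT
  (fun i => EFin \o f i) (fun i _ => intf i).
apply: eq_integrable => //.
by move=> x _; rewrite /= -sumEFin.
Qed.

Lemma integrable_fun_bounded_mul h f (M : R) : measurable_fun setT h ->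
  (forall x, `|h x| <= M) -> mu.-integrable setT (EFin \o f) ->
  mu.-integrable setT (EFin \o (fun x => h x * f x)).
Proof.
move=> mh hM intf.
have := integrableMr measurableT mh (le_bounded setT hM) intf.
exact: eq_integrable.
Qed.

Lemma Rintegral_sum k (f : 'I_k -> T -> R) :
  (forall i, mu.-integrable setT (EFin \o f i)) ->
  \int[mu]_x (\sum_i f i x) = \sum_i \int[mu]_x f i x.
Proof.
elim: k f => [|k ih] f intf.
  rewrite big_ord0 (eq_Rintegral _ (g := fun=> 0)); last by move=> x _; rewrite big_ord0.
  by rewrite Rintegral_cst// mul0r.
rewrite big_ord_recl -ih; last by move=> i; exact: intf.
rewrite -RintegralD//; last exact: integrable_fun_sum.
by apply: eq_Rintegral => x _; rewrite big_ord_recl.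
Qed.

Lemma le_normr_Rintegral_mul h f (M : R) : measurable_fun setT h ->
  (forall x, `|h x| <= M) -> mu.-integrable setT (EFin \o f) ->
  `|\int[mu]_x (h x * f x)| <= M * \int[mu]_x `|f x|.
Proof.
move=> mh hM intf; have inthf := integrable_fun_bounded_mul mh hM intf.
rewrite (le_trans (le_normr_Rintegral _ inthf))//.
rewrite -RintegralZl//; last exact: integrable_fun_norm.
apply: le_Rintegral => //; [exact: integrable_fun_norm inthf| |].
  exact/integrable_fun_Z/integrable_fun_norm.
by move=> x _; rewrite normrM ler_wpM2r.
Qed.

End real_integrals.

(** * Bilinear forms given by a bounded measurable kernel *)

Section kernel_form.
Context d (T : measurableType d) (R : realType).
Variable mu : {sigma_finite_measure set T -> \bar R}.
Variables (k : T * T -> R) (M : R).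
Hypotheses (mk : measurable_fun setT k) (kM : forall z, `|k z| <= M).
Implicit Types f g : T -> R.

(** The inner integral of [knorm2] on densities. Keeping the integrals iterated, in the order of
    [knorm2], avoids product integrals. *)
Definition kernel_potential g (s : T) : R := \int[mu]_t (k (s, t) * g t).

Definition kernel_form f g : R := \int[mu]_s (kernel_potential g s * f s).

Let kernel_bound_ge0 (s : T) : 0 <= M.
Proof. exact: le_trans (kM (s, s)). Qed.

Lemma measurable_kernel_section s : measurable_fun setT (fun t => k (s, t)).
Proof. by apply: measurableT_comp => //; exact: measurable_pair1. Qed.

Lemma kernel_potential_bound g : mu.-integrable setT (EFin \o g) ->
  forall s, `|kernel_potential g s| <= M * \int[mu]_t `|g t|.
Proof.
by move=> intg s; apply: le_normr_Rintegral_mul => //; exact: measurable_kernel_section.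
Qed.

Let integrable_section g s : mu.-integrable setT (EFin \o g) ->
  mu.-integrable setT (EFin \o (fun t => k (s, t) * g t)).
Proof.
move=> intg; apply: (@integrable_fun_bounded_mul _ _ _ _ _ _ M) => //.
exact: measurable_kernel_section.
Qed.

(** Tonelli gives measurability only for nonnegative integrands. The kernel is shifted to k + M >= 0
    and g split into its positive and negative parts; the excess is the constant M times the
    integral of g. *)
Lemma measurable_kernel_potential g : mu.-integrable setT (EFin \o g) ->
  measurable_fun setT (kernel_potential g).
Proof.
move=> intg.
have mg : measurable_fun setT g by apply/measurable_EFinP; exact: measurable_int intg.
have pos (u : T -> R) : measurable_fun setT u -> (forall t, 0 <= u t) ->
    measurable_fun setT (fun s => \int[mu]_t ((k (s, t) + M) * u t)).
  move=> mu0 u0; apply: (measurableT_comp (f := fine)); first exact: fine_measurable.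
  have := @measurable_fun_fubini_tonelli_F _ _ T T R mu
    (fun z => ((k z + M) * u z.2)%:E).
  apply.
  - apply/measurable_EFinP; apply: measurable_funM.
      by apply: measurable_funD => //; exact: measurable_cst.
    by apply: measurableT_comp => //; exact: measurable_snd.
  - move=> z; rewrite lee_fin mulr_ge0//.
    by have := kM z; rewrite ler_norml => /andP[+ _]; rewrite lerNl -subr_ge0 opprK addrC.
have intm (u : T -> R) : measurable_fun setT u -> (forall t, `|u t| <= `|g t|) ->
    mu.-integrable setT (EFin \o u).
  move=> mu0 ug; apply: le_integrable intg => //; first exact/measurable_EFinP.
  by move=> t _; rewrite /= lee_fin ug.
pose gp t := Num.max (g t) 0; pose gn t := Num.max (- g t) 0.
have mgp : measurable_fun setT gp by exact: measurable_maxr.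
have mgn : measurable_fun setT gn.
  by apply: measurable_maxr => //; exact: measurableT_comp.
have igp : mu.-integrable setT (EFin \o gp).
  apply: intm => // t; rewrite /gp; case: (leP (g t) 0) => _ //.
  by rewrite normr0.
have ign : mu.-integrable setT (EFin \o gn).
  apply: intm => // t; rewrite /gn; case: (leP (- g t) 0) => _; rewrite ?normr0// normrN.
  exact: lexx.
have -> : kernel_potential g = fun s => \int[mu]_t ((k (s, t) + M) * gp t)
    - \int[mu]_t ((k (s, t) + M) * gn t) - M * \int[mu]_t g t.
  apply/funext => s.
  have isp (u : T -> R) : mu.-integrable setT (EFin \o u) ->
      mu.-integrable setT (EFin \o (fun t => (k (s, t) + M) * u t)).
    move=> iu; apply: (@integrable_fun_bounded_mul _ _ _ _ _ _ (M + M)) => //.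
      by apply: measurable_funD; [exact: measurable_kernel_section|exact: measurable_cst].
    by move=> t; rewrite (le_trans (ler_normD _ _))// lerD// ger0_norm// kernel_bound_ge0.
  rewrite -RintegralB//; [|exact: isp|exact: isp].
  rewrite -RintegralZl// -RintegralB//; last 2 first.
  - by apply: integrable_fun_B; exact: isp.
  - exact: integrable_fun_Z.
  apply: eq_Rintegral => t _; rewrite -mulrBr.
  have -> : gp t - gn t = g t.
    rewrite /gp /gn; case: (leP (g t) 0) => g0; case: (leP (- g t) 0) => g1; lra.
  by rewrite mulrDl addrK.
apply: measurable_funB; last exact: measurable_cst.
by apply: measurable_funB; apply: pos => // t; rewrite /gp /gn le_max lexx orbT.
Qed.

Lemma integrable_kernel_form f g : mu.-integrable setT (EFin \o f) ->
  mu.-integrable setT (EFin \o g) ->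
  mu.-integrable setT (EFin \o (fun s => kernel_potential g s * f s)).
Proof.
move=> intf intg; apply: integrable_fun_bounded_mul => //.
- exact: measurable_kernel_potential.
- exact: kernel_potential_bound.
Qed.

Lemma kernel_form_bound f g : mu.-integrable setT (EFin \o f) ->
  mu.-integrable setT (EFin \o g) ->
  `|kernel_form f g| <= M * (\int[mu]_s `|f s|) * \int[mu]_t `|g t|.
Proof.
move=> intf intg; rewrite mulrAC; apply: le_normr_Rintegral_mul => //.
- exact: measurable_kernel_potential.
- exact: kernel_potential_bound.
Qed.

Lemma kernel_formDl f1 f2 g : mu.-integrable setT (EFin \o f1) ->
  mu.-integrable setT (EFin \o f2) -> mu.-integrable setT (EFin \o g) ->
  kernel_form (fun x => f1 x + f2 x) g = kernel_form f1 g + kernel_form f2 g.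
Proof.
move=> i1 i2 ig; rewrite /kernel_form -RintegralD//; [|exact: integrable_kernel_form..].
by apply: eq_Rintegral => x _; rewrite mulrDr.
Qed.

Lemma kernel_formZl f g (c : R) : mu.-integrable setT (EFin \o f) ->
  mu.-integrable setT (EFin \o g) ->
  kernel_form (fun x => c * f x) g = c * kernel_form f g.
Proof.
move=> i1 ig; rewrite /kernel_form -RintegralZl//; last exact: integrable_kernel_form.
by apply: eq_Rintegral => x _; rewrite mulrCA.
Qed.

Lemma kernel_formDr f g1 g2 : mu.-integrable setT (EFin \o f) ->
  mu.-integrable setT (EFin \o g1) -> mu.-integrable setT (EFin \o g2) ->
  kernel_form f (fun x => g1 x + g2 x) = kernel_form f g1 + kernel_form f g2.
Proof.
move=> i1 ig1 ig2; rewrite /kernel_form -RintegralD//; [|exact: integrable_kernel_form..].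
apply: eq_Rintegral => x _; rewrite -mulrDl /kernel_potential -RintegralD//;
  [|exact: integrable_section..].
by congr (_ * _); apply: eq_Rintegral => y _; rewrite mulrDr.
Qed.

Lemma kernel_formZr f g (c : R) : mu.-integrable setT (EFin \o f) ->
  mu.-integrable setT (EFin \o g) ->
  kernel_form f (fun x => c * g x) = c * kernel_form f g.
Proof.
move=> i1 ig; rewrite /kernel_form -RintegralZl//; last exact: integrable_kernel_form.
apply: eq_Rintegral => x _; rewrite mulrA; congr (_ * _).
rewrite /kernel_potential -RintegralZl//; last exact: integrable_section.
by apply: eq_Rintegral => y _; rewrite mulrCA.
Qed.

(** Both cross terms are kept, since exchanging them would need Fubini and a symmetric kernel. *)
Lemma kernel_form_expand f g (a b : R) : mu.-integrable setT (EFin \o f) ->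
  mu.-integrable setT (EFin \o g) ->
  kernel_form (fun x => a * f x + b * g x) (fun x => a * f x + b * g x) =
  a ^+ 2 * kernel_form f f + a * b * (kernel_form f g + kernel_form g f)
  + b ^+ 2 * kernel_form g g.
Proof.
move=> i1 i2; have i1a := integrable_fun_Z a i1; have i2b := integrable_fun_Z b i2.
rewrite kernel_formDl ?kernel_formDr ?kernel_formZl ?kernel_formZr//;
  [ring|exact: integrable_fun_D].
Qed.

Lemma charge_double_integral_density (nu : {charge set T -> \bar R}) f :
  has_density mu nu f ->
  charge_integral nu (fun s => charge_integral nu (fun t => k (s, t))) = kernel_form f f.
Proof.
move=> nuf; have [intf _] := nuf.
have -> : (fun s => charge_integral nu (fun t => k (s, t))) = kernel_potential f.
  apply/funext => s; apply: (charge_integral_density nuf) => [|t].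
    exact: measurable_kernel_section.
  exact: kM.
apply: (charge_integral_density nuf); first exact: measurable_kernel_potential.
exact: kernel_potential_bound.
Qed.

End kernel_form.

(** * Translation invariance of Lebesgue measure *)

Section translation.
Context {R : realType}.

Lemma lebesgue_measure_shift (c : R) (A : set (measurableTypeR R)) : measurable A ->
  @lebesgue_measure R A = pushforward lebesgue_measure (fun x : measurableTypeR R => x + c) A.
Proof.
have mshift : measurable_fun setT ((fun x => x + c) : measurableTypeR R -> measurableTypeR R).
  by apply: measurable_funD => //; exact: measurable_cst.
move: A; apply: (@lebesgue_measure_unique R
  (measure_function_pushforward__canonical__measure_function_Measure lebesgue_measure mshift)).
move=> X [[a b] _ <-] /=; rewrite /pushforward.
have -> : (fun x : R => x + c) @^-1` `]a, b] = `](a - c), (b - c)]%classic.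
  by apply/seteqP; split => x /=; rewrite !in_itv/= ltrBlDr lerBrDr.
by rewrite !lebesgue_measure_itv/= !lte_fin ltrD2r -!EFinB; case: ifP => // _; congr EFin; ring.
Qed.

Lemma ge0_integral_shift (c : R) (f : measurableTypeR R -> \bar R) :
  measurable_fun setT f -> (forall x, (0 <= f x)%E) ->
  (\int[@lebesgue_measure R]_x f (x + c)%R = \int[@lebesgue_measure R]_x f x)%E.
Proof.
move=> mf f0.
have mshift : measurable_fun setT ((fun x => x + c) : measurableTypeR R -> measurableTypeR R).
  by apply: measurable_funD => //; exact: measurable_cst.
pose nu := measure_function_pushforward__canonical__measure_function_Measure
  (@lebesgue_measure R) mshift.
transitivity (\int[nu]_x f x)%E.
  by rewrite ge0_integral_pushforward.
apply: eq_measure_integral => A mA _.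
by rewrite [RHS](lebesgue_measure_shift c).
Qed.

Definition tuple_shift n (s : 'I_n -> R) (t : Rtuple R n) : Rtuple R n :=
  [tuple tnth t i + s i | i < n].

Lemma measurable_tuple_shift n (s : 'I_n -> R) : measurable_fun setT (tuple_shift s).
Proof.
apply/measurable_fun_tnthP => i /=.
apply: (eq_measurable_fun (fun t : Rtuple R n => tnth t i + s i)).
  by move=> t _; rewrite /= tnth_mktuple.
apply: measurable_funD; last exact: measurable_cst.
exact: measurable_tnth.
Qed.

(** Tonelli peels off the first coordinate: the induction hypothesis shifts the inner integral,
    invariance on the line the outer one. Nonnegativity is what lets Tonelli apply without
    integrability. *)
Lemma ge0_integral_tuple_shift n (s : 'I_n -> R) (f : Rtuple R n -> \bar R) :
  measurable_fun setT f -> (forall x, (0 <= f x)%E) ->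
  (\int[lebesgue_tuple R n]_t f (tuple_shift s t) = \int[lebesgue_tuple R n]_t f t)%E.
Proof.
elim: n s f => [|n ih] s f mf f0.
  by apply: eq_integral => t _; congr f; rewrite [LHS]tuple0 [RHS]tuple0.
have fub (g : Rtuple R n.+1 -> \bar R) : measurable_fun setT g ->
    (forall x, (0 <= g x)%E) ->
    (\int[lebesgue_tuple R n.+1]_t g t =
     \int[@lebesgue_measure R]_x \int[lebesgue_tuple R n]_t g [tuple of x :: t])%E.
  move=> mg g0; rewrite [LHS](ge0_integral_pushforward measurable_tuple_cons)//.
  rewrite preimage_setT fubini_tonelli1//; last by move=> z; exact: g0.
  by apply: measurableT_comp => //; exact: measurable_tuple_cons.
rewrite [LHS]fub; last 2 first.
- by apply: measurableT_comp => //; exact: measurable_tuple_shift.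
- by [].
have mcons (g : Rtuple R n.+1 -> \bar R) x : measurable_fun setT g ->
    measurable_fun setT (fun t : Rtuple R n => g [tuple of x :: t]).
  move=> mg; have := measurableT_comp (measurableT_comp mg measurable_tuple_cons) (measurable_pair1 x).
  exact.
transitivity (\int[@lebesgue_measure R]_x \int[lebesgue_tuple R n]_t
   f [tuple of (x + s ord0)%R :: t])%E.
  apply: eq_integral => x _.
  rewrite -(ih (fun i => s (lift ord0 i)) (fun t => f [tuple of (x + s ord0)%R :: t]))//;
    last exact: mcons.
  apply: eq_integral => t _; congr f; apply: eq_from_tnth => i.
  rewrite tnth_mktuple; case: (unliftP ord0 i) => [j ->|->]; rewrite ?tnth0// !tnthS.
  by rewrite tnth_mktuple.
rewrite (ge0_integral_shift (s ord0)
  (f := fun x => \int[lebesgue_tuple R n]_t f [tuple of x :: t])%E).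
- by rewrite -fub.
- apply: (measurable_fun_fubini_tonelli_F (f \o tuple_cons)); last by move=> z; exact: f0.
  by apply: measurableT_comp => //; exact: measurable_tuple_cons.
- by move=> x; apply: integral_ge0 => t _; exact: f0.
Qed.

Lemma integral_tuple_shift n (s : 'I_n -> R) (f : Rtuple R n -> \bar R) :
  measurable_fun setT f ->
  (\int[lebesgue_tuple R n]_t f (tuple_shift s t) = \int[lebesgue_tuple R n]_t f t)%E.
Proof.
move=> mf; rewrite [LHS]integralE [RHS]integralE.
congr (_ - _)%E.
  rewrite -[RHS](ge0_integral_tuple_shift s) => [||x]; last exact: funepos_ge0.
    by apply: eq_integral => t _; rewrite !funeposE.
  exact: measurable_funepos.
rewrite -[RHS](ge0_integral_tuple_shift s) => [||x]; last exact: funeneg_ge0.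
  by apply: eq_integral => t _; rewrite !funenegE.
exact: measurable_funeneg.
Qed.

Lemma integrable_tuple_shift n (s : 'I_n -> R) (f : Rtuple R n -> \bar R) :
  (lebesgue_tuple R n).-integrable setT f ->
  (lebesgue_tuple R n).-integrable setT (f \o tuple_shift s).
Proof.
move=> /integrableP[mf fy]; apply/integrableP; split.
  by apply: measurableT_comp => //; exact: measurable_tuple_shift.
rewrite [X in (X < _)%E](ge0_integral_tuple_shift s (f := fun t => `|f t|%E))//.
exact: measurableT_comp.
Qed.

Section vector.
Context {p : nat}.

Definition mvec (f : 'cV[R]_p -> R) : Prop :=
  measurable_fun setT (f \o @vec_of_tuple R p).

Definition ivec (f : 'cV[R]_p -> R) : Prop :=
  (lebesgue_tuple R p).-integrable setT (EFin \o (f \o @vec_of_tuple R p)).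

Lemma ivec_mvec f : ivec f -> mvec f.
Proof. by move=> fi; apply/measurable_EFinP; exact: measurable_int fi. Qed.

Lemma vec_of_tuple_shift (s : 'cV[R]_p) t :
  vec_of_tuple (tuple_shift (fun i => s i 0) t) = vec_of_tuple t + s.
Proof. by apply/colP => i; rewrite !mxE tnth_mktuple. Qed.

Lemma mvec_shift f s : mvec f -> mvec (fun u => f (u + s)).
Proof.
move=> mf; rewrite /mvec.
have -> : (fun u => f (u + s)) \o @vec_of_tuple R p =
  (f \o @vec_of_tuple R p) \o tuple_shift (fun i => s i 0).
  by apply/funext => t /=; rewrite vec_of_tuple_shift.
by apply: measurableT_comp => //; exact: measurable_tuple_shift.
Qed.

Lemma ivec_shift f s : ivec f -> ivec (fun u => f (u + s)).
Proof.
move=> fi; rewrite /ivec.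
have -> : EFin \o ((fun u => f (u + s)) \o @vec_of_tuple R p) =
  (EFin \o (f \o @vec_of_tuple R p)) \o tuple_shift (fun i => s i 0).
  by apply/funext => t /=; rewrite vec_of_tuple_shift.
exact: integrable_tuple_shift.
Qed.

Lemma lint_shift f s : mvec f -> lint (fun u => f (u + s)) = lint f.
Proof.
move=> mf; rewrite /lint /Rintegral; congr fine.
rewrite -(integral_tuple_shift (fun i => s i 0)
  (f := fun t => (f (vec_of_tuple t))%:E)); last exact/measurable_EFinP.
by apply: eq_integral => t _; rewrite /= vec_of_tuple_shift.
Qed.

End vector.

End translation.

(** * Euclidean norms and the least eigenvalue *)

(** The common source of the Cauchy-Schwarz inequalities below, for semidefinite forms as well; with
    a = 0 it also forces a linear coefficient to vanish. *)
Lemma discriminant_le (R : realFieldType) (a b c : R) :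
  (forall t : R, 0 <= a + t * (2 * b) + t ^+ 2 * c) -> b ^+ 2 <= a * c.
Proof.
move=> h; have c0 : 0 <= c.
  rewrite leNgt; apply/negP => c0.
  (* Adding the values at t and -t cancels b, and t is so large that t^2 c < -|a|. *)
  have := h ((`|a| + 2 * `|b| + 1) / - c + 1); have := h (- ((`|a| + 2 * `|b| + 1) / - c + 1)).
  have na := ler_norm a; have nb := normr_ge0 b.
  set s := _ / _; have sE : s * c = - (`|a| + 2 * `|b| + 1) by rewrite /s; field; lra.
  have s0 : 0 <= s by rewrite /s divr_ge0//; lra.
  move=> h1 h2; nra.
move: c0; rewrite le_eqVlt => /predU1P[c0|c0].
  rewrite -c0 mulr0; have [->|b0] := eqVneq b 0; first by rewrite expr0n.
  have := h (- (a + 1) / (2 * b)); rewrite -c0 mulr0 addr0.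
  by rewrite divfK ?mulf_neq0 ?pnatr_eq0//; lra.
have := h (- b / c).
have -> : a + - b / c * (2 * b) + (- b / c) ^+ 2 * c = a - b ^+ 2 / c.
  by field; rewrite gt_eqF.
by rewrite subr_ge0 ler_pdivrMr.
Qed.

Section frobenius.
Context {R : realType}.

(** One inner product for all shapes in use: row vectors of parameters, column vectors of means, and
    m x 2 matrices of measurements. *)
Definition frob m n (A B : 'M[R]_(m, n)) : R := \sum_i \sum_j A i j * B i j.

Variables m n : nat.
Implicit Types A B C : 'M[R]_(m, n).

Lemma frobC A B : frob A B = frob B A.
Proof. by apply: eq_bigr => i _; apply: eq_bigr => j _; rewrite mulrC. Qed.

Lemma frobDl A B C : frob (A + B) C = frob A C + frob B C.
Proof.
rewrite /frob -big_split; apply: eq_bigr => i _ /=; rewrite -big_split.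
by apply: eq_bigr => j _ /=; rewrite mxE mulrDl.
Qed.

Lemma frobZl (c : R) A C : frob (c *: A) C = c * frob A C.
Proof.
rewrite /frob mulr_sumr; apply: eq_bigr => i _; rewrite mulr_sumr.
by apply: eq_bigr => j _ /=; rewrite mxE mulrA.
Qed.

Lemma frobDr A B C : frob A (B + C) = frob A B + frob A C.
Proof. by rewrite frobC frobDl !(frobC A). Qed.

Lemma frobZr (c : R) A C : frob A (c *: C) = c * frob A C.
Proof. by rewrite frobC frobZl frobC. Qed.

Lemma frobNl A C : frob (- A) C = - frob A C.
Proof. by rewrite -scaleN1r frobZl mulN1r. Qed.

Lemma frobNr A C : frob A (- C) = - frob A C.
Proof. by rewrite frobC frobNl frobC. Qed.

Lemma frob0l C : frob 0 C = 0.
Proof. by rewrite -(scale0r 0) frobZl mul0r. Qed.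

Lemma frob0r C : frob C 0 = 0.
Proof. by rewrite frobC frob0l. Qed.

Lemma frob_suml (I : finType) (F : I -> 'M[R]_(m, n)) C :
  frob (\sum_i F i) C = \sum_i frob (F i) C.
Proof.
by apply: (big_morph (fun A => frob A C)); [move=> ? ?; exact: frobDl|exact: frob0l].
Qed.

Lemma frob_sumr (I : finType) (F : I -> 'M[R]_(m, n)) C :
  frob C (\sum_i F i) = \sum_i frob C (F i).
Proof. by rewrite frobC frob_suml; apply: eq_bigr => i _; rewrite frobC. Qed.

Lemma frob_ge0 A : 0 <= frob A A.
Proof. by apply: sumr_ge0 => i _; apply: sumr_ge0 => j _; rewrite -expr2 sqr_ge0. Qed.

Lemma norm2_sqr A : norm2 A ^+ 2 = frob A A.
Proof.
rewrite sqr_sqrtr; last first.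
  by apply: sumr_ge0 => i _; apply: sumr_ge0 => j _; rewrite sqr_ge0.
by apply: eq_bigr => i _; apply: eq_bigr => j _; rewrite expr2.
Qed.

Lemma norm2_ge0 A : 0 <= norm2 A. Proof. exact: sqrtr_ge0. Qed.

Hint Resolve norm2_ge0 : core.

Lemma norm2_le A (c : R) : 0 <= c -> (norm2 A <= c) = (frob A A <= c ^+ 2).
Proof. by move=> c0; rewrite -norm2_sqr ler_sqr ?nnegrE. Qed.

Lemma frob_CS_sqr A B : frob A B ^+ 2 <= frob A A * frob B B.
Proof.
apply: discriminant_le => t; have := frob_ge0 (A + t *: B).
by rewrite frobDl !frobDr !frobZl !frobZr (frobC B A); congr (0 <= _); ring.
Qed.

Lemma frob_CS A B : `|frob A B| <= norm2 A * norm2 B.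
Proof.
rewrite -ler_sqr ?nnegrE ?mulr_ge0// exprMn !norm2_sqr.
by rewrite -normrX ger0_norm ?sqr_ge0// frob_CS_sqr.
Qed.

Lemma norm2D A B : norm2 (A + B) <= norm2 A + norm2 B.
Proof.
rewrite norm2_le ?addr_ge0// frobDl !frobDr (frobC B A) sqrrD !norm2_sqr.
have := le_trans (ler_norm _) (frob_CS A B); lra.
Qed.

Lemma norm2D_sqr A B : norm2 (A + B) ^+ 2 = norm2 A ^+ 2 + 2 * frob A B + norm2 B ^+ 2.
Proof. by rewrite !norm2_sqr frobDl !frobDr (frobC B A); ring. Qed.

Lemma norm2Z (c : R) A : norm2 (c *: A) = `|c| * norm2 A.
Proof.
apply/eqP; rewrite -(@eqrXn2 _ 2)//; last by rewrite mulr_ge0.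
by rewrite exprMn !norm2_sqr frobZl frobZr -normrX ger0_norm ?sqr_ge0//; apply/eqP; ring.
Qed.

Lemma norm2N A : norm2 (- A) = norm2 A.
Proof. by rewrite -scaleN1r norm2Z normrN1 mul1r. Qed.

Lemma norm2B A B : norm2 (A - B) = norm2 (B - A).
Proof. by rewrite -norm2N opprB. Qed.

Lemma norm2_0 : norm2 (0 : 'M[R]_(m, n)) = 0.
Proof. by rewrite -(scale0r 0) norm2Z normr0 mul0r. Qed.

Lemma norm2_sum (I : finType) (F : I -> 'M[R]_(m, n)) :
  norm2 (\sum_i F i) <= \sum_i norm2 (F i).
Proof.
apply: (big_ind2 (fun A c => norm2 A <= c)); first by rewrite norm2_0.
- by move=> A a B b Aa Bb; rewrite (le_trans (norm2D _ _))// lerD.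
- by [].
Qed.

Lemma norm2_eq0 A : (norm2 A == 0) = (A == 0).
Proof.
apply/idP/idP => [/eqP A0|/eqP->]; last by rewrite norm2_0.
have : frob A A = 0 by rewrite -norm2_sqr A0 expr0n.
move/eqP; rewrite psumr_eq0; last first.
  by move=> i _; apply: sumr_ge0 => j _; rewrite -expr2 sqr_ge0.
move=> /allP h; apply/eqP/matrixP => i j; rewrite mxE.
have := h i (mem_index_enum _) => /=; rewrite psumr_eq0; last first.
  by move=> k _; rewrite -expr2 sqr_ge0.
move=> /allP/(_ j (mem_index_enum _)) /=.
by rewrite -expr2 sqrf_eq0 => /eqP.
Qed.

Lemma norm2_gt0 A : (0 < norm2 A) = (A != 0).
Proof. by rewrite lt_def norm2_ge0 andbT norm2_eq0. Qed.

End frobenius.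

#[global] Hint Extern 0 (is_true (0 <= norm2 _)) => exact: norm2_ge0 : core.

Section euclidean_dot.
Context {R : realType}.

Lemma dotvE p (u v : 'cV[R]_p) : dotv u v = frob u v.
Proof.
rewrite /dotv mxE; apply: eq_bigr => i _.
by rewrite big_ord1 mxE.
Qed.

Lemma trmx_neq0 m n (A : 'M[R]_(m, n)) : A != 0 -> A^T != 0.
Proof. by apply: contra => /eqP At0; rewrite -[A]trmxK At0 trmx0. Qed.

Lemma frob_tr m n (A B : 'M[R]_(m, n)) : frob A^T B^T = frob A B.
Proof.
rewrite /frob exchange_big; apply: eq_bigr => i _; apply: eq_bigr => j _.
by rewrite !mxE.
Qed.

Lemma norm2_mulmx m n (A : 'M[R]_(m, n)) (u : 'cV[R]_n) :
  norm2 (A *m u) <= norm2 A * norm2 u.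
Proof.
rewrite norm2_le ?mulr_ge0// exprMn !norm2_sqr {2}/frob mulr_suml.
apply: ler_sum => i _; rewrite big_ord1 -expr2.
have -> : (A *m u) i 0 = frob (row i A) u^T.
  by rewrite /frob big_ord1 mxE; apply: eq_bigr => j _; rewrite !mxE.
rewrite (le_trans (frob_CS_sqr _ _))// frob_tr ler_wpM2r ?frob_ge0//.
by rewrite /frob big_ord1; apply: ler_sum => j _; rewrite !mxE.
Qed.

Lemma frob_mulmx_sym p (S : 'M[R]_p) (u v : 'cV[R]_p) : S^T = S ->
  frob u (S *m v) = frob (S *m u) v.
Proof. by move=> St; rewrite -!dotvE /dotv trmx_mul St mulmxA. Qed.

End euclidean_dot.

(** * The quadratic norm of a positive definite matrix *)

Section posdef.
Context {R : realType} {p : nat}.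
Variable G : 'M[R]_p.
Hypothesis Gpos : posdefmx G.

Lemma posdef_unitmx : G \in unitmx.
Proof.
rewrite unitmxE unitfE; apply/negP => /det0P[v v0 vG].
have [Gt /(_ v^T)] := Gpos.
have -> : G *m v^T = 0 by rewrite -[G *m _]trmxK trmx_mul trmxK Gt vG trmx0.
by rewrite dotvE frob0r ltxx => /(_ (trmx_neq0 v0)).
Qed.

Lemma trmx_invmx_posdef : (invmx G)^T = invmx G.
Proof. by have [Gt _] := Gpos; rewrite trmx_inv Gt. Qed.

(** Positivity of G is evaluated at G^-1 u. *)
Lemma normG2_gt0 u : u != 0 -> 0 < normG2 G u.
Proof.
move=> u0; rewrite /normG2; have [Gt Gp] := Gpos.
have := Gp (invmx G *m u); rewrite mulKVmx ?posdef_unitmx// !dotvE.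
rewrite (frobC _ u); apply; apply: contra u0 => /eqP Gu0.
by rewrite -(mulKVmx posdef_unitmx u) Gu0 mulmx0.
Qed.

Lemma normG2Z (c : R) u : normG2 G (c *: u) = c ^+ 2 * normG2 G u.
Proof. by rewrite /normG2 !dotvE -scalemxAr frobZl frobZr; ring. Qed.

Lemma normG2N u : normG2 G (- u) = normG2 G u.
Proof. by rewrite -scaleN1r normG2Z sqrrN expr1n mul1r. Qed.

Lemma normG2_ge0 u : 0 <= normG2 G u.
Proof.
have [->|/normG2_gt0/ltW//] := eqVneq u 0.
by rewrite -(scale0r u) normG2Z expr0n mul0r.
Qed.

Lemma normG2D u v : normG2 G (u + v) =
  normG2 G u + 2 * dotv v (invmx G *m u) + normG2 G v.
Proof.
rewrite /normG2 !dotvE mulmxDr !frobDl !frobDr.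
by rewrite (frob_mulmx_sym u v trmx_invmx_posdef) (frobC _ v); ring.
Qed.

Lemma normGZ (c : R) u : normG G (c *: u) = `|c| * normG G u.
Proof. by rewrite /normG normG2Z sqrtrM ?sqr_ge0// sqrtr_sqr. Qed.

Lemma normG_sqr u : normG G u ^+ 2 = normG2 G u.
Proof. by rewrite sqr_sqrtr// normG2_ge0. Qed.

Lemma normGD u v : normG G (u + v) <= normG G u + normG G v.
Proof.
have nG w : 0 <= normG G w by exact: sqrtr_ge0.
rewrite -ler_sqr ?nnegrE ?addr_ge0// sqrrD !normG_sqr normG2D.
have CS : dotv v (invmx G *m u) ^+ 2 <= normG2 G u * normG2 G v.
  apply: discriminant_le => t; have := normG2_ge0 (u + t *: v).
  rewrite normG2D normG2Z !dotvE frobZl.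
  by congr (0 <= _); ring.
have : dotv v (invmx G *m u) <= normG G u * normG G v.
  rewrite (le_trans (ler_norm _))// -ler_sqr ?nnegrE ?mulr_ge0//.
  by rewrite exprMn !normG_sqr -normrX ger0_norm ?sqr_ge0.
lra.
Qed.

End posdef.

(** * The least eigenvalue through the Rayleigh quotient of the inverse *)

Section rayleigh.
Context {R : realType} {p : nat}.
Variable G : 'M[R]_p.+1.
Hypothesis Gpos : posdefmx G.

Let S := invmx G.
Let E := [set normG2 G u | u in [set u : 'cV[R]_p.+1 | norm2 u = 1]].
(** The largest Rayleigh quotient of G^-1. Its inverse will be shown to be the least eigenvalue of
    G, with neither the spectral theorem nor compactness of the sphere. *)
Let M := sup E.

Let has_unit : exists u : 'cV[R]_p.+1, norm2 u = 1.
Proof.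
pose v : 'cV[R]_p.+1 := delta_mx 0 0.
have v0 : v != 0.
  by apply/eqP => /matrixP/(_ 0 0); rewrite !mxE !eqxx/= => /eqP; rewrite oner_eq0.
exists ((norm2 v)^-1 *: v); rewrite norm2Z ger0_norm ?invr_ge0//.
by rewrite mulVf// norm2_eq0.
Qed.

Let supE : has_sup E.
Proof.
have [u u1] := has_unit; split; first by exists (normG2 G u); exists u.
exists (norm2 S) => _ [v /= v1 <-]; rewrite /normG2 dotvE.
rewrite (le_trans (ler_norm _))// (le_trans (frob_CS _ _))// v1 mul1r.
by rewrite (le_trans (norm2_mulmx _ _))// v1 mulr1.
Qed.

Let rayleigh_le u : normG2 G u <= M * norm2 u ^+ 2.
Proof.
have [->|u0] := eqVneq u 0; first by rewrite norm2_0 expr0n mulr0 /normG2 mulmx0 dotvE frob0r.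
have n0 : 0 < norm2 u by rewrite norm2_gt0.
have : E (normG2 G ((norm2 u)^-1 *: u)).
  exists ((norm2 u)^-1 *: u) => //=.
  by rewrite norm2Z ger0_norm ?invr_ge0// mulVf// gt_eqF.
move=> /(ub_le_sup supE.2); rewrite -/M normG2Z exprVn mulrC.
by rewrite ler_pdivrMr// exprn_gt0.
Qed.

Let M_gt0 : 0 < M.
Proof.
have [u u1] := has_unit.
have u0 : u != 0 by rewrite -norm2_gt0 u1.
by have := lt_le_trans (normG2_gt0 Gpos u0) (rayleigh_le u); rewrite u1 expr1n mulr1.
Qed.

(* If M I - G^-1 were invertible, x^T (M I - G^-1) x would be bounded below on
   the unit sphere, against the choice of M as a supremum. *)
Let M_eigenvalue : eigenvalue G M^-1.
Proof.
pose T := M%:M - S.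
have Tt : T^T = T by rewrite /T linearB/= tr_scalar_mx trmx_invmx_posdef.
have TE x : frob x (T *m x) = M * norm2 x ^+ 2 - normG2 G x.
  by rewrite /T mulmxBl mul_scalar_mx frobDr frobNr frobZr norm2_sqr /normG2 dotvE.
have Tge0 (x : 'cV[R]_p.+1) : 0 <= frob x (T *m x) by rewrite TE subr_ge0.
have [detT|detT] := eqVneq (\det T) 0.
  move/eqP/det0P : detT => [v v0 vT]; apply/eigenvalueP; exists v => //.
  have vS : v *m S = M *: v.
    by apply/eqP; rewrite eq_sym -subr_eq0 -mul_mx_scalar -mulmxBr vT.
  have vE : v = M *: (v *m G).
    by rewrite scalemxAl -vS /S mulmxKV// posdef_unitmx.
  by rewrite {2}vE scalerA mulVf ?scale1r// gt_eqF.
exfalso; have uT : T \in unitmx by rewrite unitmxE unitfE.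
(* Cauchy-Schwarz for the semidefinite form of T at x and T x gives |T x|^4 <= (x . T x)(T x . T T
   x), and the last factor is at most |T| |T x|^2. *)
have Tx (x : 'cV[R]_p.+1) : norm2 (T *m x) ^+ 2 <= frob x (T *m x) * norm2 T.
  have [->|Tx0] := eqVneq (T *m x) 0.
    by rewrite norm2_0 expr0n frob0r mul0r.
  have CS : frob x (T *m (T *m x)) ^+ 2 <=
      frob x (T *m x) * frob (T *m x) (T *m (T *m x)).
    apply: discriminant_le => t; have := Tge0 (x + t *: (T *m x)).
    rewrite mulmxDr -scalemxAr !frobDl !frobDr !frobZl !frobZr.
    rewrite [frob (T *m x) (T *m x)](_ : _ = frob x (T *m (T *m x)));
      last by rewrite [RHS]frob_mulmx_sym.
    by congr (0 <= _); ring.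
  have n0 : 0 < norm2 (T *m x) by rewrite norm2_gt0.
  have h : frob (T *m x) (T *m (T *m x)) <= norm2 T * norm2 (T *m x) ^+ 2.
    rewrite (le_trans (ler_norm _))// (le_trans (frob_CS _ _))//.
    by rewrite mulrC expr2 mulrA ler_wpM2r// norm2_mulmx.
  move: CS; rewrite frob_mulmx_sym// -norm2_sqr => CS.
  have := le_trans CS (ler_wpM2l (Tge0 x) h).
  by rewrite mulrA [X in X <= _]expr2 ler_pM2r// exprn_gt0.
(* For a unit vector, 1 <= |T^-1|^2 |T x|^2 <= |T^-1|^2 |T| (x . T x). The added 1 only keeps c
   positive. *)
pose c := norm2 (invmx T) ^+ 2 * norm2 T + 1.
have c_gt0 : 0 < c by rewrite ltr_wpDl// mulr_ge0// exprn_ge0.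
have ubE : ubound E (M - c^-1).
  move=> _ [x /= x1 <-]; rewrite lerBrDr -lerBrDl.
  have : 1 <= frob x (T *m x) * c.
    have h1 : 1 <= norm2 (invmx T) ^+ 2 * norm2 (T *m x) ^+ 2.
      rewrite -[1](expr1n _ 2) -x1 -{1}(mulKmx uT x) -exprMn ler_sqr ?nnegrE ?mulr_ge0//.
      exact: norm2_mulmx.
    rewrite (le_trans h1)// (le_trans (ler_wpM2l (exprn_ge0 2 (norm2_ge0 _)) (Tx x)))//.
    by rewrite /c mulrDr mulr1 mulrCA lerDl.
  by rewrite TE x1 expr1n mulr1 -ler_pdivrMr// div1r.
have := ge_sup supE.1 ubE; rewrite -/M; have : 0 < c^-1 by rewrite invr_gt0.
lra.
Qed.

(** An eigenvector of G for l is one of G^-1 for 1/l, and 1/l is then a Rayleigh quotient, hence at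
    most M. *)
Let eigenvalue_ge l : eigenvalue G l -> M^-1 <= l.
Proof.
move=> /eigenvalueP[v vG v0]; have [Gt Gp] := Gpos.
have Gu : G *m v^T = l *: v^T by rewrite -[LHS]trmxK trmx_mul trmxK Gt vG linearZ.
have u0 := trmx_neq0 v0.
have n0 : 0 < norm2 v^T ^+ 2 by rewrite exprn_gt0// norm2_gt0.
have l0 : 0 < l.
  by have := Gp _ u0; rewrite Gu dotvE frobZr -norm2_sqr pmulr_lgt0.
have Su : S *m v^T = l^-1 *: v^T.
  rewrite -{2}(mulKmx (posdef_unitmx Gpos) v^T) Gu -scalemxAr scalerA mulVf ?scale1r//.
  by rewrite gt_eqF.
have := rayleigh_le v^T; rewrite /normG2 -/S Su dotvE frobZr -norm2_sqr ler_pM2r//.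
by move=> h; rewrite -(invrK l) lef_pV2// ?posrE ?invr_gt0.
Qed.

Lemma lambda_min_gt0 : 0 < lambda_min G.
Proof.
rewrite (@lt_le_trans _ _ M^-1) ?invr_gt0//.
by apply: lb_le_inf; [exists M^-1; exact: M_eigenvalue|move=> l; exact: eigenvalue_ge].
Qed.

Lemma normG2_le_lambda_min u : normG2 G u <= norm2 u ^+ 2 / lambda_min G.
Proof.
rewrite (le_trans (rayleigh_le u))// mulrC ler_wpM2l ?exprn_ge0//.
rewrite -(invrK M) lef_pV2 ?posrE ?invr_gt0 ?lambda_min_gt0//.
by apply: ge_inf; [exists M^-1 => l; exact: eigenvalue_ge|exact: M_eigenvalue].
Qed.

End rayleigh.

(** * First-order L1 expansion of Gaussian translates *)

Section vector_integrals.
Context {R : realType} {p : nat}.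
Implicit Types f g : 'cV[R]_p -> R.

Lemma dotv_delta i (u : 'cV[R]_p) : dotv (delta_mx i 0) u = u i 0.
Proof. by rewrite /dotv trmx_delta -rowE mxE. Qed.

Lemma mvec_dot (w : 'cV[R]_p) : mvec (dotv w).
Proof.
rewrite /mvec; have -> : dotv w \o @vec_of_tuple R p = fun t => \sum_i w i 0 * tnth t i.
  apply/funext => t; rewrite /= dotvE /frob; apply: eq_bigr => i _.
  by rewrite big_ord1 mxE.
apply: measurable_sum => i; apply: measurable_funM; first exact: measurable_cst.
exact: measurable_tnth.
Qed.

Lemma mvecM f g : mvec f -> mvec g -> mvec (fun u => f u * g u).
Proof. by move=> mf mg; exact: measurable_funM. Qed.

Lemma mvec_comp (h : R -> R) f : measurable_fun setT h -> mvec f -> mvec (h \o f).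
Proof. by move=> mh mf; apply: measurableT_comp. Qed.

Lemma mvec_dot_mulmx (w : 'cV[R]_p) (A : 'M[R]_p) : mvec (fun u => dotv w (A *m u)).
Proof.
have -> : (fun u => dotv w (A *m u)) = dotv (A^T *m w).
  by apply/funext => u; rewrite /dotv trmx_mul trmxK mulmxA.
exact: mvec_dot.
Qed.

Lemma mvec_normG2 (G : 'M[R]_p) : mvec (normG2 G).
Proof.
rewrite /mvec.
have -> : normG2 G \o @vec_of_tuple R p =
    fun t => \sum_i tnth t i * dotv (delta_mx i 0) (invmx G *m vec_of_tuple t).
  apply/funext => t; rewrite /= /normG2 dotvE /frob; apply: eq_bigr => i _.
  by rewrite big_ord1 dotv_delta {1}mxE.
apply: measurable_sum => i; apply: measurable_funM; first exact: measurable_tnth.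
exact: mvec_dot_mulmx.
Qed.

Lemma mvec_gauss (G : 'M[R]_p) : mvec (gauss G).
Proof.
have := mvec_comp (h := fun x => expR (- (x / 2))) _ (mvec_normG2 G); apply.
apply: measurableT_comp => //; apply: measurableT_comp => //.
by apply: measurable_funM => //; exact: measurable_cst.
Qed.

Lemma mvec_norm2_mulmx (A : 'M[R]_p) : mvec (fun u => norm2 (A *m u)).
Proof.
rewrite /mvec.
have -> : (fun u => norm2 (A *m u)) \o @vec_of_tuple R p =
    fun t => Num.sqrt (\sum_i dotv (delta_mx i 0) (A *m vec_of_tuple t) ^+ 2).
  apply/funext => t; rewrite /= /norm2; congr Num.sqrt; apply: eq_bigr => i _.
  by rewrite big_ord1 dotv_delta.
apply: (measurableT_comp (f := @Num.sqrt R)).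
  by apply: continuous_measurable_fun; exact: sqrt_continuous.
apply: measurable_sum => i; apply: measurable_funX; exact: mvec_dot_mulmx.
Qed.

Lemma ivec_le f g : mvec f -> ivec g -> (forall u, `|f u| <= g u) -> ivec f.
Proof.
move=> mf ig fg; apply: le_integrable ig => //; first exact/measurable_EFinP.
by move=> t _; rewrite /= lee_fin (le_trans (fg _)) ?ler_norm.
Qed.

Lemma ivecD f g : ivec f -> ivec g -> ivec (fun u => f u + g u).
Proof. exact: integrable_fun_D. Qed.

Lemma ivecB f g : ivec f -> ivec g -> ivec (fun u => f u - g u).
Proof. exact: integrable_fun_B. Qed.

Lemma ivecZ f (c : R) : ivec f -> ivec (fun u => c * f u).
Proof. exact: integrable_fun_Z. Qed.

Lemma ivec_norm f : ivec f -> ivec (fun u => `|f u|).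
Proof. exact: integrable_fun_norm. Qed.

Lemma ivec_sum k (f : 'I_k -> 'cV[R]_p -> R) : (forall i, ivec (f i)) ->
  ivec (fun u => \sum_i f i u).
Proof. by move=> fi; exact: integrable_fun_sum. Qed.

Lemma ivec_bounded_mul (M : R) h f : mvec h -> (forall u, `|h u| <= M) -> ivec f ->
  ivec (fun u => h u * f u).
Proof.
move=> mh hM fi; apply: (@integrable_fun_bounded_mul _ _ _ _ (h \o vec_of_tuple) _ M) => //.
by move=> x; exact: hM.
Qed.

Lemma lintD f g : ivec f -> ivec g -> lint (fun u => f u + g u) = lint f + lint g.
Proof. by move=> fi gi; exact: RintegralD. Qed.

Lemma lintB f g : ivec f -> ivec g -> lint (fun u => f u - g u) = lint f - lint g.
Proof. by move=> fi gi; exact: RintegralB. Qed.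

Lemma lintZ f (c : R) : ivec f -> lint (fun u => c * f u) = c * lint f.
Proof. by move=> fi; exact: RintegralZl. Qed.

Lemma le_lint f g : ivec f -> ivec g -> (forall u, f u <= g u) -> lint f <= lint g.
Proof. by move=> fi gi fg; apply: le_Rintegral => // x _; exact: fg. Qed.

Lemma lint_ge0 f : (forall u, 0 <= f u) -> 0 <= lint f.
Proof. by move=> f0; apply: Rintegral_ge0 => x _; exact: f0. Qed.

Lemma eq_lint f g : f =1 g -> lint f = lint g.
Proof. by move=> /funext->. Qed.

Lemma lint_sum k (f : 'I_k -> 'cV[R]_p -> R) : (forall i, ivec (f i)) ->
  lint (fun u => \sum_i f i u) = \sum_i lint (f i).
Proof. by move=> fi; exact: Rintegral_sum. Qed.

Lemma le_normr_lint_mul h f (M : R) : mvec h -> (forall u, `|h u| <= M) -> ivec f ->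
  `|lint (fun u => h u * f u)| <= M * lint (fun u => `|f u|).
Proof.
move=> mh hM fi; apply: (@le_normr_Rintegral_mul _ _ _ _ (h \o vec_of_tuple)) => //.
by move=> x; exact: hM.
Qed.

End vector_integrals.

Section gaussian.
Context {R : realType} {p : nat}.
Variable G : 'M[R]_p.
Hypotheses (Gpos : posdefmx G) (gauss_int : ivec (gauss G)).

Definition gdot (v u : 'cV[R]_p) : R := dotv v (invmx G *m u).

Lemma gdotZl (c : R) v u : gdot (c *: v) u = c * gdot v u.
Proof. by rewrite /gdot !dotvE frobZl. Qed.

Lemma gdotNl v u : gdot (- v) u = - gdot v u.
Proof. by rewrite /gdot !dotvE frobNl. Qed.

Lemma gauss_ge0 u : 0 <= gauss G u. Proof. exact: expR_ge0. Qed.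

Lemma gauss_shift u v : gauss G (u - v) = gauss G u * expR (gdot v u - normG2 G v / 2).
Proof.
rewrite /gauss -expRD; congr expR; rewrite normG2D//.
rewrite normG2N /gdot !dotvE frobNl; lra.
Qed.

(** The derivative at h = 0 of [gauss G (u - h *: v)]. Its sign is opposite to the density of
    [dgauss_measure]. *)
Definition gderiv v u : R := gdot v u * gauss G u.

Lemma gderivZ (c : R) v u : gderiv (c *: v) u = c * gderiv v u.
Proof. by rewrite /gderiv gdotZl mulrA. Qed.

Lemma ivec_gauss s : ivec (fun u => gauss G (u - s)).
Proof. exact: (ivec_shift (- s) gauss_int). Qed.

Lemma lint_gauss s : lint (fun u => gauss G (u - s)) = lint (gauss G).
Proof. exact: (lint_shift (- s) (mvec_gauss G)). Qed.

Lemma mvec_gderiv v : mvec (gderiv v).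
Proof. by apply: mvecM; [exact: mvec_dot_mulmx|exact: mvec_gauss]. Qed.

(** Since |x| <= e^x + e^(-x), and the Gaussian times e^x or e^(-x), for x = [gdot v u], is a
    multiple of a translated Gaussian, integrability of the Gaussian alone suffices. *)
Lemma ivec_gderiv0 v : ivec (gderiv v).
Proof.
apply: (@ivec_le _ _ _ (fun u => expR (normG2 G v / 2) *
  (gauss G (u - v) + gauss G (u - (- v))))).
- exact: mvec_gderiv.
- by apply/ivecZ/ivecD; exact: ivec_gauss.
move=> u; rewrite !gauss_shift /gderiv normrM (ger0_norm (gauss_ge0 _)).
rewrite gdotNl normG2N -mulrDr mulrCA.
rewrite mulrC ler_wpM2l ?gauss_ge0// mulrDr -!expRD.
rewrite (_ : _ + (gdot v u - _) = gdot v u); last by ring.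
rewrite (_ : _ + (- gdot v u - _) = - gdot v u); last by ring.
have := expR_ge1Dx (gdot v u); have := expR_ge1Dx (- gdot v u).
have := expR_gt0 (gdot v u); have := expR_gt0 (- gdot v u).
by rewrite ler_norml => *; apply/andP; split; lra.
Qed.

Lemma ivec_gderiv v s : ivec (fun u => gderiv v (u - s)).
Proof. exact: (ivec_shift (- s) (ivec_gderiv0 v)). Qed.

Let remainder v u := gauss G (u - v) - gauss G u - gderiv v u.

Let ivec_increment v : ivec (fun u => gauss G (u - v) - gauss G u).
Proof. exact: ivecB (ivec_gauss v) gauss_int. Qed.

Let ivec_remainder v : ivec (remainder v).
Proof. exact: ivecB (ivec_increment v) (ivec_gderiv0 v). Qed.

(** This is e^z >= 1 + z at z = x - q/2, with x = [gdot v u] and q = [normG2 G v]. *)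
Let remainder_lb v u : 0 <= remainder v u + normG2 G v / 2 * gauss G u.
Proof.
rewrite /remainder gauss_shift /gderiv.
have := expR_ge1Dx (gdot v u - normG2 G v / 2).
have := gauss_ge0 u; nra.
Qed.

Let lint_remainder v : lint (remainder v) = - lint (gderiv v).
Proof.
rewrite /remainder (lintB (ivec_increment v) (ivec_gderiv0 v)).
by rewrite (lintB (ivec_gauss v) gauss_int) lint_gauss subrr sub0r.
Qed.

(* The remainder at h v, plus h^2 q(v)/2 times the Gaussian, is nonnegative for
   all real h; its integral is a quadratic in h whose linear term must vanish. *)
Let lint_gderiv v : lint (gderiv v) = 0.
Proof.
have : (- lint (gderiv v) / 2) ^+ 2 <= 0 * (normG2 G v / 2 * lint (gauss G)).
  apply: discriminant_le => h.
  have : 0 <= lint (fun u => remainder (h *: v) u + normG2 G (h *: v) / 2 * gauss G u).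
    by apply: lint_ge0 => u; exact: remainder_lb.
  rewrite (lintD (ivec_remainder _) (ivecZ _ gauss_int)).
  rewrite lint_remainder (lintZ _ gauss_int) normG2Z.
  rewrite (eq_lint (g := fun u => h * gderiv v u)); last by move=> u; exact: gderivZ.
  by rewrite (lintZ h (ivec_gderiv0 v)); congr (0 <= _); field.
rewrite mul0r => h; apply/eqP; have := sqr_ge0 (- lint (gderiv v) / 2).
move=> h2; have /eqP : (- lint (gderiv v) / 2) ^+ 2 = 0 by apply/le_anti/andP.
by rewrite sqrf_eq0 mulf_eq0 oppr_eq0 invr_eq0 pnatr_eq0 orbF.
Qed.

(** The remainder r satisfies r >= -(q/2) times the Gaussian, so |r| <= r + q times the Gaussian
    pointwise. Both r and the derivative integrate to 0, so only q times the mass is left and no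
    second moment is computed. *)
Lemma gauss_taylor_L1 v :
  lint (fun u => `|gauss G (u - v) - gauss G u - gderiv v u|)
    <= normG2 G v * lint (gauss G).
Proof.
have -> : normG2 G v * lint (gauss G) =
    lint (fun u => remainder v u + normG2 G v * gauss G u).
  rewrite (lintD (ivec_remainder _) (ivecZ _ gauss_int)).
  by rewrite lint_remainder lint_gderiv oppr0 add0r (lintZ _ gauss_int).
apply: le_lint.
- exact/ivec_norm/ivec_remainder.
- exact: ivecD (ivec_remainder _) (ivecZ _ gauss_int).
move=> u; have := remainder_lb v u; rewrite -/(remainder v u).
have := mulr_ge0 (normG2_ge0 Gpos v) (gauss_ge0 u).
by rewrite ler_norml => *; apply/andP; split; lra.
Qed.

(** The norm is at most the sum of the absolute coordinates, each of which gives a [gderiv] along a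
    basis vector. *)
Lemma ivec_norm2_invmx_gauss : ivec (fun u => norm2 (invmx G *m u) * gauss G u).
Proof.
pose e i : 'cV[R]_p := delta_mx i 0.
apply: (@ivec_le _ _ _ (fun u => \sum_i `|gderiv (e i) u|)).
- by apply: mvecM; [exact: mvec_norm2_mulmx|exact: mvec_gauss].
- by apply: ivec_sum => i; apply: ivec_norm; exact: ivec_gderiv0.
move=> u; rewrite ger0_norm ?mulr_ge0 ?gauss_ge0//.
under eq_bigr do rewrite /gderiv normrM (ger0_norm (gauss_ge0 _)).
rewrite -mulr_suml ler_wpM2r ?gauss_ge0//.
have -> : invmx G *m u = \sum_i gdot (e i) u *: e i.
  rewrite [LHS]matrix_sum_delta; apply: eq_bigr => i _; rewrite big_ord1.
  by rewrite /gdot dotv_delta.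
rewrite (le_trans (norm2_sum _))//; apply: ler_sum => i _.
rewrite norm2Z -[leRHS]mulr1 ler_wpM2l// norm2_le// expr1n /frob.
rewrite (bigD1 i)//= big_ord1 !mxE !eqxx mulr1 big1 ?addr0// => j ji.
by rewrite big_ord1 !mxE (negbTE ji) mul0r.
Qed.

Lemma gderiv_le v u : `|gderiv v u| <= norm2 v * (norm2 (invmx G *m u) * gauss G u).
Proof.
rewrite /gderiv normrM (ger0_norm (gauss_ge0 _)) mulrA ler_wpM2r ?gauss_ge0//.
by rewrite /gdot dotvE frob_CS.
Qed.

End gaussian.

(** * The forward map and its Taylor remainders *)

Section trigonometric_bounds.
Context {R : realType}.
Implicit Types x y : R.

Lemma sin_mvt y : exists2 c, `|c| <= `|y| & sin y = cos c * y.
Proof.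
wlog y0 : y / 0 <= y => [h|].
  have [y0|/ltW y0] := leP 0 y; first exact: h.
  have [|c cy cE] := h (- y); first by rewrite oppr_ge0.
  by exists c; [rewrite -(normrN y)|rewrite -[LHS]opprK -sinN cE; ring].
have [c] := @MVT_segment R (@sin R) (@cos R) 0 y y0
  (fun x _ => is_derive_sin x) (continuous_subspaceT (@continuous_sin R)).
rewrite in_itv/= => /andP[c0 cy]; rewrite sin0 !subr0 => ->; exists c => //.
by rewrite !ger0_norm.
Qed.

Lemma sin_abs_le y : `|sin y| <= `|y|.
Proof. by have [c _ ->] := sin_mvt y; rewrite normrM ler_piMl// cos_max. Qed.

Lemma one_sub_cos y : 1 - cos y = 2 * sin (y / 2) ^+ 2.
Proof.
have -> : cos y = cos ((y / 2) *+ 2) by congr cos; rewrite mulr2n; lra.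
by rewrite cos_mulr2n cos2sin2 mulr2n; ring.
Qed.

Lemma one_sub_cos_le y : 1 - cos y <= y ^+ 2 / 2.
Proof.
rewrite one_sub_cos; have := sin_abs_le (y / 2).
rewrite -ler_sqr ?nnegrE// !real_normK ?num_real// expr_div_n; lra.
Qed.

Lemma one_sub_cos_le_abs y : 1 - cos y <= `|y|.
Proof.
rewrite one_sub_cos; have h := sin_abs_le (y / 2); have h1 := sin_max (y / 2).
rewrite -(real_normK (num_real (sin _))).
have y2 : `|y / 2| = `|y| / 2 by rewrite normrM [X in _ * X = _]ger0_norm.
rewrite y2 in h; have := normr_ge0 (sin (y / 2)); nra.
Qed.

(** The mean value theorem leaves (1 - cos c)|y| with |c| <= |y|. A quadratic bound is all the
    Taylor estimates use. *)
Lemma sin_sub_le y : `|sin y - y| <= y ^+ 2.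
Proof.
have [c cy ->] := sin_mvt y.
have -> : cos c * y - y = - (1 - cos c) * y by ring.
have c0 : 0 <= 1 - cos c by rewrite subr_ge0 cos_le1.
rewrite normrM normrN (ger0_norm c0) -[leRHS]real_normK ?num_real// expr2.
by rewrite ler_wpM2r// (le_trans (one_sub_cos_le_abs c)).
Qed.

(** A lower bound with cubic error, from which y^2 is recovered in the limit h -> 0 at h y. It
    squares sin x >= x - x^2 at x = y/2. *)
Lemma one_sub_cos_ge y : 0 <= y -> y ^+ 2 / 2 - y ^+ 3 / 2 <= 1 - cos y.
Proof.
move=> y0; rewrite one_sub_cos; have := sin_sub_le (y / 2).
rewrite ler_norml => /andP[h1 h2].
have x0 : 0 <= y / 2 by lra.
have -> : y = 2 * (y / 2) by lra.
rewrite [2 * _ / 2](_ : _ = y / 2); last by lra.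
move: (y / 2) h1 h2 x0 => x; move: (sin x) => s h1 h2 x0.
have [x1|x1] := leP x 1.
  have : x - x ^+ 2 <= s by lra.
  have : 0 <= x - x ^+ 2 by nra.
  move=> u0 us; have : (x - x ^+ 2) ^+ 2 <= s ^+ 2 by rewrite ler_sqr ?nnegrE//; lra.
  by have := sqr_ge0 (x ^+ 2); lra.
(* For x > 1 the left-hand side is already negative. *)
have := sqr_ge0 s => s2.
have : x ^+ 2 <= x ^+ 3 by rewrite ler_weXn2l// ltW.
have := sqr_ge0 x; lra.
Qed.

Lemma cos_sin_increment_le y : (cos y - 1) ^+ 2 + sin y ^+ 2 <= y ^+ 2.
Proof. rewrite sin2cos2; have := one_sub_cos_le y; lra. Qed.

Lemma cos_sin_remainder_le y :
  (cos y - 1) ^+ 2 + (sin y - y) ^+ 2 <= (2 * y ^+ 2) ^+ 2.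
Proof.
have h1 := one_sub_cos_le y; have h0 : 0 <= 1 - cos y by rewrite subr_ge0 cos_le1.
have : (sin y - y) ^+ 2 <= (y ^+ 2) ^+ 2.
  by rewrite -[leLHS]real_normK ?num_real// ler_sqr ?nnegrE ?sqr_ge0// sin_sub_le.
have : (1 - cos y) ^+ 2 <= (y ^+ 2 / 2) ^+ 2 by rewrite ler_sqr ?nnegrE//; lra.
have := sqr_ge0 (y ^+ 2); lra.
Qed.

End trigonometric_bounds.

(* A row (x, y) of an m x 2 real matrix stands for the complex number x + i y,
   so that [norm2] is the norm of C^m.  [cexp d x] has entries d_l e^(-i x_l). *)
Section complex_exponential.
Context {R : realType} {m : nat}.
Implicit Types (d : 'M[R]_(m, 2)) (x y : 'I_m -> R).

Definition cexp d x : 'M[R]_(m, 2) := \matrix_(l, b)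
  (if b == 0 then d l 0 * cos (x l) + d l 1 * sin (x l)
   else d l 1 * cos (x l) - d l 0 * sin (x l)).

Definition dcexp d x y : 'M[R]_(m, 2) := \matrix_(l, b)
  (y l * (if b == 0 then d l 1 * cos (x l) - d l 0 * sin (x l)
          else - (d l 0 * cos (x l)) - d l 1 * sin (x l))).

(** The l2 norm of (|d_l| y_l), the size of a first derivative of [cexp]. Likewise [cnorm2] is that
    of (|d_l| y_l^2), the size of a second derivative. *)
Definition cnorm1 d y : R := Num.sqrt (\sum_l (d l 0 ^+ 2 + d l 1 ^+ 2) * y l ^+ 2).

Definition cnorm2 d y : R :=
  Num.sqrt (\sum_l (d l 0 ^+ 2 + d l 1 ^+ 2) * (y l ^+ 2) ^+ 2).

Let frob2 (A : 'M[R]_(m, 2)) : frob A A = \sum_l (A l 0 ^+ 2 + A l 1 ^+ 2).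
Proof.
apply: eq_bigr => l _; rewrite big_ord_recl big_ord1 !expr2.
by rewrite (_ : lift ord0 0 = 1)//; exact/val_inj.
Qed.

Let norm2_dle d y (A : 'M[R]_(m, 2)) (f : R -> R) :
  (forall l, A l 0 ^+ 2 + A l 1 ^+ 2 <= (d l 0 ^+ 2 + d l 1 ^+ 2) * f (y l)) ->
  (forall l, 0 <= f (y l)) ->
  norm2 A <= Num.sqrt (\sum_l (d l 0 ^+ 2 + d l 1 ^+ 2) * f (y l)).
Proof.
move=> h f0; rewrite norm2_le ?sqrtr_ge0// sqr_sqrtr; last first.
  by apply: sumr_ge0 => l _; rewrite mulr_ge0// addr_ge0 ?sqr_ge0.
by rewrite frob2; apply: ler_sum.
Qed.

(** Multiplicativity of the squared modulus for d e^(-ix) and p - iq: it factors the phase out of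
    the estimates and reduces them to the base point x = 0. *)
Let rotation_norm (u v c s : R) : c ^+ 2 + s ^+ 2 = 1 -> forall p q,
  ((u * c + v * s) * p + (v * c - u * s) * q) ^+ 2
  + ((v * c - u * s) * p - (u * c + v * s) * q) ^+ 2
  = (u ^+ 2 + v ^+ 2) * (p ^+ 2 + q ^+ 2).
Proof.
move=> cs p q.
transitivity ((u ^+ 2 + v ^+ 2) * (c ^+ 2 + s ^+ 2) * (p ^+ 2 + q ^+ 2)); first by ring.
by rewrite cs mulr1.
Qed.

Lemma cexp_increment d x y : norm2 (cexp d (fun l => x l + y l) - cexp d x) <= cnorm1 d y.
Proof.
apply: (norm2_dle (f := fun t => t ^+ 2)) => l; last exact: sqr_ge0.
rewrite !mxE /= cosD sinD.
rewrite [leLHS](_ : _ = (d l 0 ^+ 2 + d l 1 ^+ 2) * ((cos (y l) - 1) ^+ 2 + sin (y l) ^+ 2)).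
  by rewrite ler_wpM2l ?cos_sin_increment_le// addr_ge0 ?sqr_ge0.
rewrite -(rotation_norm _ _ (cos2Dsin2 (x l))); congr (_ ^+ 2 + _ ^+ 2); ring.
Qed.

Lemma cexp_taylor d x y :
  norm2 (cexp d (fun l => x l + y l) - cexp d x - dcexp d x y) <= 2 * cnorm2 d y.
Proof.
have -> : 2 * cnorm2 d y =
    Num.sqrt (\sum_l (d l 0 ^+ 2 + d l 1 ^+ 2) * (2 * y l ^+ 2) ^+ 2).
  rewrite /cnorm2 -[X in X * _](@ger0_norm _ 2)// -sqrtr_sqr -sqrtrM ?sqr_ge0//.
  rewrite mulr_sumr; congr Num.sqrt; apply: eq_bigr => l _; ring.
apply: (norm2_dle (f := fun t => (2 * t ^+ 2) ^+ 2)) => l; last exact: sqr_ge0.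
rewrite !mxE /= cosD sinD.
rewrite [leLHS](_ : _ = (d l 0 ^+ 2 + d l 1 ^+ 2) *
    ((cos (y l) - 1) ^+ 2 + (sin (y l) - y l) ^+ 2)).
  by rewrite ler_wpM2l ?cos_sin_remainder_le// addr_ge0 ?sqr_ge0.
rewrite -(rotation_norm _ _ (cos2Dsin2 (x l))); congr (_ ^+ 2 + _ ^+ 2); ring.
Qed.

Lemma norm2_dcexp d x y : norm2 (dcexp d x y) = cnorm1 d y.
Proof.
apply/eqP; rewrite -(@eqrXn2 _ 2)//; last exact: sqrtr_ge0.
rewrite norm2_sqr /cnorm1 sqr_sqrtr; last first.
  by apply: sumr_ge0 => l _; rewrite mulr_ge0 ?addr_ge0 ?sqr_ge0.
rewrite frob2; apply/eqP; apply: eq_bigr => l _; rewrite !mxE /=.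
transitivity ((d l 0 ^+ 2 + d l 1 ^+ 2) * y l ^+ 2 * (cos (x l) ^+ 2 + sin (x l) ^+ 2)).
  by ring.
by rewrite cos2Dsin2 mulr1.
Qed.

Lemma norm2_cexp d x : norm2 (cexp d x) = cnorm1 d (fun=> 1).
Proof.
apply/eqP; rewrite -(@eqrXn2 _ 2)//; last exact: sqrtr_ge0.
rewrite norm2_sqr /cnorm1 sqr_sqrtr; last first.
  by apply: sumr_ge0 => l _; rewrite mulr_ge0 ?addr_ge0 ?sqr_ge0.
rewrite frob2; apply/eqP; apply: eq_bigr => l _; rewrite !mxE /=.
transitivity ((d l 0 ^+ 2 + d l 1 ^+ 2) * (cos (x l) ^+ 2 + sin (x l) ^+ 2)).
  by ring.
by rewrite cos2Dsin2 expr1n.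
Qed.

Lemma le_cnorm1 d y z : (forall l, `|y l| <= z l) -> cnorm1 d y <= cnorm1 d z.
Proof.
move=> yz; rewrite /cnorm1 ler_wsqrtr//; apply: ler_sum => l _.
rewrite ler_wpM2l ?addr_ge0 ?sqr_ge0// -[leLHS]real_normK ?num_real//.
by rewrite ler_sqr ?nnegrE// (le_trans _ (yz l)).
Qed.

Lemma dcexpZ d x y (c : R) : dcexp d x (fun l => c * y l) = c *: dcexp d x y.
Proof. by apply/matrixP => l b; rewrite !mxE mulrA. Qed.

Lemma dcexpD d x y z : dcexp d x (fun l => y l + z l) = dcexp d x y + dcexp d x z.
Proof. by apply/matrixP => l b; rewrite !mxE mulrDl. Qed.

Lemma cnorm1Z d y (c : R) : cnorm1 d (fun l => c * y l) = `|c| * cnorm1 d y.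
Proof.
rewrite /cnorm1 -sqrtr_sqr -sqrtrM ?sqr_ge0// mulr_sumr.
by congr Num.sqrt; apply: eq_bigr => l _; ring.
Qed.

Lemma cnorm2Z d y (c : R) : cnorm2 d (fun l => c * y l) = c ^+ 2 * cnorm2 d y.
Proof.
rewrite /cnorm2 -[X in X * _](@ger0_norm _ (c ^+ 2)) ?sqr_ge0// -sqrtr_sqr.
rewrite -sqrtrM ?sqr_ge0// mulr_sumr.
by congr Num.sqrt; apply: eq_bigr => l _; ring.
Qed.

Lemma cnorm1_ge0 d y : 0 <= cnorm1 d y. Proof. exact: sqrtr_ge0. Qed.

Lemma cnorm2_ge0 d y : 0 <= cnorm2 d y. Proof. exact: sqrtr_ge0. Qed.

End complex_exponential.

(** * Coordinates of the parameter space *)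

Section parameters.
Context {R : realType} {k p : nat}.
Implicit Types theta u : 'rV[R]_(k + k * p).

Lemma amplitudeD theta u i : amplitude (theta + u) i = amplitude theta i + amplitude u i.
Proof. by rewrite /amplitude !mxE. Qed.

Lemma amplitudeZ (c : R) theta i : amplitude (c *: theta) i = c * amplitude theta i.
Proof. by rewrite /amplitude !mxE. Qed.

Lemma meanD theta u i : mean (theta + u) i = mean theta i + mean u i.
Proof. by rewrite /mean !linearD. Qed.

Lemma meanZ (c : R) theta i : mean (c *: theta) i = c *: mean theta i.
Proof. by rewrite /mean !linearZ. Qed.

Definition of_params (a : 'I_k -> R) (t : 'I_k -> 'cV[R]_p) : 'rV[R]_(k + k * p) :=
  row_mx (\row_i a i) (mxvec (\matrix_(i, j) t i j 0)).

Lemma amplitude_of_params a t : amplitude (of_params a t) = a.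
Proof. by apply/funext => i; rewrite /amplitude row_mxKl mxE. Qed.

Lemma mean_of_params a t : mean (of_params a t) = t.
Proof. by apply/funext => i; apply/colP => j; rewrite /mean row_mxKr mxvecK !mxE. Qed.

Lemma norm2_params theta : norm2 theta ^+ 2 =
  \sum_i (amplitude theta i ^+ 2 + norm2 (mean theta i) ^+ 2).
Proof.
rewrite norm2_sqr /frob big_ord1 big_split_ord big_split /=; congr (_ + _).
  by apply: eq_bigr => i _; rewrite /amplitude mxE expr2.
have -> : \sum_(j < k * p) theta 0 (rshift k j) * theta 0 (rshift k j) =
    \sum_(j < k * p) mxvec (vec_mx (rsubmx theta)) 0 j ^+ 2.
  by apply: eq_bigr => j _; rewrite vec_mxK mxE expr2.
rewrite (reindex _ (curry_mxvec_bij _ _)) /=.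
rewrite (eq_bigr (fun ij => vec_mx (rsubmx theta) ij.1 ij.2 ^+ 2)); last first.
  by move=> [i j] _; rewrite /= mxvecE.
rewrite -(pair_bigA _ (fun i j => vec_mx (rsubmx theta) i j ^+ 2)) /=.
apply: eq_bigr => i _; rewrite norm2_sqr; apply: eq_bigr => j _.
by rewrite big_ord1 !mxE expr2.
Qed.

Lemma amplitude_le_norm2 theta i : `|amplitude theta i| <= norm2 theta.
Proof.
rewrite -ler_sqr ?nnegrE// real_normK ?num_real// norm2_params (bigD1 i)//= -addrA.
by rewrite lerDl addr_ge0 ?exprn_ge0// sumr_ge0// => j _; rewrite addr_ge0 ?sqr_ge0.
Qed.

Lemma mean_le_norm2 theta i : norm2 (mean theta i) <= norm2 theta.
Proof.
rewrite -ler_sqr ?nnegrE// norm2_params (bigD1 i)//= -addrA addrCA.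
by rewrite lerDl addr_ge0 ?sqr_ge0// sumr_ge0// => j _; rewrite addr_ge0 ?sqr_ge0.
Qed.

End parameters.

(* The noiseless measurement of a mixture, in which each Gaussian at t
   contributes d_l e^(-i <om_l, t>) to the l-th coordinate. *)
Section forward_map.
Context {R : realType} {k p m : nat}.
Variables (d : 'M[R]_(m, 2)) (om : 'I_m -> 'cV[R]_p).
Implicit Types (t v : 'cV[R]_p) (theta u : 'rV[R]_(k + k * p)).

Definition phase t : 'I_m -> R := fun l => dotv (om l) t.

Definition atom t := cexp d (phase t).

Definition datom t v := dcexp d (phase t) (phase v).

(** The norm of the derivative of an atom along v, the same at every base point since moving the
    base only multiplies by phases. [speed2] plays this role at second order. *)
Definition speed1 v := cnorm1 d (phase v).

Definition speed2 v := cnorm2 d (phase v).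

Let phaseD t v : phase (t + v) = fun l => phase t l + phase v l.
Proof. by apply/funext => l; rewrite /phase !dotvE frobDr. Qed.

Let phaseZ (c : R) v : phase (c *: v) = fun l => c * phase v l.
Proof. by apply/funext => l; rewrite /phase !dotvE frobZr. Qed.

Lemma atom_increment t v : norm2 (atom (t + v) - atom t) <= speed1 v.
Proof. by rewrite /atom phaseD; exact: cexp_increment. Qed.

Lemma atom_taylor t v : norm2 (atom (t + v) - atom t - datom t v) <= 2 * speed2 v.
Proof. by rewrite /atom phaseD; exact: cexp_taylor. Qed.

Lemma norm2_datom t v : norm2 (datom t v) = speed1 v.
Proof. exact: norm2_dcexp. Qed.

Lemma datomZ t (c : R) v : datom t (c *: v) = c *: datom t v.
Proof. by rewrite /datom phaseZ dcexpZ. Qed.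

Lemma datomD t v w : datom t (v + w) = datom t v + datom t w.
Proof. by rewrite /datom phaseD dcexpD. Qed.

Lemma speed1Z (c : R) v : speed1 (c *: v) = `|c| * speed1 v.
Proof. by rewrite /speed1 phaseZ cnorm1Z. Qed.

Lemma speed2Z (c : R) v : speed2 (c *: v) = c ^+ 2 * speed2 v.
Proof. by rewrite /speed2 phaseZ cnorm2Z. Qed.

Lemma speed1_ge0 v : 0 <= speed1 v. Proof. exact: cnorm1_ge0. Qed.

Lemma speed2_ge0 v : 0 <= speed2 v. Proof. exact: cnorm2_ge0. Qed.

(** Taylor expansion from the far endpoint t + v with step -v. *)
Lemma atom_taylor_back t v :
  norm2 (atom (t + v) - atom t - datom (t + v) v) <= 2 * speed2 v.
Proof.
have := atom_taylor (t + v) (- v); rewrite addrK.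
have -> : datom (t + v) (- v) = - datom (t + v) v by rewrite -scaleN1r datomZ scaleN1r.
have -> : speed2 (- v) = speed2 v by rewrite -scaleN1r speed2Z sqrrN expr1n mul1r.
rewrite opprK (_ : _ + datom (t + v) v = datom (t + v) v - (atom (t + v) - atom t)).
  by rewrite norm2B.
by rewrite opprB addrC.
Qed.

Lemma norm2_atom t : norm2 (atom t) = cnorm1 d (fun=> 1).
Proof. exact: norm2_cexp. Qed.

(** This bound governs how small tau must be; the radius beta relies on [speed1_fmeas_le]
    instead. *)
Lemma speed1_le v : speed1 v <= cnorm1 d (fun l => norm2 (om l)) * norm2 v.
Proof.
rewrite mulrC -[X in X * _]ger0_norm// -cnorm1Z; apply: le_cnorm1 => l.
by rewrite /phase dotvE mulrC frob_CS.
Qed.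

Definition forward theta := \sum_i amplitude theta i *: atom (mean theta i).

Definition jacobian theta u := \sum_i
  (amplitude u i *: atom (mean theta i) +
   amplitude theta i *: datom (mean theta i) (mean u i)).

(** One quantity bounding the Taylor remainder with the Jacobian taken at either end. Only the
    amplitudes of [theta] itself enter, which is why |a_k| appears in beta rather than a supremum
    over the ball. *)
Definition curvature theta u : R := \sum_i
  (`|amplitude theta i| * (2 * speed2 (mean u i)) +
   `|amplitude u i| * speed1 (mean u i)).

Lemma curvatureZ (c : R) theta u : curvature theta (c *: u) = c ^+ 2 * curvature theta u.
Proof.
rewrite /curvature mulr_sumr; apply: eq_bigr => i _.
rewrite amplitudeZ meanZ speed1Z speed2Z normrM -(real_normK (num_real c)); ring.
Qed.

Lemma curvature_ge0 theta u : 0 <= curvature theta u.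
Proof.
by apply: sumr_ge0 => i _; rewrite addr_ge0 ?mulr_ge0 ?speed1_ge0 ?speed2_ge0.
Qed.

Lemma jacobianZ (c : R) theta u : jacobian theta (c *: u) = c *: jacobian theta u.
Proof.
rewrite /jacobian scaler_sumr; apply: eq_bigr => i _.
by rewrite amplitudeZ meanZ datomZ scalerDr !scalerA (mulrC c (amplitude theta i)).
Qed.

Lemma jacobianD theta u w : jacobian theta (u + w) = jacobian theta u + jacobian theta w.
Proof.
rewrite /jacobian -big_split; apply: eq_bigr => i _ /=.
by rewrite amplitudeD meanD datomD scalerDl scalerDr addrACA.
Qed.

Lemma forward_taylor theta u :
  norm2 (forward (theta + u) - forward theta - jacobian theta u) <= curvature theta u.
Proof.
rewrite /forward /jacobian -!sumrB (le_trans (norm2_sum _))//.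
apply: ler_sum => i _; rewrite amplitudeD meanD.
set a := amplitude theta i; set b := amplitude u i.
set t := mean theta i; set v := mean u i.
rewrite [X in norm2 X](_ : _ = a *: (atom (t + v) - atom t - datom t v) +
  b *: (atom (t + v) - atom t)); last first.
  by apply/matrixP => x y; rewrite !mxE; ring.
rewrite (le_trans (norm2D _ _))// !norm2Z lerD// ler_wpM2l//; first exact: atom_taylor.
exact: atom_increment.
Qed.

(** With the Jacobian at the far end, the mixed term is -b times the atom derivative, whose norm is
    exactly [speed1]; hence the same bound as from the near end. *)
Lemma forward_taylor_back theta u :
  norm2 (forward (theta + u) - forward theta - jacobian (theta + u) u)
    <= curvature theta u.
Proof.
rewrite /forward /jacobian -!sumrB (le_trans (norm2_sum _))//.
apply: ler_sum => i _; rewrite amplitudeD meanD.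
set a := amplitude theta i; set b := amplitude u i.
set t := mean theta i; set v := mean u i.
rewrite [X in norm2 X](_ : _ = a *: (atom (t + v) - atom t - datom (t + v) v) -
  b *: datom (t + v) v); last first.
  by apply/matrixP => x y; rewrite !mxE; ring.
rewrite (le_trans (norm2D _ _))// norm2N !norm2Z lerD// ler_wpM2l//.
  exact: atom_taylor_back.
by rewrite norm2_datom.
Qed.

End forward_map.

(** * Gradient descent for the least-squares objective *)

Section gradient_descent.
Context {R : realType}.

(** Reads a directional derivative off a quadratic error bound, so that the derivative of the
    objective follows from Taylor estimates without chain rules. *)
Lemma derive_quadratic n (g : 'rV[R]_n -> R) (x v : 'rV[R]_n) (c M : R) :
  (forall h, `|h| <= 1 -> `|g (x + h *: v) - g x - h * c| <= M * h ^+ 2) ->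
  'D_v g x = c.
Proof.
move=> gM; rewrite /derive; apply: cvg_lim => //.
have M0 : 0 <= M.
  by have := gM 1 _; rewrite normr1 expr1n mulr1 => /(_ (lexx _)); exact: le_trans.
apply/cvgrPdist_le => e e0.
near=> h.
have h0 : h != 0 by near: h; exact: nbhs_dnbhs_neq.
have h1 : `|h| <= Num.min 1 (e / (M + 1)).
  near: h; apply: dnbhs0_le; rewrite lt_min ltr01 divr_gt0//; lra.
move: h1; rewrite le_min => /andP[h1 he].
rewrite /= -[c](mulKf h0) -mulrBr normrM normrV ?unitfE// ler_pdivrMl ?normr_gt0//.
rewrite distrC (addrC _ x) (le_trans (gM _ h1))//.
rewrite -(real_normK (num_real h)) expr2 mulrCA ler_wpM2l//.
move: he; rewrite ler_pdivlMr; last by lra.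
by have := normr_ge0 h; lra.
Unshelve. all: by end_near. Qed.

Lemma basin_of_descent n (g : 'rV[R]_n -> R) (xs : 'rV[R]_n) (beta L : R) :
  0 < beta -> 0 <= L -> (forall x, 0 <= g x) -> g xs = 0 ->
  (forall x, norm2 (x - xs) < beta -> g x <= frob (gradient g x) (x - xs)) ->
  (forall x, norm2 (x - xs) < beta -> norm2 (gradient g x) ^+ 2 <= L * g x) ->
  basin_of_attraction g xs [set x | norm2 (x - xs) < beta].
Proof.
move=> beta0 L0 g0 gxs mono smooth; split.
  by rewrite /= subrr norm2_0.
(* The added 1 covers L = 0. *)
exists (L + 1)^-1; first by rewrite invr_gt0; lra.
move=> tau tau0 tauL x0 /= x0b.
have tauL1 : tau * L <= 1.
  have : tau * (L + 1) <= 1 by rewrite -ler_pdivlMr ?div1r//; lra.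
  lra.
pose x n := iter n (gradient_step g tau) x0.
(* The inner product contributes at most -2 tau g, and tau L <= 1 lets the squared gradient give
   back at most tau g. *)
have step y : norm2 (y - xs) < beta ->
    norm2 (gradient_step g tau y - xs) ^+ 2 <= norm2 (y - xs) ^+ 2 - tau * g y.
  move=> yb; rewrite /gradient_step addrAC.
  move: (y - xs) (mono _ yb) (smooth _ yb) => dl h1 h2.
  rewrite !norm2_sqr frobDl !frobDr !frobNl !frobNr.
  rewrite !frobZl !frobZr -(norm2_sqr (gradient g y)) (frobC dl (gradient g y)).
  have h3 : tau * g y <= tau * frob (gradient g y) dl by rewrite ler_wpM2l// ltW.
  have h4 : tau * (tau * norm2 (gradient g y) ^+ 2) <= tau * g y.
    rewrite ler_pM2l// (le_trans (ler_wpM2l (ltW tau0) h2))// mulrA.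
    by rewrite -[leRHS]mul1r ler_wpM2r.
  lra.
have xb i : norm2 (x i - xs) < beta.
  elim: i => [|i ih]//=; rewrite (le_lt_trans _ ih)//.
  rewrite -ler_sqr ?nnegrE// (le_trans (step _ ih))// lerBlDr lerDl.
  by rewrite mulr_ge0// ltW.
pose D i := norm2 (x i - xs) ^+ 2.
have Dcvg : cvgn D.
  apply: nonincreasing_is_cvgn.
    apply/nonincreasing_seqP => i; rewrite (le_trans (step _ (xb i)))//.
    by rewrite lerBlDr lerDl mulr_ge0// ltW.
  by exists 0 => _ [i _ <-]; rewrite exprn_ge0.
(* The squared distances D converge, so their consecutive differences tend to 0 and squeeze g. *)
have gD i : 0 <= g (x i) <= tau^-1 * (D i - D i.+1).
  rewrite g0/= ler_pdivlMl//; have := step _ (xb i).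
  by rewrite -/(x i.+1) /D; lra.
rewrite gxs; apply: (@squeeze_cvgr _ _ _ _ (fun=> 0) (fun i => tau^-1 * (D i - D i.+1))).
- by apply: nearW => i; exact: gD.
- exact: cvg_cst.
- rewrite -(mulr0 tau^-1); apply: cvgMr; rewrite -(subrr (limn D)).
  apply: cvgB => //.
  by have := Dcvg; rewrite -(cvg_shiftS D).
Qed.

End gradient_descent.

(** * The least-squares objective along the forward map *)

Section least_squares.
Context {R : realType} {k p m : nat}.
Variables (d : 'M[R]_(m, 2)) (om : 'I_m -> 'cV[R]_p).
Variable thetas : 'rV[R]_(k + k * p).
Local Notation forward := (@forward R k p m d om).
Local Notation jacobian := (@jacobian R k p m d om).
Local Notation curvature := (@curvature R k p m d om).

Let g theta := norm2 (forward theta - forward thetas) ^+ 2.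

Lemma derive_least_squares theta u :
  'D_u g theta = 2 * frob (forward theta - forward thetas) (jacobian theta u).
Proof.
set r := forward theta - forward thetas; set J := jacobian theta u.
pose N := curvature theta u; have N0 : 0 <= N := curvature_ge0 _ _ _ _.
(* The first summand pairs the residual with the Taylor error; the second bounds the squared
   increment when |h| <= 1. *)
apply: (@derive_quadratic _ _ _ _ _ _ (2 * norm2 r * N + (norm2 J + N) ^+ 2)) => h h1.
set e := forward (theta + h *: u) - forward theta - h *: J.
have eN : norm2 e <= N * h ^+ 2.
  rewrite /e -jacobianZ (le_trans (forward_taylor _ _ _ _))//.
  by rewrite curvatureZ mulrC.
have aux (A B C D : 'M[R]_(m, 2)) : A - C = (B - C) + (D + (A - B - D)).
  by apply/matrixP => i j; rewrite !mxE; ring.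
have gE : g (theta + h *: u) = norm2 (r + (h *: J + e)) ^+ 2.
  rewrite /g (_ : forward (theta + h *: u) - forward thetas = r + (h *: J + e))//.
  exact: aux.
rewrite gE norm2D_sqr frobDr frobZr /g -/r.
rewrite [X in `|X|](_ : _ = 2 * frob r e + norm2 (h *: J + e) ^+ 2); last by ring.
rewrite (le_trans (ler_normD _ _))// [leRHS]mulrDl lerD//.
  rewrite normrM ger0_norm// -!mulrA ler_wpM2l// (le_trans (frob_CS _ _))//.
  by rewrite ler_wpM2l.
rewrite ger0_norm ?sqr_ge0// -exprMn_comm; last exact: mulrC.
rewrite -[leRHS](_ : ((norm2 J + N) * `|h|) ^+ 2 = _); last first.
  by rewrite !exprMn real_normK ?num_real.
rewrite ler_sqr ?nnegrE ?mulr_ge0 ?addr_ge0// (le_trans (norm2D _ _))// norm2Z mulrDl.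
rewrite mulrC lerD// (le_trans eN)// ler_wpM2l//.
by rewrite -real_normK ?num_real// expr2 ler_piMl.
Qed.

Lemma frob_gradient_least_squares theta u :
  frob (gradient g theta) u =
  2 * frob (forward theta - forward thetas) (jacobian theta u).
Proof.
have {2}-> : u = \sum_j u 0 j *: delta_mx 0 j.
  by rewrite [LHS]matrix_sum_delta big_ord1.
rewrite (big_morph (jacobian theta) (id1 := 0) (op1 := +%R)); last 2 first.
- by move=> ? ?; exact: jacobianD.
- by rewrite -(scale0r 0) jacobianZ !scale0r.
rewrite frob_sumr mulr_sumr /frob big_ord1; apply: eq_bigr => j _.
by rewrite mxE derive_least_squares jacobianZ -/(frob _ _) frobZr; ring.
Qed.

(** Test the gradient against itself: |grad g|^2 = 2 (r . J grad g) <= 2 |r| B |grad g|. *)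
Lemma norm2_gradient_least_squares (B : R) theta : 0 <= B ->
  (forall u, norm2 (jacobian theta u) <= B * norm2 u) ->
  norm2 (gradient g theta) ^+ 2 <= (2 * B) ^+ 2 * g theta.
Proof.
move=> B0 JB; set G := gradient g theta.
have [->|G0] := eqVneq G 0; first by rewrite norm2_0 expr0n mulr_ge0 ?sqr_ge0.
have nG : 0 < norm2 G by rewrite norm2_gt0.
rewrite /g -exprMn ler_sqr ?nnegrE ?mulr_ge0//.
rewrite -(ler_pM2r nG) -expr2 norm2_sqr {1}/G frob_gradient_least_squares -/G.
rewrite -!mulrA ler_wpM2l// (le_trans (ler_norm _))// (le_trans (frob_CS _ _))//.
by rewrite mulrCA ler_wpM2l// JB.
Qed.

(** The norms of an atom and of its derivative do not depend on the mean, so bounded amplitudes give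
    a uniform bound. *)
Lemma jacobian_bounded (a : R) : 0 <= a -> exists2 B : R, 0 <= B &
  forall theta u, (forall i, `|amplitude theta i| <= a) ->
  norm2 (jacobian theta u) <= B * norm2 u.
Proof.
move=> a0; pose H := cnorm1 d (fun=> 1); pose S := cnorm1 d (fun l => norm2 (om l)).
have H0 : 0 <= H := cnorm1_ge0 _ _; have S0 : 0 <= S := cnorm1_ge0 _ _.
exists (\sum_(i < k) (H + a * S)).
  by apply: sumr_ge0 => i _; rewrite addr_ge0 ?mulr_ge0.
move=> theta u ha; rewrite mulr_suml (le_trans (norm2_sum _))//.
apply: ler_sum => i _; rewrite (le_trans (norm2D _ _))// !norm2Z norm2_atom norm2_datom.
rewrite mulrDl mulrC lerD//; first by rewrite ler_wpM2l ?amplitude_le_norm2.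
rewrite -mulrA ler_pM ?speed1_ge0// (le_trans (speed1_le _ _ _))//.
by rewrite ler_wpM2l ?mean_le_norm2.
Qed.

(* With delta = theta - thetas, the residual, the Jacobian at theta and the
   Jacobian at thetas applied to delta agree up to the second-order term
   [curvature thetas delta], a small fraction of the residual. *)
Lemma least_squares_basin (s c beta : R) :
  0 < beta -> 0 < s -> c * beta <= s / 4 ->
  (forall u, s * norm2 u <= norm2 (jacobian thetas u)) ->
  (forall u, curvature thetas u <= c * norm2 u ^+ 2) ->
  basin_of_attraction g thetas [set theta | norm2 (theta - thetas) < beta].
Proof.
(* With N the curvature, s |delta| <= |r| + N and 4 N <= s |delta| give 3 N <= |r|. Then r . J >=
   |r|^2 - |r| N >= (2/3) |r|^2, more than the half that is required. *)
have three (x y z : R) : s * x <= y + z -> z <= s / 4 * x -> 3 * z <= y by lra.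
have final (x y z w : R) : 0 <= x -> x - w <= y * z -> y * (3 * z) <= x -> x <= 2 * w.
  by lra.
move=> beta0 s0 cs Jlow curv.
have a0 : 0 <= norm2 thetas + beta by rewrite addr_ge0// ltW.
have [B B0 JB] := jacobian_bounded a0.
apply: (@basin_of_descent _ _ _ _ _ ((2 * B) ^+ 2)) => //.
- exact: sqr_ge0.
- by move=> theta; exact: sqr_ge0.
- by rewrite /g subrr norm2_0 expr0n.
- move=> theta; set del := theta - thetas => delb.
  rewrite frob_gradient_least_squares /g.
  have thE : theta = thetas + del by rewrite /del addrC subrK.
  clearbody del; subst theta.
  set r := forward _ - forward _; set J := jacobian _ del.
  have E1 : norm2 (r - jacobian thetas del) <= curvature thetas del.
    exact: forward_taylor.
  have E2 : norm2 (r - J) <= curvature thetas del by exact: forward_taylor_back.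
  have cN : curvature thetas del <= s / 4 * norm2 del.
    have [c0|c0] := leP c 0.
      rewrite (le_trans (curv _))// (@le_trans _ _ 0)// ?mulr_le0_ge0 ?sqr_ge0//.
      by rewrite mulr_ge0// divr_ge0// ltW.
    rewrite (le_trans (curv _))// expr2 mulrA ler_wpM2r//.
    by rewrite (le_trans _ cs)// ler_pM2l// ltW.
  have low : s * norm2 del <= norm2 r + curvature thetas del.
    rewrite (le_trans (Jlow _))// (le_trans _ (lerD (lexx _) E1))//.
    by rewrite -[X in norm2 X <= _](subKr r) (le_trans (norm2D _ _))// norm2N.
  have CS : frob r (r - J) <= norm2 r * curvature thetas del.
    rewrite (le_trans (ler_norm _))// (le_trans (frob_CS _ _))//.
    by rewrite ler_wpM2l.
  have N0 : 0 <= curvature thetas del := curvature_ge0 _ _ _ _.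
  have r3 := three _ _ _ low cN.
  move: CS; rewrite frobDr frobNr -norm2_sqr => CS.
  have : norm2 r * (3 * curvature thetas del) <= norm2 r ^+ 2.
    by rewrite expr2 ler_wpM2l.
  exact: final (sqr_ge0 _) CS.
- move=> theta thb; apply: norm2_gradient_least_squares => // u; apply: JB => i.
  rewrite -[theta](subrK thetas) addrC amplitudeD (le_trans (ler_normD _ _))//.
  by rewrite lerD ?amplitude_le_norm2// (le_trans (amplitude_le_norm2 _ _))// ltW.
Qed.

End least_squares.

(** * Mixtures in the kernel norm *)

(** Division by h^2 leaves x <= y + M h. This replaces the limit h -> 0 for the RIP, for the Fourier
    decay and for the cross term of the kernel. *)
Lemma le_of_cubic_error (R : realType) (x y M h0 : R) : 0 < h0 ->
  (forall h, 0 < h -> h <= h0 -> x * h ^+ 2 <= y * h ^+ 2 + M * h ^+ 3) -> x <= y.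
Proof.
move=> h00 hM; rewrite -subr_le0 leNgt; apply/negP => xy.
pose h := Num.min h0 ((x - y) / (2 * (`|M| + 1))).
have M1 : 0 < 2 * (`|M| + 1) by have := normr_ge0 M; lra.
have h_gt0 : 0 < h by rewrite lt_min h00 divr_gt0.
have hh0 : h <= h0 by rewrite ge_min lexx.
have h1 : h * (2 * (`|M| + 1)) <= x - y.
  by rewrite -ler_pdivlMr// ge_min lexx orbT.
have h2 : 0 < h ^+ 2 by rewrite exprn_gt0.
have h3 : x * h ^+ 2 <= (y + M * h) * h ^+ 2.
  by rewrite mulrDl -mulrA -exprS; exact: hM.
move: h3; rewrite ler_pM2r// => h3.
have : M * h <= `|M| * h by rewrite ler_wpM2r ?ler_norm// ltW.
lra.
Qed.

Section mixture_density.
Context {R : realType} {p : nat}.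
Variable G : 'M[R]_p.
Hypotheses (Gpos : posdefmx G) (gauss_int : ivec (gauss G)).

Definition vdens (nu : smeasure) (f : 'cV[R]_p -> R) : Prop :=
  has_density (lebesgue_tuple R p) nu (f \o @vec_of_tuple R p).

Lemma vdens_gauss s : vdens (gauss_measure G s) (fun u => gauss G (u - s)).
Proof. by apply: has_density_charge_density; exact: (ivec_gauss gauss_int). Qed.

Lemma vdens_dgauss w s :
  vdens (dgauss_measure G w s) (fun u => -1 * gderiv G w (u - s)).
Proof.
have := has_density_charge_density (ivecZ (-1) (ivec_gderiv Gpos gauss_int w s)).
rewrite /vdens /dgauss_measure /with_density.
rewrite (_ : (fun u => -1 * gderiv G w (u - s)) =
  (fun t => - dotv w (invmx G *m (t - s)) * gauss G (t - s)))//.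
by apply/funext => u; rewrite /gderiv /gdot mulN1r mulNr.
Qed.

Context {k : nat}.
Implicit Types theta u : 'rV[R]_(k + k * p).

Definition mix_density theta x : R :=
  \sum_i amplitude theta i * gauss G (x - mean theta i).

Definition dmix_density theta u x : R :=
  \sum_i (amplitude u i * gauss G (x - mean theta i) +
          amplitude theta i * gderiv G (mean u i) (x - mean theta i)).

Lemma ivec_mix_density theta : ivec (mix_density theta).
Proof. by apply: ivec_sum => i; apply: ivecZ; exact: ivec_gauss. Qed.

Lemma ivec_dmix_density theta u : ivec (dmix_density theta u).
Proof.
apply: ivec_sum => i; apply: (ivecD (ivecZ _ (ivec_gauss gauss_int _))).
exact: ivecZ (ivec_gderiv Gpos gauss_int _ _).
Qed.

Lemma vdens_phi theta : vdens (phi G theta) (mix_density theta).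
Proof. by apply: has_density_sum => i; apply: has_density_scale; exact: vdens_gauss. Qed.

Lemma vdens_phi_sub theta theta' : vdens (charge_sub (phi G theta) (phi G theta'))
  (fun x => mix_density theta x - mix_density theta' x).
Proof. by apply: has_density_sub; exact: vdens_phi. Qed.

Definition mix_error theta u x : R :=
  mix_density (theta + u) x - mix_density theta x - dmix_density theta u x.

Lemma ivec_mix_error theta u : ivec (mix_error theta u).
Proof.
apply: (ivecB (ivecB (ivec_mix_density (theta + u)) (ivec_mix_density theta))).
exact: ivec_dmix_density.
Qed.

(** Component i contributes (a + h b) times the Gaussian remainder along h v, quadratic in h by
    [gauss_taylor_L1], plus the mixed term h^2 b [gderiv]. *)
Lemma mix_error_L1 theta u : exists2 M : R, 0 <= M & forall h, 0 < h -> h <= 1 ->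
  lint (fun x => `|mix_error theta (h *: u) x|) <= M * h ^+ 2.
Proof.
pose I := lint (gauss G).
have I0 : 0 <= I by apply: lint_ge0 => x; exact: gauss_ge0.
pose D v := lint (fun x => `|gderiv G v x|).
have D0 v : 0 <= D v by apply: lint_ge0 => x.
pose M := \sum_i ((`|amplitude theta i| + `|amplitude u i|) *
  (normG2 G (mean u i) * I) + `|amplitude u i| * D (mean u i)).
exists M.
  apply: sumr_ge0 => i _; rewrite addr_ge0 ?mulr_ge0 ?addr_ge0//.
  exact: normG2_ge0.
move=> h h0 h1.
pose rem v x := gauss G (x - v) - gauss G x - gderiv G v x.
have irem v : ivec (rem v).
  exact: ivecB (ivecB (ivec_gauss gauss_int v) gauss_int) (ivec_gderiv0 Gpos gauss_int v).
pose E i x := (`|amplitude theta i| + `|amplitude u i|) *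
    `|rem (h *: mean u i) (x - mean theta i)| +
  (h ^+ 2 * `|amplitude u i|) * `|gderiv G (mean u i) (x - mean theta i)|.
have iE1 i : ivec (fun x => `|rem (h *: mean u i) (x - mean theta i)|).
  exact: (ivec_shift (- mean theta i) (ivec_norm (irem (h *: mean u i)))).
have iE2 i : ivec (fun x => `|gderiv G (mean u i) (x - mean theta i)|).
  exact: ivec_norm (ivec_gderiv Gpos gauss_int _ _).
have iE i : ivec (E i) by exact: ivecD (ivecZ _ (iE1 i)) (ivecZ _ (iE2 i)).
have bound : lint (fun x => `|mix_error theta (h *: u) x|) <= lint (fun x => \sum_i E i x).
  apply: le_lint; [exact/ivec_norm/ivec_mix_error|exact: ivec_sum|move=> x].
  rewrite /mix_error /mix_density /dmix_density -!sumrB.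
  rewrite (le_trans (ler_norm_sum _ _ _))//; apply: ler_sum => i _.
  rewrite amplitudeD meanD amplitudeZ meanZ opprD addrA.
  set a := amplitude theta i; set b := amplitude u i; set v := mean u i.
  set z := x - mean theta i.
  rewrite [X in `|X|](_ : _ = (a + h * b) * rem (h *: v) z + (h ^+ 2 * b) * gderiv G v z);
    last first.
    rewrite /rem gderivZ.
    by move: (gauss _ _) (gauss _ _) (gderiv _ _ _) => g1 g2 g3; clear; ring.
  rewrite (le_trans (ler_normD _ _))// (normrM (a + h * b)) (normrM (h ^+ 2 * b)).
  rewrite (normrM (h ^+ 2) b) (ger0_norm (sqr_ge0 h)) lerD// ler_wpM2r//.
  rewrite (le_trans (ler_normD _ _))// lerD// normrM ger0_norm ?(ltW h0)//.
  by rewrite ler_piMl.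
rewrite (le_trans bound)// (lint_sum iE) mulr_suml; apply: ler_sum => i _.
rewrite (lintD (ivecZ _ (iE1 i)) (ivecZ _ (iE2 i))) (lintZ _ (iE1 i)) (lintZ _ (iE2 i)).
rewrite (lint_shift (f := fun x => `|rem (h *: mean u i) x|) (- mean theta i));
  last exact: ivec_mvec (ivec_norm (irem _)).
rewrite (lint_shift (f := fun x => `|gderiv G (mean u i) x|) (- mean theta i));
  last exact: ivec_mvec (ivec_norm (ivec_gderiv0 Gpos gauss_int _)).
rewrite [leRHS]mulrDl; apply: lerD; last by rewrite -/(D _); lra.
rewrite -mulrA ler_wpM2l ?addr_ge0// (le_trans (gauss_taylor_L1 Gpos gauss_int _))//.
by rewrite normG2Z -/I -mulrA mulrC.
Qed.

End mixture_density.

(** * The Gaussian kernel as a bounded bilinear form *)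

Section gaussian_kernel_form.
Context {R : realType} {p : nat}.
Variable G : 'M[R]_p.
Hypotheses (Gpos : posdefmx G).
Variable K : 'cV[R]_p -> R.
Hypothesis K_gaussian : gaussian_kernel G K.

Definition tuple_kernel (z : Rtuple R p * Rtuple R p) : R :=
  K (vec_of_tuple z.2 - vec_of_tuple z.1).

Lemma measurable_tuple_kernel : measurable_fun setT tuple_kernel.
Proof.
have [kappa [lam [_ _ KE]]] := K_gaussian.
have -> : tuple_kernel = (fun q => kappa * expR (- (lam ^+ 2 * q / 2))) \o
    (fun z : Rtuple R p * Rtuple R p => \sum_i (tnth z.2 i - tnth z.1 i) *
      (dotv (delta_mx i 0) (invmx G *m vec_of_tuple z.2) -
       dotv (delta_mx i 0) (invmx G *m vec_of_tuple z.1))).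
  apply/funext => z; rewrite /tuple_kernel KE.
  suff -> : normG2 G (vec_of_tuple z.2 - vec_of_tuple z.1) =
      \sum_i (tnth z.2 i - tnth z.1 i) *
      (dotv (delta_mx i 0) (invmx G *m vec_of_tuple z.2) -
       dotv (delta_mx i 0) (invmx G *m vec_of_tuple z.1)) by [].
  have subE (A B : 'cV[R]_p) i : (A - B) i 0 = A i 0 - B i 0 by rewrite !mxE.
  rewrite /normG2 dotvE /frob; apply: eq_bigr => i _; rewrite big_ord1 mulmxBr.
  by rewrite !dotv_delta !subE; congr (_ * _); rewrite !mxE.
apply: measurableT_comp.
  apply: measurable_funM; first exact: measurable_cst.
  apply: measurableT_comp => //; apply: measurableT_comp => //.
  apply: measurable_funM; last exact: measurable_cst.
  by apply: measurable_funM => //; exact: measurable_cst.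
apply: measurable_sum => i.
have m1 (f : Rtuple R p -> R) : measurable_fun setT f ->
    measurable_fun setT (fun z : Rtuple R p * Rtuple R p => f z.1).
  by move=> mf; apply: measurableT_comp => //; exact: measurable_fst.
have m2 (f : Rtuple R p -> R) : measurable_fun setT f ->
    measurable_fun setT (fun z : Rtuple R p * Rtuple R p => f z.2).
  by move=> mf; apply: measurableT_comp => //; exact: measurable_snd.
apply: measurable_funM; apply: measurable_funB.
- exact: (m2 (fun t => tnth t i) (measurable_tnth i)).
- exact: (m1 (fun t => tnth t i) (measurable_tnth i)).
- exact: (m2 _ (mvec_dot_mulmx _ _)).
- exact: (m1 _ (mvec_dot_mulmx _ _)).
Qed.

Lemma gaussian_kernel_ge0 t : 0 <= K t.
Proof. by have [kappa [lam [k0 _ ->]]] := K_gaussian; rewrite mulr_ge0 ?expR_ge0 ?ltW. Qed.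

Lemma gaussian_kernel_bound : exists kappa : R, forall t, `|K t| <= kappa.
Proof.
have [kappa [lam [k0 l0 KE]]] := K_gaussian; exists kappa => t.
rewrite ger0_norm ?gaussian_kernel_ge0// KE -[leRHS]mulr1 ler_wpM2l ?(ltW k0)//.
rewrite -[leRHS]expR0 ler_expR oppr_le0 divr_ge0// mulr_ge0 ?sqr_ge0//.
exact: normG2_ge0.
Qed.

Definition KF (f g : 'cV[R]_p -> R) : R :=
  kernel_form (lebesgue_tuple R p) tuple_kernel
    (f \o @vec_of_tuple R p) (g \o @vec_of_tuple R p).

Lemma KFE f g : KF f g = lint (fun s => lint (fun t => K (t - s) * g t) * f s).
Proof. by []. Qed.

Lemma knorm2_vdens nu f : vdens nu f -> knorm2 K nu = KF f f.
Proof.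
move=> nuf; have [kappa kP] := gaussian_kernel_bound.
apply: (charge_double_integral_density (M := kappa) _ _ nuf).
- exact: measurable_tuple_kernel.
- by move=> z; exact: kP.
Qed.

Lemma KF_expand f g (a b : R) : ivec f -> ivec g ->
  KF (fun x => a * f x + b * g x) (fun x => a * f x + b * g x) =
  a ^+ 2 * KF f f + a * b * (KF f g + KF g f) + b ^+ 2 * KF g g.
Proof.
move=> fi gi; have [kappa kP] := gaussian_kernel_bound.
exact: (kernel_form_expand measurable_tuple_kernel (fun z => kP _) a b fi gi).
Qed.

Lemma KF_bound : exists2 kappa : R, 0 <= kappa & forall f g, ivec f -> ivec g ->
  `|KF f g| <= kappa * lint (fun x => `|f x|) * lint (fun x => `|g x|).
Proof.
have [kappa kP] := gaussian_kernel_bound.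
exists kappa; first exact: le_trans (kP 0).
move=> f g fi gi.
exact: (kernel_form_bound measurable_tuple_kernel (fun z => kP _) fi gi).
Qed.

(** The kernel sees only differences, so both integration variables can be shifted, one after the
    other. *)
Lemma KF_shift f s : ivec f -> KF (fun x => f (x - s)) (fun x => f (x - s)) = KF f f.
Proof.
move=> fi; rewrite !KFE.
have [kappa kP] := gaussian_kernel_bound.
have mKs t : mvec (fun x => K (x - t)).
  have [ka [lam [_ _ KE]]] := K_gaussian.
  have -> : (fun x => K (x - t)) = (fun q => ka * expR (- (lam ^+ 2 * q / 2))) \o
    (fun x => normG2 G (x - t)) by apply/funext => x; rewrite /= KE.
  apply: mvec_comp; last exact: (mvec_shift (- t) (mvec_normG2 G)).
  apply: measurable_funM; first exact: measurable_cst.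
  apply: measurableT_comp => //; apply: measurableT_comp => //.
  apply: measurable_funM; last exact: measurable_cst.
  by apply: measurable_funM => //; exact: measurable_cst.
pose P t := lint (fun x => K (x - t) * f x).
have mP : mvec P.
  exact: (measurable_kernel_potential measurable_tuple_kernel (fun z => kP _) fi).
rewrite -[RHS](lint_shift (- s)); last by apply: mvecM => //; exact: ivec_mvec.
apply: eq_lint => t; congr (_ * _).
rewrite -[RHS](lint_shift (- s)); last by apply: mvecM => //; exact: ivec_mvec.
by apply: eq_lint => x; rewrite opprB addrA subrK.
Qed.

End gaussian_kernel_form.

(** * Kernel norms of Gaussians and their derivatives *)

Section kernel_estimates.
Context {R : realType} {p : nat}.
Variable G : 'M[R]_p.
Hypotheses (Gpos : posdefmx G) (gauss_int : ivec (gauss G)).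
Variable K : 'cV[R]_p -> R.
Hypothesis K_gaussian : gaussian_kernel G K.

Let norm1 (f : 'cV[R]_p -> R) := lint (fun x => `|f x|).

Let norm1_ge0 f : 0 <= norm1 f. Proof. exact: lint_ge0. Qed.

Let norm1D f g (a b : R) : ivec f -> ivec g ->
  norm1 (fun x => a * f x + b * g x) <= `|a| * norm1 f + `|b| * norm1 g.
Proof.
move=> fi gi; have fi' := ivecZ `|a| (ivec_norm fi); have gi' := ivecZ `|b| (ivec_norm gi).
rewrite /norm1 -(lintZ _ (ivec_norm fi)) -(lintZ _ (ivec_norm gi)) -(lintD fi' gi').
apply: le_lint; [exact/ivec_norm/(ivecD (ivecZ a fi) (ivecZ b gi))|exact: ivecD|].
by move=> x; rewrite -!normrM ler_normD.
Qed.

(** Cross terms cost h times h^2, and the square of the perturbation h^4 <= h^3. The constant is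
    uniform in e, so h may vary together with e. *)
Lemma KF_perturb_scale f (c : R) : ivec f -> 0 <= c ->
  exists2 M : R, 0 <= M & forall e h, ivec e -> 0 <= h -> h <= 1 ->
  lint (fun x => `|e x|) <= c * h ^+ 2 ->
  `|KF K (fun x => h * f x + 1 * e x) (fun x => h * f x + 1 * e x) - h ^+ 2 * KF K f f|
    <= M * h ^+ 3.
Proof.
move=> fi c0; have [kappa k0 kP] := KF_bound Gpos K_gaussian.
have aux1 (h x y z : R) : h ^+ 2 * x + h * 1 * y + 1 ^+ 2 * z - h ^+ 2 * x = h * y + z.
  by ring.
have aux3 (h n : R) : h * (2 * kappa * n * (c * h ^+ 2)) + kappa * (c ^+ 2 * h ^+ 3) =
    (2 * kappa * n * c + kappa * c ^+ 2) * h ^+ 3 by ring.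
exists (2 * kappa * norm1 f * c + kappa * c ^+ 2).
  by rewrite addr_ge0// ?mulr_ge0.
move=> e h ei h0 h1 ec; rewrite (KF_expand Gpos K_gaussian)//.
have b1 := kP _ _ fi ei; have b2 := kP _ _ ei fi; have b3 := kP _ _ ei ei.
rewrite -/(norm1 e) -/(norm1 f) in ec b1 b2 b3.
have e0 := norm1_ge0 e; have f0 := norm1_ge0 f.
rewrite aux1.
have c2 : norm1 e * norm1 e <= c ^+ 2 * h ^+ 3.
  rewrite (le_trans (ler_pM e0 e0 ec ec))//.
  rewrite -expr2 exprMn ler_wpM2l ?sqr_ge0// -exprM.
  by rewrite ler_wiXn2l.
have B : `|KF K f e + KF K e f| <= 2 * kappa * norm1 f * (c * h ^+ 2).
  rewrite (le_trans (ler_normD _ _))// (le_trans (lerD b1 b2))//.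
  rewrite (mulrAC kappa (norm1 e)) -mulr2n -[leRHS]mulrA -[leRHS]mulrA -mulrA mulr_natl.
  by rewrite lerMn2r/= ler_wpM2l// ler_wpM2l.
have B' : h * `|KF K f e + KF K e f| <= h * (2 * kappa * norm1 f * (c * h ^+ 2)).
  by rewrite ler_wpM2l.
have B3 : `|KF K e e| <= kappa * (c ^+ 2 * h ^+ 3).
  by rewrite (le_trans b3)// -mulrA ler_wpM2l.
rewrite (le_trans (ler_normD _ _))// normrM (ger0_norm h0).
by rewrite (le_trans (lerD B' B3))// aux3.
Qed.

Section unit_norm.
Hypothesis K_unit : forall s, knorm K (gauss_measure G s) = 1.

Lemma KF_gauss_unit s : KF K (fun x => gauss G (x - s)) (fun x => gauss G (x - s)) = 1.
Proof.
rewrite -(knorm2_vdens Gpos K_gaussian (vdens_gauss gauss_int s)).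
have := K_unit s; rewrite /knorm => h.
(* [Num.sqrt] vanishes on negative numbers, so a norm equal to 1 excludes a negative square. *)
have k0 : 0 <= knorm2 K (gauss_measure G s).
  rewrite leNgt; apply/negP => /ltW k0; move: h; rewrite ler0_sqrtr// => /eqP.
  by rewrite eq_sym oner_eq0.
by rewrite -(sqr_sqrtr k0) h expr1n.
Qed.

(* The K-norm of a translate of the Gaussian does not depend on the translation,
   so its derivative, twice the cross term, vanishes. *)
Lemma KF_cross_eq0 s v :
  KF K (fun x => gauss G (x - s)) (fun x => gderiv G v (x - s)) +
  KF K (fun x => gderiv G v (x - s)) (fun x => gauss G (x - s)) = 0.
Proof.
pose g x := gauss G (x - s); pose q x := gderiv G v (x - s).
have gi : ivec g := ivec_gauss gauss_int s.
have qi : ivec q := ivec_gderiv Gpos gauss_int v s.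
have [kappa k0 kP] := KF_bound Gpos K_gaussian.
have aux1 (x y z w : R) : 1 = 1 ^+ 2 * (1 + x + y) + 1 * 1 * z + 1 ^+ 2 * w ->
  x + y = - (z + w) by move=> E; lra.
have aux3 (x y : R) : `|x| <= `|x + y| + `|y|.
  by rewrite -[X in `|X| <= _](addrK y) ler_normB.
have aux4 (h Y : R) : Y * h ^+ 2 = h * (h * Y) by ring.
have aux5 (h Z : R) : Z * h ^+ 3 = h * (Z * h ^+ 2) by ring.
have aux2 (n h c : R) : kappa * (n * (c * h ^+ 2)) + kappa * (n * (c * h ^+ 2)) +
    kappa * (c ^+ 2 * h ^+ 2) = (2 * kappa * n * c + kappa * c ^+ 2) * h ^+ 2 by ring.
set X := _ + _; rewrite -/g -/q in X *.
pose c := normG2 G v * lint (gauss G).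
have c0 : 0 <= c by rewrite mulr_ge0 ?normG2_ge0 ?lint_ge0// => x; exact: gauss_ge0.
pose N := norm1 g + norm1 q.
have N0 : 0 <= N by rewrite addr_ge0.
(* The translate by h v is f + e, with f = g + h q its linear part and e an L1 error of order h^2.
   Its K-norm is 1, so the excess of f over 1 is of order h^2 as well. *)
have key h : 0 < h -> h <= 1 ->
    `|h * X + h ^+ 2 * KF K q q| <= (2 * kappa * N * c + kappa * c ^+ 2) * h ^+ 2.
  move=> h0 h1.
  pose e x := gauss G (x - s - h *: v) - gauss G (x - s) - gderiv G (h *: v) (x - s).
  have ei : ivec e.
    have ii : ivec (fun x => gauss G (x - h *: v) - gauss G x - gderiv G (h *: v) x).
      exact: ivecB (ivecB (ivec_gauss gauss_int _) gauss_int) (ivec_gderiv0 Gpos gauss_int _).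
    exact: (ivec_shift (- s) ii).
  have ec : norm1 e <= c * h ^+ 2.
    have ii : ivec (fun x => `|gauss G (x - h *: v) - gauss G x - gderiv G (h *: v) x|).
      apply: ivec_norm.
      exact: ivecB (ivecB (ivec_gauss gauss_int _) gauss_int) (ivec_gderiv0 Gpos gauss_int _).
    rewrite /norm1 /e (lint_shift (f := fun x =>
      `|gauss G (x - h *: v) - gauss G x - gderiv G (h *: v) x|) (- s) (ivec_mvec ii)).
    by rewrite (le_trans (gauss_taylor_L1 Gpos gauss_int _))// normG2Z /c -mulrA mulrC.
  pose f x := 1 * g x + h * q x.
  have fi : ivec f by exact: ivecD (ivecZ _ gi) (ivecZ _ qi).
  have fN : norm1 f <= N.
    rewrite (le_trans (norm1D _ _ gi qi))// normr1 mul1r lerD// ger0_norm ?(ltW h0)//.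
    by rewrite ler_piMl.
  have fE : KF K f f = 1 + h * X + h ^+ 2 * KF K q q.
    by rewrite (KF_expand Gpos K_gaussian)// [KF K g g]KF_gauss_unit expr1n !mul1r.
  have := KF_gauss_unit (s + h *: v).
  rewrite (_ : (fun x => gauss G (x - (s + h *: v))) = (fun x => 1 * f x + 1 * e x)); last first.
    by apply/funext => x; rewrite /f /e /g /q gderivZ opprD addrA; ring.
  rewrite (KF_expand Gpos K_gaussian)// fE => E.
  rewrite (aux1 _ _ _ _ (esym E)).
  have b1 := kP _ _ fi ei; have b2 := kP _ _ ei fi; have b3 := kP _ _ ei ei.
  rewrite -/(norm1 e) -/(norm1 f) in b1 b2 b3.
  have e0 := norm1_ge0 e; have f0 := norm1_ge0 f.
  have c2 : norm1 e * norm1 e <= c ^+ 2 * h ^+ 2.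
    rewrite (le_trans (ler_pM e0 e0 ec ec))//.
    rewrite -expr2 exprMn ler_wpM2l ?sqr_ge0// -exprM.
    by rewrite ler_wiXn2l// ltW.
  have fe : norm1 f * norm1 e <= N * (c * h ^+ 2) by rewrite ler_pM.
  have B1 : kappa * norm1 f * norm1 e <= kappa * (N * (c * h ^+ 2)).
    by rewrite -mulrA ler_wpM2l.
  have B3 : kappa * norm1 e * norm1 e <= kappa * (c ^+ 2 * h ^+ 2).
    by rewrite -mulrA ler_wpM2l.
  rewrite normrN (le_trans (ler_normD _ _))//.
  rewrite (le_trans (lerD (ler_normD _ _) (lexx _)))//.
  rewrite (le_trans (lerD (lerD b1 b2) b3))//.
  rewrite (mulrAC kappa (norm1 e)) (le_trans (lerD (lerD B1 B1) B3))//.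
  by rewrite aux2.
(* Applied to Y = X and to Y = -X: h Y = O(h^2) forces Y <= 0. *)
have lim : forall Y : R, (forall h, 0 < h -> h <= 1 -> h * Y <= `|h * X + h ^+ 2 * KF K q q| +
    `|h ^+ 2 * KF K q q|) -> Y <= 0.
  move=> Y hY; apply: (@le_of_cubic_error _ _ _
    (2 * kappa * N * c + kappa * c ^+ 2 + `|KF K q q|) 1) => // h h0 h1.
  have := le_trans (hY h h0 h1) (lerD (key h h0 h1) (lexx _)).
  rewrite normrM (ger0_norm (sqr_ge0 h)) mul0r add0r => le1.
  by rewrite (aux4 h Y) (aux5 h) ler_pM2l// (le_trans le1)// [leRHS]mulrDl lerD// mulrC.
apply/le_anti/andP; split; last rewrite -oppr_le0.
  by apply: lim => h h0 h1; rewrite (le_trans (ler_norm _) (aux3 _ _)).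
by apply: lim => h h0 h1; rewrite mulrN (le_trans _ (aux3 _ _))// -normrN ler_norm.
Qed.

(** Orthogonality of a Gaussian to its derivative makes each block diagonal; this is where min(1,
    d_K a_1^2) originates. *)
Lemma KF_gauss_gderiv s v (a b : R) :
  KF K (fun x => b * gauss G (x - s) + a * gderiv G v (x - s))
       (fun x => b * gauss G (x - s) + a * gderiv G v (x - s)) =
  b ^+ 2 + a ^+ 2 * KF K (fun x => gderiv G v (x - s)) (fun x => gderiv G v (x - s)).
Proof.
rewrite (KF_expand Gpos K_gaussian _ _ (ivec_gauss gauss_int s)
  (ivec_gderiv Gpos gauss_int v s)).
by rewrite KF_cross_eq0 KF_gauss_unit mulr0 addr0 mulr1.
Qed.

End unit_norm.

Lemma KF_gderiv_shift v s :
  KF K (fun x => gderiv G v (x - s)) (fun x => gderiv G v (x - s)) =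
  KF K (gderiv G v) (gderiv G v).
Proof. exact: (KF_shift Gpos K_gaussian s (ivec_gderiv0 Gpos gauss_int v)). Qed.

(** The pointwise majorant of [gderiv v] after division by |v|; its kernel energy is D_K. *)
Let W u := norm2 (invmx G *m u) * gauss G u.

Let Wi : ivec W. Proof. exact: ivec_norm2_invmx_gauss. Qed.

Let mK s : mvec (fun t => K (t - s)).
Proof.
have [ka [lam [_ _ KE]]] := K_gaussian.
have -> : (fun x => K (x - s)) = (fun q => ka * expR (- (lam ^+ 2 * q / 2))) \o
  (fun x => normG2 G (x - s)) by apply/funext => x; rewrite /= KE.
apply: mvec_comp; last exact: (mvec_shift (- s) (mvec_normG2 G)).
apply: measurable_funM; first exact: measurable_cst.
apply: measurableT_comp => //; apply: measurableT_comp => //.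
apply: measurable_funM; last exact: measurable_cst.
by apply: measurable_funM => //; exact: measurable_cst.
Qed.

Let KWi s f : ivec f -> ivec (fun t => K (t - s) * f t).
Proof.
have [kappa kP] := gaussian_kernel_bound Gpos K_gaussian.
by move=> fi; exact: (ivec_bounded_mul (mK s) (fun t => kP (t - s)) fi).
Qed.

Lemma DK_constE : DK_const G K = KF K W W.
Proof.
rewrite KFE /DK_const; apply: eq_lint => s; rewrite mulrC -(lintZ _ (KWi s Wi)).
by apply: eq_lint => t; rewrite /W; ring.
Qed.

(** K is nonnegative, so the pointwise majorant |v| W can be inserted in both slots. *)
Lemma KF_gderiv_le v : KF K (gderiv G v) (gderiv G v) <= norm2 v ^+ 2 * DK_const G K.
Proof.
have [kappa kP] := gaussian_kernel_bound Gpos K_gaussian.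
have qi : ivec (gderiv G v) by exact: ivec_gderiv0.
rewrite DK_constE !KFE.
have WWi : ivec (fun s => lint (fun t => K (t - s) * W t) * W s).
  exact: (integrable_kernel_form (measurable_tuple_kernel K_gaussian) (fun z => kP _) Wi Wi).
have qqi : ivec (fun s => lint (fun t => K (t - s) * gderiv G v t) * gderiv G v s).
  exact: (integrable_kernel_form (measurable_tuple_kernel K_gaussian) (fun z => kP _) qi qi).
rewrite -(lintZ _ WWi); apply: le_lint => //; first exact: ivecZ.
move=> s; rewrite (le_trans (ler_norm _))// normrM.
have -> : norm2 v ^+ 2 * (lint (fun t => K (t - s) * W t) * W s) =
  (norm2 v * lint (fun t => K (t - s) * W t)) * (norm2 v * W s) by ring.
rewrite ler_pM//; last exact: gderiv_le.
rewrite (le_trans (le_normr_Rintegral measurableT (KWi s qi)))//.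
rewrite -(lintZ _ (KWi s Wi)).
apply: (le_lint (ivec_norm (KWi s qi)) (ivecZ (norm2 v) (KWi s Wi))) => t.
rewrite normrM (ger0_norm (gaussian_kernel_ge0 K_gaussian _)) mulrCA.
by rewrite ler_wpM2l ?(gaussian_kernel_ge0 K_gaussian)// gderiv_le.
Qed.

End kernel_estimates.

(** * Fourier measurements *)

Section fourier_measurement.
Context {R : realType} {p m : nat}.
Variable G : 'M[R]_p.
Hypotheses (Gpos : posdefmx G) (gauss_int : ivec (gauss G)).
Variables (c : 'M[R]_(m, 2)) (om : 'I_m -> 'cV[R]_p).

(** The measurement as a linear map on densities, in the m x 2 real encoding; at the centred
    Gaussian it gives the weights d_l. *)
Definition fmeas (f : 'cV[R]_p -> R) : 'M[R]_(m, 2) :=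
  \matrix_(l, b) lint (fun x => cexp c (phase om x) l b * f x).

Let weight (A : 'M[R]_(m, 2)) l := A l 0 ^+ 2 + A l 1 ^+ 2.

Lemma cexp_entry_le x l b : `|cexp c x l b| <= `|c l 0| + `|c l 1|.
Proof.
have h (u v s t : R) : `|s| <= 1 -> `|t| <= 1 -> `|u * s + v * t| <= `|u| + `|v|.
  move=> s1 t1; rewrite (le_trans (ler_normD _ _))// !normrM.
  by rewrite lerD// ler_piMr.
rewrite mxE; case: ifP => _; first exact: h (cos_max _) (sin_max _).
rewrite addrC -mulrN; have := h (c l 0) (c l 1) (- sin (x l)) (cos (x l)).
rewrite mulrN normrN; apply; [exact: sin_max|exact: cos_max].
Qed.

Lemma mvec_cexp l b : mvec (fun x => cexp c (phase om x) l b).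
Proof.
have mc : mvec (fun x => cos (dotv (om l) x)).
  apply: (mvec_comp (h := @cos R)); last exact: mvec_dot.
  by apply: continuous_measurable_fun; exact: continuous_cos.
have ms : mvec (fun x => sin (dotv (om l) x)).
  apply: (mvec_comp (h := @sin R)); last exact: mvec_dot.
  by apply: continuous_measurable_fun; exact: continuous_sin.
have cst (a : R) f : mvec f -> mvec (fun x : 'cV[R]_p => a * f x).
  by move=> mf; apply: mvecM => //; exact: measurable_cst.
have [b0|b0] := eqVneq b 0.
  rewrite (_ : (fun x => _) = (fun x => c l 0 * cos (dotv (om l) x) + c l 1 * sin (dotv (om l) x))).
    exact: measurable_funD (cst _ _ mc) (cst _ _ ms).
  by apply/funext => x; rewrite mxE b0 eqxx.
rewrite (_ : (fun x => _) = (fun x => c l 1 * cos (dotv (om l) x) - c l 0 * sin (dotv (om l) x))).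
  exact: measurable_funB (cst _ _ mc) (cst _ _ ms).
by apply/funext => x; rewrite mxE (negbTE b0).
Qed.

Lemma ivec_cexp_mul f l b : ivec f -> ivec (fun x => cexp c (phase om x) l b * f x).
Proof.
by move=> fi; exact: (ivec_bounded_mul (mvec_cexp l b) (fun x => cexp_entry_le _ l b) fi).
Qed.

Lemma fmeasZ f (a : R) : ivec f -> fmeas (fun x => a * f x) = a *: fmeas f.
Proof.
move=> fi; apply/matrixP => l b; rewrite !mxE.
rewrite -(lintZ _ (ivec_cexp_mul l b fi)).
by apply: eq_lint => x; rewrite mulrCA.
Qed.

Lemma fmeasB f g : ivec f -> ivec g -> fmeas (fun x => f x - g x) = fmeas f - fmeas g.
Proof.
move=> fi gi; apply/matrixP => l b; rewrite !mxE.
rewrite -(lintB (ivec_cexp_mul l b fi) (ivec_cexp_mul l b gi)).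
by apply: eq_lint => x; rewrite mulrBr.
Qed.

Lemma fmeas_sum k (f : 'I_k -> 'cV[R]_p -> R) : (forall i, ivec (f i)) ->
  fmeas (fun x => \sum_i f i x) = \sum_i fmeas (f i).
Proof.
move=> fi; apply/matrixP => l b; rewrite summxE !mxE.
under [RHS]eq_bigr do rewrite mxE.
rewrite -(lint_sum (fun i => ivec_cexp_mul l b (fi i))).
by apply: eq_lint => x; rewrite mulr_sumr.
Qed.

Local Notation d := (fmeas (gauss G)).

(** The character property: a sum of phases amounts to two successive rotations. *)
Let cexpD x y l b : cexp c (fun l => x l + y l) l b = cexp (cexp c x) y l b.
Proof.
by rewrite !mxE/= cosD sinD; case: ifP => _; ring.
Qed.

Lemma fmeas_gauss t : fmeas (fun x => gauss G (x - t)) = atom d om t.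
Proof.
apply/matrixP => l b; rewrite mxE.
rewrite -(lint_shift (f := fun x => cexp c (phase om x) l b * gauss G (x - t)) t); last first.
  apply: ivec_mvec; apply: ivec_cexp_mul; exact: (ivec_gauss gauss_int).
have ci b' := ivec_cexp_mul l b' gauss_int.
rewrite /atom [in RHS]mxE.
rewrite (eq_lint (g := fun x => cexp (cexp c (phase om x)) (phase om t) l b * gauss G x)); last first.
  move=> x; rewrite addrK -cexpD; congr (cexp c _ l b * _).
  by apply/funext => i; rewrite /phase !dotvE frobDr.
have [b0|b0] := eqVneq b 0.
  rewrite [d l 0]mxE [d l 1]mxE.
  rewrite (eq_lint (g := fun x => cos (phase om t l) * (cexp c (phase om x) l 0 * gauss G x)
    + sin (phase om t l) * (cexp c (phase om x) l 1 * gauss G x))).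
    rewrite (lintD (ivecZ _ (ci 0)) (ivecZ _ (ci 1))) (lintZ _ (ci 0)) (lintZ _ (ci 1)).
    by rewrite mulrC (mulrC (sin _)).
  by move=> x; rewrite [cexp (cexp _ _) _ _ _]mxE b0 eqxx; ring.
rewrite [d l 0]mxE [d l 1]mxE.
rewrite (eq_lint (g := fun x => cos (phase om t l) * (cexp c (phase om x) l 1 * gauss G x)
  - sin (phase om t l) * (cexp c (phase om x) l 0 * gauss G x))).
  rewrite (lintB (ivecZ _ (ci 1)) (ivecZ _ (ci 0))) (lintZ _ (ci 0)) (lintZ _ (ci 1)).
  by rewrite mulrC (mulrC (sin _)).
by move=> x; rewrite [cexp (cexp _ _) _ _ _]mxE (negbTE b0); ring.
Qed.

Lemma fmeas_mix_density k (theta : 'rV[R]_(k + k * p)) :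
  fmeas (mix_density G theta) = forward d om theta.
Proof.
rewrite /mix_density fmeas_sum; last by move=> i; apply: ivecZ; exact: ivec_gauss.
apply: eq_bigr => i _; rewrite fmeasZ; last exact: ivec_gauss.
by rewrite fmeas_gauss.
Qed.

(* Testing the second difference of the Gaussian against the character gives
   2 (1 - cos (h w.v)) |d|, and its L1 norm is at most 2 h^2 q(v) times the mass. *)
Lemma fourier_decay v l : weight d l * (phase om v l ^+ 2) ^+ 2 <=
  weight c l * (2 * (normG2 G v * lint (gauss G))) ^+ 2.
Proof.
have aux (A B D h : R) : A * ((h * B) ^+ 2 / 2 - (h * B) ^+ 3 / 2) <= D * h ^+ 2 ->
    A * (B ^+ 2 / 2) * h ^+ 2 <= D * h ^+ 2 + A * (B ^+ 3 / 2) * h ^+ 3.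
  by move=> ?; lra.
have aux2 (s t A Y Z : R) : A = s ^+ 2 -> A * (Y / 2) <= s * t * Z ->
    s * (s * Y) <= s * (t * (2 * Z)) by move=> -> ?; lra.
(* The real part of conj(d_l) times the l-th character. Its pairing with a translated Gaussian is
   |d_l|^2 times a cosine, and |psi| <= |d_l| |c_l|. *)
pose psi x := d l 0 * cexp c (phase om x) l 0 + d l 1 * cexp c (phase om x) l 1.
set I := lint (gauss G); set q := normG2 G v; set y := phase om v l.
have I0 : 0 <= I by apply: lint_ge0 => x; exact: gauss_ge0.
have q0 : 0 <= q by exact: normG2_ge0.
have wd0 : 0 <= weight d l by rewrite addr_ge0 ?sqr_ge0.
have wc0 : 0 <= weight c l by rewrite addr_ge0 ?sqr_ge0.
pose rho := Num.sqrt (weight d l) * Num.sqrt (weight c l).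
have rho0 : 0 <= rho by rewrite mulr_ge0 ?sqrtr_ge0.
have psi_le x : `|psi x| <= rho.
  rewrite -ler_sqr ?nnegrE// real_normK ?num_real// exprMn !sqr_sqrtr//.
  have -> : weight c l = weight (cexp c (phase om x)) l.
    rewrite /weight !mxE/= -[LHS]mulr1 -(cos2Dsin2 (phase om x l)); ring.
  rewrite /psi /weight; move: (cexp c _ l 0) (cexp c _ l 1) (d l 0) (d l 1) => A B C D.
  rewrite -subr_ge0 [X in 0 <= X](_ : _ = (C * B - D * A) ^+ 2) ?sqr_ge0//; ring.
have mpsi : mvec psi.
  have cst (a : R) f : mvec f -> mvec (fun x : 'cV[R]_p => a * f x).
    by move=> mf; apply: mvecM => //; exact: measurable_cst.
  exact: measurable_funD (cst _ _ (mvec_cexp l 0)) (cst _ _ (mvec_cexp l 1)).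
have psi_gauss w : lint (fun x => psi x * gauss G (x - w)) = weight d l * cos (phase om w l).
  have gi := ivec_gauss gauss_int w.
  rewrite (eq_lint (g := fun x => d l 0 * (cexp c (phase om x) l 0 * gauss G (x - w))
    + d l 1 * (cexp c (phase om x) l 1 * gauss G (x - w)))); last first.
    by move=> x; rewrite /psi mulrDl !mulrA.
  have i0 := ivec_cexp_mul l 0 gi; have i1 := ivec_cexp_mul l 1 gi.
  rewrite (lintD (ivecZ _ i0) (ivecZ _ i1)) (lintZ _ i0) (lintZ _ i1).
  have E b : lint (fun x => cexp c (phase om x) l b * gauss G (x - w)) = atom d om w l b.
    by rewrite -fmeas_gauss [RHS]mxE.
  have E0 : atom d om w l 0 = d l 0 * cos (phase om w l) + d l 1 * sin (phase om w l).
    by rewrite /atom [LHS]mxE.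
  have E1 : atom d om w l 1 = d l 1 * cos (phase om w l) - d l 0 * sin (phase om w l).
    by rewrite /atom [LHS]mxE.
  rewrite (E 0) (E 1) E0 E1 /weight.
  by move: (d l 0) (d l 1) (cos _) (sin _) => A B C D; ring.
have lin (f1 f2 f3 : 'cV[R]_p -> R) v1 v2 v3 : ivec f1 -> ivec f2 -> ivec f3 ->
    lint f1 = v1 -> lint f2 = v2 -> lint f3 = v3 ->
    lint (fun x => f1 x + f2 x - 2 * f3 x) = v1 + v2 - 2 * v3.
  move=> i1 i2 i3 <- <- <-.
  by rewrite (lintB (ivecD i1 i2) (ivecZ 2 i3)) (lintD i1 i2) (lintZ 2 i3).
clearbody psi; pose rem w x := gauss G (x - w) - gauss G x - gderiv G w x.
have irem w : ivec (rem w).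
  exact: ivecB (ivecB (ivec_gauss gauss_int w) gauss_int) (ivec_gderiv0 Gpos gauss_int w).
(* In the sum of the remainders at w and -w the first-order terms cancel, which leaves the second
   difference. *)
have step h : 0 < h -> weight d l * (1 - cos (h * y)) <= rho * (q * I) * h ^+ 2.
  move=> h0; pose w := h *: v.
  have wE : phase om w l = h * y by rewrite /w /y /phase !dotvE frobZr.
  have E : lint (fun x => psi x * (rem w x + rem (- w) x)) =
      - (2 * (weight d l * (1 - cos (h * y)))).
    have ig u : ivec (fun x => psi x * gauss G (x - u)).
      exact: (ivec_bounded_mul mpsi psi_le (ivec_gauss gauss_int u)).
    rewrite (eq_lint (g := fun x => (psi x * gauss G (x - w) + psi x * gauss G (x - (- w)))
      - 2 * (psi x * gauss G (x - 0)))).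
      rewrite (lin _ _ _ _ _ _ (ig w) (ig (- w)) (ig 0) (psi_gauss w) (psi_gauss (- w))
        (psi_gauss 0)) wE.
      have -> : phase om (- w) l = - (h * y) by rewrite -wE /phase !dotvE frobNr.
      have -> : phase om 0 l = 0 by rewrite /phase dotvE frob0r.
      by rewrite cosN cos0; ring.
    move=> x; rewrite /rem subr0 opprK.
    have -> : gderiv G (- w) x = - gderiv G w x by rewrite -scaleN1r gderivZ mulN1r.
    by move: (psi x) (gauss G _) (gauss G _) (gauss G _) (gderiv _ _ _) => A B C D F; ring.
  have := le_normr_lint_mul mpsi psi_le (ivecD (irem w) (irem (- w))).
  rewrite E normrN normrM (ger0_norm (_ : 0 <= 2))//.
  rewrite ger0_norm; last by rewrite mulr_ge0// subr_ge0 cos_le1.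
  have L1 : lint (fun x => `|rem w x + rem (- w) x|) <= 2 * (h ^+ 2 * q * I).
    have iw := ivec_norm (irem w); have iNw := ivec_norm (irem (- w)).
    apply: (@le_trans _ _ (lint (fun x => `|rem w x| + `|rem (- w) x|))).
      apply: (le_lint (ivec_norm (ivecD (irem w) (irem (- w)))) (ivecD iw iNw)) => x.
      exact: ler_normD.
    rewrite (lintD iw iNw).
    have t1 := gauss_taylor_L1 Gpos gauss_int w.
    have t2 := gauss_taylor_L1 Gpos gauss_int (- w).
    rewrite normG2N /w normG2Z -/q -/I in t1 t2.
    by rewrite mulr_natl mulr2n lerD.
  move=> le1; have := le_trans le1 (ler_wpM2l rho0 L1).
  have a1 (A B C : R) : 2 * A <= B * (2 * C) -> A <= B * C by move=> *; lra.
  move=> /a1 le2; rewrite (le_trans le2)//.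
  by rewrite le_eqVlt; apply/orP; left; apply/eqP; ring.
(* Letting h -> 0 replaces 1 - cos(h y) by h^2 y^2 / 2. The absolute value of y meets the sign
   condition of [one_sub_cos_ge]. *)
have lim : weight d l * (`|y| ^+ 2 / 2) <= rho * (q * I).
  apply: (@le_of_cubic_error _ _ _ (weight d l * (`|y| ^+ 3 / 2)) 1) => // h h0 _.
  have cE : cos (h * y) = cos (h * `|y|).
    by rewrite -(cos_norm (h * y)) normrM (ger0_norm (ltW h0)).
  have hy0 : 0 <= h * `|y| by rewrite mulr_ge0// ltW.
  apply: aux; rewrite (le_trans _ (step h h0))// cE ler_wpM2l//.
  exact: one_sub_cos_ge.
rewrite real_normK ?num_real// in lim.
(* One factor |d_l| is cancelled, which needs it nonzero; otherwise the claim is trivial. *)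
have [d0|d0] := eqVneq (weight d l) 0; first by rewrite d0 mul0r mulr_ge0// sqr_ge0.
have s0 : 0 < Num.sqrt (weight d l) by rewrite sqrtr_gt0 lt_def d0.
have lim2 : Num.sqrt (weight d l) * y ^+ 2 <= Num.sqrt (weight c l) * (2 * (q * I)).
  by rewrite -(ler_pM2l s0); exact: aux2 (esym (sqr_sqrtr wd0)) lim.
rewrite -(sqr_sqrtr wd0) -(sqr_sqrtr wc0) -!exprMn ler_sqr ?nnegrE//.
- by rewrite mulr_ge0 ?sqrtr_ge0 ?sqr_ge0.
- by rewrite !mulr_ge0 ?sqrtr_ge0.
Qed.

(** The decay factor is the same for all l, so the coordinates sum to the l2 norm of the weights
    c_l. This is the first entry of the maximum in D', once q is bounded through the least
    eigenvalue. *)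
Lemma speed2_fmeas_le v : speed2 d om v <=
  Num.sqrt (\sum_l (c l 0 ^+ 2 + c l 1 ^+ 2)) * (2 * (normG2 G v * lint (gauss G))).
Proof.
have I0 : 0 <= lint (gauss G) by apply: lint_ge0 => x; exact: gauss_ge0.
have q0 := normG2_ge0 Gpos v.
rewrite -[X in _ * X]ger0_norm ?mulr_ge0// -sqrtr_sqr -sqrtrM; last first.
  by apply: sumr_ge0 => l _; rewrite addr_ge0 ?sqr_ge0.
rewrite /speed2 /cnorm2 ler_wsqrtr// mulr_suml; apply: ler_sum => l _.
exact: fourier_decay.
Qed.

End fourier_measurement.

(** * Complex measurements as real matrices *)

Section measurement_matrix.
Context {R : realType} {p m : nat}.

Definition reim (z : 'cV[R[i]]_m) : 'M[R]_(m, 2) :=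
  \matrix_(l, b) (if b == 0 then complex.Re (z l 0) else complex.Im (z l 0)).

Lemma sqnormC_reim z : sqnormC z = norm2 (reim z) ^+ 2.
Proof.
rewrite norm2_sqr /sqnormC; apply: eq_bigr => l _.
rewrite big_ord_recl big_ord1 !mxE/=; case: (z l 0) => a b /=.
by rewrite sqr_sqrtr ?addr_ge0 ?sqr_ge0// !expr2.
Qed.

Lemma reimB z w : reim (z - w) = reim z - reim w.
Proof.
apply/matrixP => l b; rewrite !mxE; case: ifP => _.
  by case: (z l 0) => ? ?; case: (w l 0) => ? ?.
by case: (z l 0) => ? ?; case: (w l 0) => ? ?.
Qed.

Variables (alpha : 'I_m -> 'cV[R]_p -> R[i]) (c : 'I_m -> R[i]) (om : 'I_m -> 'cV[R]_p).
Hypothesis alphaE : forall l t,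
  alpha l t = c l * Complex (cos (dotv (om l) t)) (- sin (dotv (om l) t)).

Let cm := reim (\col_l c l).

Lemma reim_alpha t l b :
  (if b == 0 then complex.Re (alpha l t) else complex.Im (alpha l t)) =
  cexp cm (phase om t) l b.
Proof.
rewrite alphaE !mxE/= /phase; case: (c l) => c1 c2 /=.
by case: ifP => _; ring.
Qed.

Lemma reim_measurement nu f : vdens nu f -> reim (measurement alpha nu) = fmeas cm om f.
Proof.
move=> nuf; apply/matrixP => l b; rewrite !mxE/=.
have E b' : sint nu (fun t => cexp cm (phase om t) l b') = fmeas cm om f l b'.
  rewrite mxE; apply: (charge_integral_density nuf (mvec_cexp cm om l b')) => x.
  exact: cexp_entry_le.
have := E b; rewrite mxE => <-; case: ifP => b0.
  congr sint; apply/funext => t; rewrite -reim_alpha b0//.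
by congr sint; apply/funext => t; rewrite -reim_alpha b0.
Qed.

(** A weighted exponential has constant modulus, so the supremum is over a singleton. *)
Lemma sup_normc_alpha l :
  sup (range (fun t => Normc.normc (alpha l t) ^+ 2)) = cm l 0 ^+ 2 + cm l 1 ^+ 2.
Proof.
rewrite -[RHS]sup1; congr sup; apply/seteqP.
have E t : Normc.normc (alpha l t) ^+ 2 = cm l 0 ^+ 2 + cm l 1 ^+ 2.
  rewrite alphaE !mxE/=; case: (c l) => c1 c2 /=.
  rewrite sqr_sqrtr ?addr_ge0 ?sqr_ge0//.
  rewrite -[RHS]mulr1 -(cos2Dsin2 (dotv (om l) t)); ring.
split => [_ [t _ <-]|_ ->] /=; first exact: E.
by exists 0.
Qed.

End measurement_matrix.

(** * The RIP on tangent vectors *)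

Lemma finite_pos_lb (R : realFieldType) (I : finType) (f : I -> R) :
  (forall i, 0 < f i) -> exists2 c : R, 0 < c & forall i, c <= f i.
Proof.
(* The inverse of 1 plus the sum of inverses is positive for an empty index set too. *)
move=> f0; exists (1 + \sum_i (f i)^-1)^-1.
  by rewrite invr_gt0 ltr_wpDr// sumr_ge0// => i _; rewrite invr_ge0 ltW.
move=> i; rewrite -[leRHS]invrK lef_pV2 ?posrE ?invr_gt0//.
  rewrite (bigD1 i)//= addrCA lerDl addr_ge0// sumr_ge0// => j _.
  by rewrite invr_ge0 ltW.
by rewrite ltr_wpDr// sumr_ge0// => j _; rewrite invr_ge0 ltW.
Qed.

(** * Perturbations staying in the parameter set *)

Section small_steps.
Context {R : realType} {k p : nat}.
Variable G : 'M[R]_p.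
Hypothesis Gpos : posdefmx G.

(** Halving the separation leaves a slack of eps/2. The radius is not relaxed, so its slack comes
    from strictness and finiteness of the number of means. *)
Lemma Theta_small_step (eps rad : R) (theta u : 'rV[R]_(k + k * p)) :
  0 < eps -> Theta k eps rad G theta ->
  exists2 h0 : R, 0 < h0 /\ h0 <= 1 & forall h, 0 < h -> h <= h0 ->
  Theta k (eps / 2) rad G (theta + h *: u).
Proof.
have aux1 (A B V h c r : R) : h * (V + 1) <= c -> c <= r - A -> h * B <= h * V ->
  0 < h -> A + h * B < r by move=> *; lra.
have aux2 (A S V W h e : R) : h * (W + 1) <= e / 2 -> e < A -> A <= S + h * V ->
  h * V <= h * W -> 0 < h -> e / 2 < S by move=> *; lra.
have aux (x h : R) : 0 <= x -> 0 < h -> 0 < x + 1 by move=> *; lra.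
move=> eps0 [trad tsep].
have [c c0 cP] : exists2 c : R, 0 < c & forall i, c <= rad - norm2 (mean theta i).
  by apply: finite_pos_lb => i; rewrite subr_gt0.
pose U := norm2 u; have U0 : 0 <= U := norm2_ge0 _.
pose W := \sum_i \sum_j normG G (mean u i - mean u j).
have nG w : 0 <= normG G w by exact: sqrtr_ge0.
have W0 : 0 <= W by apply: sumr_ge0 => i _; apply: sumr_ge0.
have WP i j : normG G (mean u i - mean u j) <= W.
  rewrite /W (bigD1 i)//= (bigD1 j)//= -addrA lerDl addr_ge0 ?sumr_ge0// => l _.
  exact: sumr_ge0.
exists (Num.min 1 (Num.min (c / (U + 1)) (eps / 2 / (W + 1)))).
  split; last by rewrite ge_min lexx.
  by rewrite !lt_min ltr01/= !divr_gt0// ?(aux _ 1).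
move=> h h0; rewrite !le_min => /and3P[_ h1 h2].
rewrite ler_pdivlMr ?(aux _ 1)// in h1; rewrite ler_pdivlMr ?(aux _ 1)// in h2.
split=> [i|i j ij]; rewrite !meanD !meanZ.
  rewrite (le_lt_trans (norm2D _ _))// norm2Z (ger0_norm (ltW h0)).
  have : h * norm2 (mean u i) <= h * U by rewrite ler_wpM2l ?mean_le_norm2// ltW.
  by move=> le1; exact: aux1 h1 (cP i) le1 h0.
have -> : mean theta i + h *: mean u i - (mean theta j + h *: mean u j) =
    (mean theta i - mean theta j) + h *: (mean u i - mean u j).
  by rewrite scalerBr opprD addrACA.
move: (tsep i j ij) (WP i j).
set s := mean theta i - _; set v := mean u i - _ => ts vW.
have le1 : normG G s <= normG G (s + h *: v) + h * normG G v.
  rewrite -[X in normG G X <= _](addrK (h *: v)) (le_trans (normGD Gpos _ _))//.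
  by rewrite -scaleNr normGZ normrN (ger0_norm (ltW h0)).
have le2 : h * normG G v <= h * W by rewrite ler_wpM2l// ltW.
exact: aux2 h2 ts le1 le2 h0.
Qed.

End small_steps.

Section tangent_RIP.
Context {R : realType} {k p m : nat}.
Variable G : 'M[R]_p.
Hypotheses (Gpos : posdefmx G) (gauss_int : ivec (gauss G)).
Variable K : 'cV[R]_p -> R.
Hypothesis K_gaussian : gaussian_kernel G K.
Variables (alpha : 'I_m -> 'cV[R]_p -> R[i]) (c : 'I_m -> R[i]) (om : 'I_m -> 'cV[R]_p).
Hypothesis alphaE : forall l t,
  alpha l t = c l * Complex (cos (dotv (om l) t)) (- sin (dotv (om l) t)).
Variables (eps rad gamma : R).
Hypothesis eps_gt0 : 0 < eps.
Hypotheses (gamma_ge0 : 0 <= gamma) (gamma_lt1 : gamma < 1).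
Hypothesis A_RIP : RIP alpha K (charge_diff (Sigma k (eps / 2) rad G)) gamma.

Local Notation d := (fmeas (reim (\col_l c l)) om (gauss G)).

Lemma reim_measurement_phi (theta : 'rV[R]_(k + k * p)) :
  reim (measurement alpha (phi G theta)) = forward d om theta.
Proof.
rewrite (reim_measurement alphaE (vdens_phi gauss_int theta)).
exact: fmeas_mix_density.
Qed.

Lemma dmix_densityZ (theta u : 'rV[R]_(k + k * p)) h x :
  dmix_density G theta (h *: u) x = h * dmix_density G theta u x.
Proof.
rewrite /dmix_density mulr_sumr; apply: eq_bigr => i _.
by rewrite amplitudeZ meanZ gderivZ mulrDr !mulrA (mulrC h (amplitude theta i)).
Qed.

(** The counterpart of [KF_perturb_scale] on the side of the measurements. *)
Let increment_sqr (J e : 'M[R]_(m, 2)) (h N : R) : 0 <= h -> h <= 1 -> 0 <= N ->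
  norm2 e <= h ^+ 2 * N ->
  `|norm2 (h *: J + e) ^+ 2 - h ^+ 2 * norm2 J ^+ 2| <=
    (2 * norm2 J * N + N ^+ 2) * h ^+ 3.
Proof.
have aux (j f q : R) : 0 <= q -> `|f| <= h * (j * (h ^+ 2 * N)) -> q <= h ^+ 3 * N ^+ 2 ->
    `|(h * j) ^+ 2 + 2 * f + q - h ^+ 2 * j ^+ 2| <= (2 * j * N + N ^+ 2) * h ^+ 3.
  by rewrite !ler_norml => q0 /andP[f1 f2] q1; apply/andP; split; lra.
move=> h0 h1 N0 eN; rewrite norm2D_sqr norm2Z (ger0_norm h0) frobZl.
have b1 : `|h * frob J e| <= h * (norm2 J * (h ^+ 2 * N)).
  rewrite normrM (ger0_norm h0) ler_wpM2l// (le_trans (frob_CS _ _))//.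
  by rewrite ler_wpM2l.
have b2 : norm2 e ^+ 2 <= h ^+ 3 * N ^+ 2.
  rewrite (@le_trans _ _ ((h ^+ 2 * N) ^+ 2))//.
    by rewrite ler_sqr ?nnegrE// mulr_ge0// sqr_ge0.
  by rewrite exprMn -exprM ler_wpM2r ?sqr_ge0// ler_wiXn2l.
exact: aux (sqr_ge0 _) b1 b2.
Qed.

(* Apply the RIP to phi(theta + h u) - phi(theta) and let h tend to 0. *)
Lemma tangent_RIP (theta u : 'rV[R]_(k + k * p)) : Theta k eps rad G theta ->
  (1 - gamma) * KF K (dmix_density G theta u) (dmix_density G theta u)
    <= norm2 (jacobian d om theta u) ^+ 2 /\
  norm2 (jacobian d om theta u) ^+ 2
    <= (1 + gamma) * KF K (dmix_density G theta u) (dmix_density G theta u).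
Proof.
have aux (a b e h : R) : a - b = h * e + 1 * (a - b - h * e) by ring.
move=> thT; have [h0 [h00 h01] hP] := Theta_small_step Gpos u eps_gt0 thT.
have thT2 : Theta k (eps / 2) rad G theta.
  case: thT => t1 t2; split=> // i j ij; rewrite (lt_trans _ (t2 i j ij))//.
  by rewrite ltr_pdivrMr// ltr_pMr// ltr1n.
set D := dmix_density G theta u; set J := jacobian _ _ _ _.
have Di : ivec D := ivec_dmix_density Gpos gauss_int theta u.
have [M1 M10 M1P] := mix_error_L1 Gpos gauss_int theta u.
have [M2 M20 M2P] := KF_perturb_scale Gpos K_gaussian Di M10.
pose N := curvature d om theta u; have N0 : 0 <= N := curvature_ge0 _ _ _ _.
pose M3 := 2 * norm2 J * N + N ^+ 2.
(* A and B are the squared kernel norm and the squared measurement of the secant; both are h^2 times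
   their tangent values up to order h^3. *)
have step h : 0 < h -> h <= h0 -> exists A B : R,
    [/\ `|A - h ^+ 2 * KF K D D| <= M2 * h ^+ 3,
        `|B - h ^+ 2 * norm2 J ^+ 2| <= M3 * h ^+ 3,
        (1 - gamma) * A <= B & B <= (1 + gamma) * A].
  move=> hpos hh0; have h1 : h <= 1 := le_trans hh0 h01.
  pose nu := charge_sub (phi G (theta + h *: u)) (phi G theta).
  have nuS : charge_diff (Sigma k (eps / 2) rad G) nu.
    exists (phi G (theta + h *: u)).
      have [a1 a2] := hP h hpos hh0.
      by exists (amplitude (theta + h *: u)), (mean (theta + h *: u)); split.
    exists (phi G theta) => //; case: thT2 => a1 a2.
    by exists (amplitude theta), (mean theta); split.
  exists (knorm2 K nu), (sqnormC (measurement alpha nu)).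
  have dens := vdens_phi_sub gauss_int (theta + h *: u) theta.
  have [R1 R2] := A_RIP nuS; split => //.
    rewrite (knorm2_vdens Gpos K_gaussian dens).
    rewrite (_ : (fun x => _) = (fun x => h * D x + 1 * mix_error G theta (h *: u) x)).
      apply: M2P => //; [exact: ivec_mix_error|exact: ltW|exact: M1P].
    apply/funext => x; rewrite /mix_error dmix_densityZ -/(D x).
    exact: aux.
  rewrite sqnormC_reim (reim_measurement alphaE dens).
  rewrite (fmeasB _ _ (ivec_mix_density gauss_int _) (ivec_mix_density gauss_int _)).
  rewrite (fmeas_mix_density gauss_int _ _ (theta + h *: u)).
  rewrite (fmeas_mix_density gauss_int _ _ theta).
  rewrite -[X in norm2 X](subrKC (h *: J)).
  apply: increment_sqr => //; first exact: ltW.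
  by rewrite -jacobianZ -curvatureZ; exact: forward_taylor.
have g1 : 0 <= 1 - gamma by rewrite subr_ge0 ltW.
have g2 : 0 <= 1 + gamma by rewrite addr_ge0.
have low (g A B a b h X Y : R) : 0 <= g -> `|A - h ^+ 2 * a| <= X * h ^+ 3 ->
    `|B - h ^+ 2 * b| <= Y * h ^+ 3 -> g * A <= B ->
    g * a * h ^+ 2 <= b * h ^+ 2 + (g * X + Y) * h ^+ 3.
  move=> g0; rewrite !ler_norml => /andP[A1 _] /andP[_ B2] gAB.
  have := ler_wpM2l g0 A1; lra.
have upp (g A B a b h X Y : R) : 0 <= g -> `|A - h ^+ 2 * a| <= X * h ^+ 3 ->
    `|B - h ^+ 2 * b| <= Y * h ^+ 3 -> B <= g * A ->
    b * h ^+ 2 <= g * a * h ^+ 2 + (g * X + Y) * h ^+ 3.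
  move=> g0; rewrite !ler_norml => /andP[_ A1] /andP[B2 _] gAB.
  have := ler_wpM2l g0 A1; lra.
split.
- apply: (@le_of_cubic_error _ _ _ ((1 - gamma) * M2 + M3) h0) => // h hpos hh0.
  by have [A [B [AE BE l1 l2]]] := step h hpos hh0; exact: low AE BE l1.
- apply: (@le_of_cubic_error _ _ _ ((1 + gamma) * M2 + M3) h0) => // h hpos hh0.
  by have [A [B [AE BE l1 l2]]] := step h hpos hh0; exact: upp AE BE l2.
Qed.

(** The tangent RIP is applied to one unit amplitude at the mean i0, moved along v. Membership in
    [Theta] constrains only the means, so the amplitudes are free to choose; the tangent is then a
    pure Gaussian derivative. *)
Lemma speed1_fmeas_le (theta : 'rV[R]_(k + k * p)) (i0 : 'I_k) v :
  Theta k eps rad G theta ->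
  speed1 d om v <= Num.sqrt (1 + gamma) * Num.sqrt (DK_const G K) * norm2 v.
Proof.
move=> [t1 t2].
pose th := of_params (fun i : 'I_k => (i == i0)%:R : R) (mean theta).
pose u : 'rV[R]_(k + k * p) := of_params (fun=> 0) (fun i => if i == i0 then v else 0).
have thT : Theta k eps rad G th by rewrite /Theta /= /th mean_of_params.
have [_] := tangent_RIP u thT.
have -> : dmix_density G th u = fun x => gderiv G v (x - mean theta i0).
  apply/funext => x; rewrite /dmix_density /th /u !amplitude_of_params !mean_of_params.
  rewrite (bigD1 i0)//= eqxx mul0r add0r mul1r big1 ?addr0// => i /negbTE ->.
  by rewrite !mul0r addr0.
have -> : jacobian d om th u = datom d om (mean theta i0) v.
  rewrite /jacobian /th /u !amplitude_of_params !mean_of_params.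
  rewrite (bigD1 i0)//= eqxx scale0r add0r scale1r big1 ?addr0// => i /negbTE ->.
  by rewrite !scale0r addr0.
rewrite norm2_datom (KF_gderiv_shift Gpos gauss_int K_gaussian) => h.
have g2 : 0 <= 1 + gamma by rewrite addr_ge0.
have DK : speed1 d om v ^+ 2 <= (1 + gamma) * (norm2 v ^+ 2 * DK_const G K).
  by rewrite (le_trans h)// ler_wpM2l// KF_gderiv_le.
have DK0 : 0 <= DK_const G K.
  rewrite /DK_const; apply: lint_ge0 => s; apply: lint_ge0 => t.
  by rewrite !mulr_ge0 ?gauss_ge0// (gaussian_kernel_ge0 K_gaussian).
rewrite -ler_sqr ?nnegrE ?speed1_ge0// ?mulr_ge0 ?sqrtr_ge0//.
rewrite !exprMn (sqr_sqrtr g2) (sqr_sqrtr DK0) (le_trans DK)//.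
by rewrite le_eqVlt; apply/orP; left; apply/eqP; ring.
Qed.

End tangent_RIP.

(** * From the kernel assumption to the basin of attraction *)

Section gaussian_integrability.
Context {R : realType} {p : nat}.
Variable G : 'M[R]_p.
Hypothesis Gpos : posdefmx G.
Variable K : 'cV[R]_p -> R.
Hypothesis K_gaussian : gaussian_kernel G K.

(* Otherwise [gauss_measure G 0] is the zero charge, by the fallback in
   [charge_density], and its K-norm is not 1. *)
Lemma ivec_gauss_of_unit : knorm K (gauss_measure G 0) = 1 -> ivec (gauss G).
Proof.
move=> K1; apply: contrapT => nint.
have E : gauss_measure G 0 = czero.
  rewrite /gauss_measure /with_density /charge_density; case: pselect => // intf.
  exfalso; apply: nint; rewrite /ivec.
  by rewrite (_ : gauss G = (fun t => gauss G (t - 0)))//; apply/funext => t; rewrite subr0.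
have dens : vdens czero (fun=> 0 : R) := has_density0 (lebesgue_tuple R p).
move: K1; rewrite E /knorm (knorm2_vdens Gpos K_gaussian dens) KFE.
rewrite (eq_lint (g := fun=> 0)); last by move=> s; rewrite mulr0.
by rewrite /lint /Rintegral integral0 sqrtr0 => /eqP; rewrite eq_sym oner_eq0.
Qed.

End gaussian_integrability.

(* The numbers of components, of coordinates and of measurements are k.+1,
   p.+1 and m.+1, so that a_1 and a_k are the amplitudes of index ord0 and
   ord_max; rad is the radius written R on paper. *)
Theorem theorem3p3 (R : realType) (k p m : nat)
  (Gamma : 'M[R]_p.+1) (eps rad : R)
  (Gamma_posdef : posdefmx Gamma) (eps_gt0 : 0 < eps) (rad_gt0 : 0 < rad)
  (K : 'cV[R]_p.+1 -> R) (cK : R)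
  (K_gaussian : gaussian_kernel Gamma K)
  (cK_ge0 : 0 <= cK) (cK_lt1 : cK < 1)
  (K_assumption : kernel_assumption Gamma K k.+1 eps cK)
  (dK : R) (dK_gt0 : 0 < dK)
  (dK_le : forall w s, dK * norm2 w ^+ 2 <= knorm2 K (dgauss_measure Gamma w s))
  (alpha : 'I_m.+1 -> 'cV[R]_p.+1 -> R[i])
  (alpha_fourier : forall l, weighted_fourier (alpha l))
  (gamma : R) (gamma_ge0 : 0 <= gamma) (gamma_lt1 : gamma < 1)
  (A_RIP : RIP alpha K (charge_diff (Sigma k.+1 (eps / 2) rad Gamma)) gamma)
  (x0 : smeasure) (x0_Sigma : Sigma k.+1 eps rad Gamma x0)
  (y : 'cV[R[i]]_m.+1) (y_def : y = measurement alpha x0)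
  (thetas : 'rV[R]_(k.+1 + k.+1 * p.+1)) :
  let g := fun theta : 'rV[R]_(k.+1 + k.+1 * p.+1) =>
     sqnormC (measurement alpha (phi Gamma theta) - y) in
  let a := amplitude thetas in
  let t := mean thetas in
  forall (thetas_Theta : Theta k.+1 eps rad Gamma thetas)
  (thetas_min : forall theta, Theta k.+1 eps rad Gamma theta ->
     g thetas <= g theta)
  (a1_gt0 : 0 < `|a ord0|)
  (a_le : forall i j : 'I_k.+1, (i <= j)%N -> `|a i| <= `|a j|)
  (C : R) (C_gt0 : 0 < C)
  (C_lipschitz : forall theta,
     norm2 (theta - thetas) <
       2 * Num.min (eps * Num.sqrt (lambda_min Gamma) / 8) (`|a ord0| / 2) ->
     knorm K (charge_sub (phi Gamma theta) (phi Gamma thetas))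
       <= C * norm2 (theta - thetas)),
  let beta :=
    Num.min (Num.min (eps * Num.sqrt (lambda_min Gamma) / 8) (`|a ord0| / 2))
      ((1 - gamma) * (1 - cK) * Num.min 1 (dK * `|a ord0| ^+ 2) /
       (8 * C * Num.sqrt (1 + gamma) *
        (Num.sqrt (1 + gamma) * Num.sqrt (1 + cK) * Num.sqrt (DK_const Gamma K)
         + 2 * `|a ord_max| * DAK_const Gamma alpha))) in
  (forall i, norm2 (t i) <= rad - 2 * beta) ->
  basin_of_attraction g thetas [set theta | norm2 (theta - thetas) < beta].
Proof.
have alg1 (x s l I D : R) : s * (l * I) * x <= D * x -> s * (2 * (x * l * I)) <= 2 * D * x.
  by move=> ?; lra.
have alg2 (s n b q : R) : n <= s -> b * (8 * q) <= n -> 2 * q * b <= s / 4.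
  by move=> *; lra.
have alg3 (s D x : R) : s <= 2 * D * x -> 2 * s <= 4 * D * x by move=> *; lra.
have alg4 (b n : R) : b * n <= b ^+ 2 + n ^+ 2.
  by have := sqr_ge0 (b - n); have := sqr_ge0 b; have := sqr_ge0 n; lra.
have alg5 (x q D b n : R) : 2 * (x + 2 * q * D) * (b ^+ 2 + n ^+ 2) =
    4 * (q * D) * n ^+ 2 + x * (b ^+ 2 + n ^+ 2) +
    (4 * ((q * D) * b ^+ 2) + x * (b ^+ 2 + n ^+ 2)) by ring.
have alg6 (q D n : R) : q * (4 * D * n ^+ 2) = 4 * (q * D) * n ^+ 2 by ring.
move=> g a t thetas_Theta thetas_min a1_gt0 a_le C C_gt0 C_lipschitz beta _.
have [K_unit K_coh] := K_assumption.
have gauss_int : ivec (gauss Gamma).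
  exact (ivec_gauss_of_unit Gamma_posdef K_gaussian (K_unit 0)).
have /choice[c alphaE] (l : 'I_m.+1) : exists co : R[i] * 'cV[R]_p.+1, forall t0,
    alpha l t0 = co.1 * Complex (cos (dotv co.2 t0)) (- sin (dotv co.2 t0)).
  by have [c [om [_ E]]] := alpha_fourier l; exists (c, om).
pose om l := (c l).2.
pose cm := reim (\col_l (c l).1).
pose d := fmeas cm om (gauss Gamma).
have phiE theta : reim (measurement alpha (phi Gamma theta)) = forward d om theta.
  exact: (reim_measurement_phi gauss_int alphaE theta).
have gE theta : g theta = norm2 (forward d om theta - reim y) ^+ 2.
  by rewrite /g sqnormC_reim reimB phiE.
have yE : reim y = forward d om thetas.
  have [b [s [s1 s2 x0E]]] := x0_Sigma.
  have E : phi Gamma (of_params b s) = x0.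
    by rewrite /phi amplitude_of_params mean_of_params x0E.
  have ythE : reim y = forward d om (of_params b s) by rewrite y_def -E phiE.
  have := thetas_min (of_params b s); rewrite /Theta /= mean_of_params => /(_ (conj s1 s2)).
  rewrite !gE ythE subrr norm2_0 expr0n => h.
  have /eqP : norm2 (forward d om thetas - forward d om (of_params b s)) ^+ 2 = 0.
    by apply/le_anti; rewrite h sqr_ge0.
  by rewrite sqrf_eq0 norm2_eq0 subr_eq0 => /eqP.
have -> : g = fun theta => norm2 (forward d om theta - forward d om thetas) ^+ 2.
  by apply/funext => theta; rewrite gE yE.
have lam0 := lambda_min_gt0 Gamma_posdef.
have gaussI0 : 0 <= lint (gauss Gamma) by apply: lint_ge0 => x; exact: gauss_ge0.
have speed1_le v : speed1 d om v <=
    Num.sqrt (1 + gamma) * Num.sqrt (DK_const Gamma K) * norm2 v.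
  exact: (speed1_fmeas_le Gamma_posdef gauss_int K_gaussian alphaE eps_gt0 gamma_ge0
    gamma_lt1 A_RIP ord0 v thetas_Theta).
(* The direction is negated to absorb the opposite sign conventions. *)
have dgaussE w s : vdens (dgauss_measure Gamma w s) (fun x => gderiv Gamma (- w) (x - s)).
  have := vdens_dgauss Gamma_posdef gauss_int w s.
  rewrite (_ : (fun x => -1 * _) = (fun x => gderiv Gamma (- w) (x - s)))//.
  by apply/funext => x; rewrite -(scaleN1r w) gderivZ.
have KFd w s : knorm2 K (dgauss_measure Gamma w s) =
    KF K (gderiv Gamma (- w)) (gderiv Gamma (- w)).
  rewrite (knorm2_vdens Gamma_posdef K_gaussian (dgaussE w s)).
  exact: KF_gderiv_shift.
have dK_KF v : dK * norm2 v ^+ 2 <= KF K (gderiv Gamma v) (gderiv Gamma v).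
  by have := dK_le (- v) 0; rewrite KFd opprK norm2N.
(* Comparing d_K |w|^2 <= |w|^2 D_K at a nonzero w. Positivity keeps the denominator of beta
   nonzero; division by 0 would make beta equal to 0. *)
have DK0 : 0 < DK_const Gamma K.
  pose w : 'cV[R]_p.+1 := delta_mx 0 0.
  have w0 : 0 < norm2 w ^+ 2.
    rewrite exprn_gt0// norm2_gt0; apply/eqP => /matrixP/(_ 0 0).
    by rewrite !mxE !eqxx/= => /eqP; rewrite oner_eq0.
  have := le_trans (dK_KF w) (KF_gderiv_le Gamma_posdef gauss_int K_gaussian w).
  by rewrite mulrC ler_pM2l//; exact: lt_le_trans.
pose D' := DAK_const Gamma alpha.
have csum0 : 0 <= \sum_l (cm l 0 ^+ 2 + cm l 1 ^+ 2).
  by apply: sumr_ge0 => l _; rewrite addr_ge0 ?sqr_ge0.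
have D'_ge : Num.sqrt (\sum_l (cm l 0 ^+ 2 + cm l 1 ^+ 2)) *
    ((lambda_min Gamma)^-1 * lint (gauss Gamma)) <= D'.
  rewrite /D' /DAK_const.
  under [X in _ <= Num.sqrt X * _]eq_bigr do rewrite (sup_normc_alpha alphaE).
  by rewrite ler_wpM2l ?sqrtr_ge0// le_max lexx.
have D'0 : 0 <= D'.
  by rewrite (le_trans _ D'_ge)// !mulr_ge0 ?sqrtr_ge0// invr_ge0 ltW.
have speed2_le v : speed2 d om v <= 2 * D' * norm2 v ^+ 2.
  rewrite (le_trans (speed2_fmeas_le Gamma_posdef gauss_int cm om v))//.
  set S := Num.sqrt _; have S0 : 0 <= S by exact: sqrtr_ge0.
  apply: (@le_trans _ _ (S * (2 * (norm2 v ^+ 2 / lambda_min Gamma * lint (gauss Gamma))))).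
    by rewrite ler_wpM2l// ler_wpM2l// ler_wpM2r// normG2_le_lambda_min.
  have := ler_wpM2r (sqr_ge0 (norm2 v)) D'_ge; rewrite -/S.
  exact: alg1.
pose a1 := `|a ord0|; pose ak := `|a ord_max|.
have a1_le i : a1 <= `|a i| by exact: a_le.
have le_ak i : `|a i| <= ak by apply: a_le; rewrite -ltnS.
have g1 : 0 < 1 - gamma by rewrite subr_gt0.
have g2 : 1 <= 1 + gamma by rewrite lerDl.
have k1 : 0 < 1 - cK by rewrite subr_gt0.
pose mu := (1 - gamma) * (1 - cK) * Num.min 1 (dK * a1 ^+ 2).
have min0 : 0 < Num.min 1 (dK * a1 ^+ 2).
  by rewrite lt_min ltr01 mulr_gt0// exprn_gt0.
have mu0 : 0 < mu by rewrite !mulr_gt0.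
have mu1 : mu <= 1.
  have m1 : Num.min 1 (dK * a1 ^+ 2) <= 1 by rewrite ge_min lexx.
  have p1 : (1 - gamma) * (1 - cK) <= 1.
    by rewrite mulr_ile1 ?(ltW g1) ?(ltW k1)// gerBl.
  by rewrite /mu mulr_ile1// ?(ltW min0)// mulr_ge0 ?(ltW g1) ?(ltW k1).
pose sg := Num.sqrt (1 + gamma).
have sg1 : 1 <= sg by rewrite -[X in X <= _]sqrtr1 ler_wsqrtr.
have sg0 : 0 < sg := lt_le_trans ltr01 sg1.
pose sk := Num.sqrt (1 + cK).
have sk1 : 1 <= sk by rewrite -[X in X <= _]sqrtr1 ler_wsqrtr// lerDl.
pose sD := Num.sqrt (DK_const Gamma K).
have sD0 : 0 < sD by rewrite sqrtr_gt0.
pose Q := sg * sk * sD + 2 * ak * D'.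
have Q0 : 0 < Q.
  have akD0 : 0 <= 2 * ak * D' by rewrite (mulr_ge0 _ D'0)// mulr_ge0// normr_ge0.
  rewrite ltr_pwDl// (mulr_gt0 _ sD0)// (mulr_gt0 sg0)//.
  exact: lt_le_trans sk1.
(* Moving only a_1 by b0 changes phi by b0 times a Gaussian of K-norm 1, so b0 <= C b0. The radius
   of the Lipschitz condition is 2 b0, which admits this step. *)
have C1 : 1 <= C.
  pose b0 := Num.min (eps * Num.sqrt (lambda_min Gamma) / 8) (a1 / 2).
  have b00 : 0 < b0 by rewrite lt_min !divr_gt0 ?mulr_gt0 ?sqrtr_gt0.
  pose u : 'rV[R]_(k.+1 + k.+1 * p.+1) :=
    of_params (fun i => (i == ord0)%:R * b0) (fun=> 0).
  have uE : norm2 u = b0.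
    apply/eqP; rewrite -(@eqrXn2 _ 2)//; last exact: ltW.
    rewrite norm2_params /u amplitude_of_params mean_of_params.
    rewrite (bigD1 ord0)// eqxx mul1r norm2_0 expr0n addr0 big1 => [|i /negbTE ->].
      by rewrite /= addr0.
    by rewrite mul0r expr0n /= add0r.
  have := C_lipschitz (thetas + u); rewrite addrAC subrr add0r uE => /(_ _).
  have lt2 : b0 < 2 * b0 by rewrite mulr_natl mulr2n ltrDl.
  move=> /(_ lt2).
  have dens := vdens_phi_sub gauss_int (thetas + u) thetas.
  rewrite /knorm (knorm2_vdens Gamma_posdef K_gaussian dens).
  have gi := ivec_gauss gauss_int (t ord0).
  rewrite (_ : (fun x => _) = (fun x => b0 * gauss Gamma (x - t ord0) +
     0 * gderiv Gamma 0 (x - t ord0))); last first.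
    apply/funext => x; rewrite mul0r addr0 /mix_density -sumrB.
    rewrite (bigD1 ord0)//= big1 ?addr0 => [|i /negbTE i0].
      rewrite amplitudeD meanD /u amplitude_of_params mean_of_params eqxx addr0.
      by rewrite mul1r mulrDl addrC addKr.
    rewrite amplitudeD meanD /u amplitude_of_params mean_of_params i0 addr0.
    by rewrite mul0r addr0 subrr.
  rewrite (KF_gauss_gderiv Gamma_posdef gauss_int K_gaussian K_unit) expr0n mul0r addr0.
  rewrite sqrtr_sqr (ger0_norm (ltW b00)) => h.
  by rewrite -(ler_pM2r b00) mul1r.
have betaE : beta = Num.min (Num.min (eps * Num.sqrt (lambda_min Gamma) / 8) (a1 / 2))
  (mu / (8 * C * sg * Q)) by [].
have den0 : 0 < 8 * C * sg * Q.
  by rewrite (mulr_gt0 _ Q0)// (mulr_gt0 _ sg0)// mulr_gt0.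
have beta0 : 0 < beta.
  rewrite betaE !lt_min (divr_gt0 mu0 den0) andbT; apply/andP; split.
    by rewrite divr_gt0// mulr_gt0// sqrtr_gt0.
  by rewrite divr_gt0.
have beta_le : beta * (8 * C * sg * Q) <= mu.
  by rewrite -ler_pdivlMr// betaE ge_min lexx orbT.
have smu0 : 0 < Num.sqrt mu by rewrite sqrtr_gt0.
apply: (@least_squares_basin _ _ _ _ _ _ _ (Num.sqrt mu) (2 * Q)) => //.
(* The 8 of beta is 2 from the curvature bound 2 Q times 4 from the required s / 4. Both C sg >= 1
   and mu <= sqrt mu, as mu <= 1, are used. *)
- have smu : mu <= Num.sqrt mu.
    rewrite -{1}(sqr_sqrtr (ltW mu0)) expr2 ler_piMl ?(ltW smu0)//.
    by rewrite -[leRHS]sqrtr1 ler_wsqrtr.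
  have : beta * (8 * Q) <= mu.
    rewrite (le_trans _ beta_le)// ler_wpM2l ?(ltW beta0)//.
    have : 1 <= C * sg by rewrite -[X in X <= _]mulr1 ler_pM.
    move=> Cs; rewrite -(mulrA 8) -mulrA ler_wpM2l// ler_peMl ?(ltW Q0)//.
  exact: alg2 smu.
- move=> u; rewrite -ler_sqr ?nnegrE ?mulr_ge0 ?sqrtr_ge0// exprMn (sqr_sqrtr (ltW mu0)).
  have [low _] := tangent_RIP Gamma_posdef gauss_int K_gaussian alphaE eps_gt0 gamma_ge0
    gamma_lt1 A_RIP u thetas_Theta.
  rewrite (le_trans _ low)// /mu -!mulrA ler_wpM2l ?(ltW g1)//.
  (* Blocks chosen so that their sum has the tangent density at [thetas] along u; the minus sign
     corrects the orientation of [dgauss_measure]. *)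
  pose nu i : smeasure := charge_add (cscale (amplitude u i) (gauss_measure Gamma (t i)))
    (cscale (a i) (dgauss_measure Gamma (- mean u i) (t i))).
  have nud i : vdens (nu i) (fun x => amplitude u i * gauss Gamma (x - t i) +
      a i * gderiv Gamma (mean u i) (x - t i)).
    apply: has_density_add; apply: has_density_scale; first exact: vdens_gauss.
    by have := dgaussE (- mean u i) (t i); rewrite opprK.
  have sumd : vdens (charge_sum nu) (dmix_density Gamma thetas u).
    exact: (has_density_sum nud).
  have := K_coh t thetas_Theta.2 (amplitude u) a (fun i => - mean u i).
  rewrite -/nu /= (knorm2_vdens Gamma_posdef K_gaussian sumd).
  apply: le_trans; rewrite ler_wpM2l ?(ltW k1)// norm2_params mulr_sumr.
  apply: ler_sum => i _.
  rewrite (knorm2_vdens Gamma_posdef K_gaussian (nud i)).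
  rewrite (KF_gauss_gderiv Gamma_posdef gauss_int K_gaussian K_unit) mulrDr lerD//.
    by rewrite ler_piMl ?sqr_ge0// ge_min lexx.
  rewrite (KF_gderiv_shift Gamma_posdef gauss_int K_gaussian).
  have ai2 : a1 ^+ 2 <= a i ^+ 2.
    by rewrite -[leRHS]real_normK ?num_real// ler_sqr ?nnegrE ?normr_ge0.
  apply: (@le_trans _ _ (dK * a i ^+ 2 * norm2 (mean u i) ^+ 2)).
    rewrite ler_wpM2r ?sqr_ge0// (@le_trans _ _ (dK * a1 ^+ 2))//.
      by rewrite ge_min lexx orbT.
    by rewrite ler_wpM2l// ltW.
  by rewrite mulrAC mulrC ler_wpM2l ?sqr_ge0.
(* Second-order motion costs 4 a_k D' n^2 per component. The mixed term is at most sg sD b n <= sg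
   sD (b^2 + n^2), and sk >= 1 turns sg sD into the summand of Q. *)
- move=> u; rewrite norm2_params mulr_sumr /curvature; apply: ler_sum => i _.
  have h1 : `|a i| * (2 * speed2 d om (mean u i)) <=
      ak * (4 * D' * norm2 (mean u i) ^+ 2).
    rewrite ler_pM ?mulr_ge0 ?speed2_ge0//.
    exact: alg3 (speed2_le (mean u i)).
  have h2 : `|amplitude u i| * speed1 d om (mean u i) <=
      `|amplitude u i| * (sg * sD * norm2 (mean u i)).
    by rewrite ler_wpM2l.
  rewrite (le_trans (lerD h1 h2))// -(real_normK (num_real (amplitude u i))).
  have sgD : sg * sD <= sg * sk * sD.
    rewrite ler_wpM2r ?(ltW sD0)// ler_peMr// (le_trans ler01)//.
  have sgD0 : 0 <= sg * sD by rewrite mulr_ge0 ?(ltW sD0)// (le_trans ler01).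
  have akD : 0 <= ak * D' by rewrite mulr_ge0 ?normr_ge0.
  rewrite /Q; move: (sg * sk * sD) (sg * sD) sgD sgD0 => X Y XY Y0.
  move: `|amplitude u i| (norm2 (mean u i)) (normr_ge0 (amplitude u i))
    (norm2_ge0 (mean u i)) => b n b0 n0.
  have e2 : b * (Y * n) <= Y * (b ^+ 2 + n ^+ 2).
    rewrite mulrCA ler_wpM2l//; exact: alg4.
  have e3 : Y * (b ^+ 2 + n ^+ 2) <= X * (b ^+ 2 + n ^+ 2).
    by rewrite ler_wpM2r// addr_ge0 ?sqr_ge0.
  have e4 : 0 <= (ak * D') * b ^+ 2 by rewrite mulr_ge0 ?sqr_ge0.
  have e5 : 0 <= X * (b ^+ 2 + n ^+ 2).
    by rewrite mulr_ge0 ?addr_ge0 ?sqr_ge0// (le_trans Y0).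
  rewrite alg6 (le_trans (lerD (lexx _) (le_trans e2 e3)))//.
  rewrite alg5.
  by rewrite lerDl addr_ge0// mulr_ge0.
Qed.
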